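(* Consider the reinforced stochastic process described in the context (a single process, i.e. $N=1$) with $\gamma=1$, i.e. $\lim_n n r_n=c>0$. Then $$\sqrt{n}\begin{pmatrix}Z_n-Z_\infty\\ N_n-Z_\infty\end{pmatrix}\longrightarrow\mathcal{N}\left(\mathbf{0},\; Z_\infty(1-Z_\infty)\begin{pmatrix}c^2&c^2\\ c^2&c^2+(c-1)^2\end{pmatrix}\right)\quad\text{stably}.$$
   Context: Model ($N=1$, weight matrix $W=[1]$). Let $(r_n)_{n\ge0}$ be real numbers with $0\le r_n<1$ and $\lim_n n r_n=c$ for a constant $c>0$. On a probability space $(\Omega,\mathcal{A},P)$ let $Z_0$ be a $[0,1]$-valued random variable and $(X_n)_{n\ge1}$ be $\{0,1\}$-valued random variables; set $\mathcal{F}_n=\sigma(Z_0)\vee\sigma(X_k:1\le k\le n)$. For every $n\ge0$, $P(X_{n+1}=1\mid\mathcal{F}_n)=Z_n$, where $Z_n=(1-r_{n-1})Z_{n-1}+r_{n-1}X_n$ for $n\ge1$. Put $N_0=0$ and $N_n=\frac1n\sum_{k=1}^nX_k$ for $n\ge 1$. $Z_\infty$ denotes the almost sure limit of the bounded martingale $(Z_n)_n$. Stable convergence: a kernel $K$ on $\mathbb{R}^d$ is a family $\{K(\omega):\omega\in\Omega\}$ of Borel probability measures on $\mathbb{R}^d$ with $\omega\mapsto\int f\,dK(\omega)$ $\mathcal{A}$-measurable for each bounded Borel $f$. Random vectors $Y_n$ converge stably to $K$ if for every $H\in\mathcal{A}$ with $P(H)>0$ the conditional laws $P(Y_n\in\cdot\mid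 H)$ converge weakly to $E[K(\cdot)\mid H]$. For a random positive semidefinite matrix $\Sigma$, $\mathcal{N}(\mathbf{0},\Sigma)$ denotes the kernel $\omega\mapsto\mathcal{N}(\mathbf{0},\Sigma(\omega))$ (possibly degenerate Gaussian). *)

(* Defs.v *)
From HB Require Import structures.
From mathcomp Require Import all_boot all_order all_algebra.
From mathcomp Require Import ring lra.
From mathcomp Require Import all_classical all_reals all_analysis.
From mathcomp Require Import measurable_realfun.

Set Implicit Arguments.
Unset Strict Implicit.
Unset Printing Implicit Defensive.

Import Order.TTheory GRing.Theory Num.Theory.
Import numFieldNormedType.Exports.

Local Open Scope classical_set_scope.
Local Open Scope ring_scope.

Section model.
Context d (T : measurableType d) (R : realType).

(* sigma(Z0) \/ sigma(X_k : 1 <= k <= n); the variable [X 0] is not used *)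
Definition natural_filtration (Z0 : T -> R) (X : nat -> T -> R) (n : nat) :
    set_system T :=
  <<s preimage_set_system [set: T] Z0 measurable `|`
      \bigcup_(k in [set k | (1 <= k <= n)%N])
        preimage_set_system [set: T] (X k) measurable >>.

(* [W] is a version of P(E | G) *)
Definition is_cond_prob (P : probability T R) (G : set_system T) (E : set T)
    (W : T -> R) : Prop :=
  [/\ forall B, measurable B -> G (W @^-1` B),
      P.-integrable [set: T] (EFin \o W) &
      forall A, G A -> (\int[P]_(w in A) (W w)%:E = P (E `&` A))%E].

(* equals 0 for n = 0 *)
Definition empirical_mean (X : nat -> {mfun T >-> R}) (n : nat) :
    {mfun T >-> R} :=
  n%:R^-1 *: \sum_(1 <= k < n.+1) X k.

End model.

Section pairing.
Context d (T : measurableType d) (R : realType) (f g : {mfun T >-> R}).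

Definition mfun_pair_fun (w : T) : R * R := (f w, g w).

Let measurable_mfun_pair : measurable_fun [set: T] mfun_pair_fun.
Proof. by apply: measurable_fun_pair. Qed.

HB.instance Definition _ :=
  isMeasurableFun.Build _ _ _ _ mfun_pair_fun measurable_mfun_pair.

Definition mfun_pair : {mfun T >-> (R * R)%type} := mfun_pair_fun.

End pairing.

Section stable_convergence.
Context d (T : measurableType d) (R : realType).

(* The conditional probability P( . | H); the second argument of [mnormalize]
   is only its value when P H = 0. *)
Definition cond_proba (P : probability T R) (H : set T) (mH : measurable H) :
    probability T R :=
  mnormalize (mrestr P mH) P.

Lemma cond_probaE (P : probability T R) (H : set T) (mH : measurable H) U :
  (0 < P H)%E -> cond_proba P mH U = (P (U `&` H) * (fine (P H))^-1%:E)%E.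
Proof.
move=> PH; rewrite /cond_proba /= /mnormalize /= /mrestr setTI.
by rewrite gt_eqF//= lt_eqF// (le_lt_trans (probability_le1 P mH))// ltry.
Qed.

Section mixture.
Local Open Scope ereal_scope.
Context d' (T' : measurableType d').
Variables (Q : probability T R) (K : R.-pker T ~> T').

(* For Q = P( . | H) this is the measure E[K( . ) | H]. *)
Definition mixture (B : set T') : \bar R := \int[Q]_w K w B.

Let mixture0 : mixture set0 = 0.
Proof. by rewrite /mixture; apply: integral0_eq => w _; rewrite measure0. Qed.

Let mixture_ge0 B : 0 <= mixture B.
Proof. exact: integral_ge0. Qed.

Let mixture_sigma_additive : semi_sigma_additive mixture.
Proof.
move=> F mF tF mUF; rewrite /mixture [X in _ --> X](_ : _ =
    \int[Q]_w \sum_(0 <= k <oo) K w (F k)); last first.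
  by apply: eq_integral => w _; apply/esym/cvg_lim => //;
    exact: measure_semi_sigma_additive.
rewrite [X in X @ _](_ : _ =
    (fun n => \int[Q]_w (\sum_(0 <= i < n) K w (F i)))); last first.
  apply/funext => n; rewrite -ge0_integral_sum// => k.
  exact: measurable_kernel.
apply: cvg_monotone_convergence => //.
- by move=> n; apply: emeasurable_sum => m; exact: measurable_kernel.
- by move=> n w _; rewrite sume_ge0.
- by move=> w _ m n mn; exact: ereal_nondecreasing_series.
Qed.

HB.instance Definition _ := isMeasure.Build _ _ _ mixture
  mixture0 mixture_ge0 mixture_sigma_additive.

Let mixture_setT : mixture [set: T'] = 1.
Proof.
rewrite /mixture; under eq_integral do rewrite prob_kernel.
by rewrite integral_cst// mul1e; exact: probability_setT.
Qed.

HB.instance Definition _ :=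
  Measure_isProbability.Build _ _ _ mixture mixture_setT.

End mixture.

Definition weak_cvg (mu : nat -> probability (R * R)%type R)
    (nu : probability (R * R)%type R) : Prop :=
  forall f : R * R -> R, continuous f -> (exists M, forall x, `|f x| <= M) ->
    (\int[mu n]_x (f x)%:E @[n --> \oo] --> \int[nu]_x (f x)%:E)%E.

Definition stable_cvg (P : probability T R)
    (Y : nat -> {mfun T >-> (R * R)%type}) (K : R.-pker T ~> (R * R)%type) :
    Prop :=
  forall (H : set T) (mH : measurable H), (0 < P H)%E ->
    weak_cvg (fun n => distribution (cond_proba P mH) (Y n))
             (mixture (cond_proba P mH) K).

End stable_convergence.

Section gaussian.
Context (R : realType).

Definition mx2 (S : Type) (a00 a01 a10 a11 : S) : 'M[S]_2 :=
  \matrix_(i, j) if i == 0 then (if j == 0 then a00 else a01)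
                 else (if j == 0 then a10 else a11).

(* Lower triangular Cholesky factor of a positive semidefinite matrix; as
   0^-1 = 0, the formula also covers the degenerate case A 0 0 = 0. *)
Definition cholesky2 (A : 'M[R]_2) : 'M[R]_2 :=
  mx2 (Num.sqrt (A 0 0)) 0
      (A 0 1 / Num.sqrt (A 0 0)) (Num.sqrt (A 1 1 - A 0 1 ^+ 2 / A 0 0)).

Lemma cholesky2K (A : 'M[R]_2) : A^T = A ->
  (forall u : 'rV_2, 0 <= (u *m A *m u^T) 0 0) ->
  cholesky2 A *m (cholesky2 A)^T = A.
Proof.
move=> sA psdA.
have A10 : A 1 0 = A 0 1 by rewrite -[in LHS]sA mxE.
have quad x y : 0 <= x ^+ 2 * A 0 0 + x * y * A 0 1 *+ 2 + y ^+ 2 * A 1 1.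
  have := psdA (\row_j if j == 0 then x else y).
  rewrite !mxE !big_ord_recl big_ord0 !mxE !big_ord_recl !big_ord0 !mxE /=.
  rewrite (_ : lift ord0 ord0 = 1); last exact/val_inj.
  rewrite A10; congr (0 <= _); ring.
have a0 : 0 <= A 0 0 by have := quad 1 0; rewrite !expr2; lra.
have e0 : 0 <= A 1 1 by have := quad 0 1; rewrite !expr2; lra.
have b0 : A 0 0 = 0 -> A 0 1 = 0.
  move=> a00; apply/eqP/negPn/negP => bn0.
  have := quad (- (A 1 1 + 1) / (A 0 1 *+ 2)) 1.
  rewrite a00 mulr0 add0r expr1n mul1r mulr1.
  rewrite -mulrnAr mulfVK ?mulrn_eq0//; lra.
have s0 : 0 <= A 1 1 - A 0 1 ^+ 2 / A 0 0.
  have [a00|an0] := eqVneq (A 0 0) 0; first by rewrite a00 invr0 mulr0 subr0.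
  have := quad (- A 0 1 / A 0 0) 1.
  by congr (0 <= _); field.
have sq : Num.sqrt (A 0 0) * Num.sqrt (A 0 0) = A 0 0 by rewrite -expr2 sqr_sqrtr.
have sb : Num.sqrt (A 0 0) * (A 0 1 / Num.sqrt (A 0 0)) = A 0 1.
  have [a00|an0] := eqVneq (A 0 0) 0; first by rewrite b0// !mul0r mulr0.
  by rewrite mulrC divfK// sqrtr_eq0 -ltNge lt_neqAle eq_sym an0.
apply/matrixP => i j; rewrite !mxE !big_ord_recl big_ord0 !mxE /= addr0.
case: i => -[|[|//]] hi; case: j => -[|[|//]] hj; rewrite /=.
- rewrite mulr0 addr0 sq; congr (A _ _); exact/val_inj.
- rewrite mul0r addr0 sb; congr (A _ _); exact/val_inj.
- rewrite mulr0 addr0 mulrC sb -A10; congr (A _ _); exact/val_inj.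
- rewrite -[X in _ + X]expr2 sqr_sqrtr// mulf_div sq -expr2 addrC subrK.
  by congr (A _ _); exact/val_inj.
Qed.

(* [measurableTypeR R], on which [normal_prob] lives, is R with the same
   sigma-algebra but another display. *)
Local Notation mR := (measurableTypeR R).

Definition std_normal2 : probability (mR * mR)%type R :=
  (normal_prob (0 : R) 1 \x normal_prob (0 : R) 1)%E.

Definition mulmx2 (A : 'M[R]_2) (g : mR * mR) : R * R :=
  (A 0 0 * g.1 + A 0 1 * g.2, A 1 0 * g.1 + A 1 1 * g.2).

Let measurable_fst_mR : measurable_fun [set: (mR * mR)%type]
  (fun g : mR * mR => g.1 : R).
Proof. exact: measurable_fst. Qed.

Let measurable_snd_mR : measurable_fun [set: (mR * mR)%type]
  (fun g : mR * mR => g.2 : R).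
Proof. exact: measurable_snd. Qed.

Let measurable_mulmx2 (A : 'M[R]_2) :
  measurable_fun [set: (mR * mR)%type] (mulmx2 A).
Proof.
by apply: measurable_fun_pair => /=; apply: measurable_funD => //=;
  apply: measurable_funM.
Qed.

HB.instance Definition _ (A : 'M[R]_2) :=
  isMeasurableFun.Build _ _ _ _ (mulmx2 A) (@measurable_mulmx2 A).

(* N(0, S) for a positive semidefinite S: the law of A G, where G is standard
   normal on R^2 and A A^T = S (see [cholesky2K]). *)
Definition normal2 (S : 'M[R]_2) : probability (R * R)%type R :=
  distribution std_normal2 (mulmx2 (cholesky2 S)).

Section kernel.
Context d (T : measurableType d).

Definition cst_mfun (a : R) : {mfun T >-> R} := cst a.

Definition eval_mx (S : 'M[{mfun T >-> R}]_2) (w : T) : 'M[R]_2 :=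
  map_mx (fun f : {mfun T >-> R} => f w) S.

Definition normal2_kernel_fun (S : 'M[{mfun T >-> R}]_2) (w : T) :
    {measure set (R * R) -> \bar R} :=
  normal2 (eval_mx S w).

Variable S : 'M[{mfun T >-> R}]_2.

Let measurable_inv (f : T -> R) :
  measurable_fun [set: T] f -> measurable_fun [set: T] (fun w => (f w)^-1).
Proof.
move=> mf; apply: (measurableT_comp _ mf) => {f mf}.
rewrite -(setUv [set (0 : R)]); apply/measurable_funU => //.
  exact: measurableC.
split; first exact: measurable_fun_set1.
apply: subspace_continuous_measurable_fun; first exact: measurableC.
rewrite continuous_open_subspace; last exact/closed_openC/closed_eq.
by move=> x /set_mem /= /eqP x0; exact: inv_continuous.
Qed.

Let measurable_cholesky2 i j :
  measurable_fun [set: T] (fun w => cholesky2 (eval_mx S w) i j).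
Proof.
have mS k l : measurable_fun [set: T] (fun w => eval_mx S w k l).
  by under eq_fun do rewrite mxE; exact: measurable_funPT.
have msqrt (f : T -> R) : measurable_fun [set: T] f ->
    measurable_fun [set: T] (fun w => Num.sqrt (f w)).
  by move=> mf; apply: (measurableT_comp _ mf);
    apply: continuous_measurable_fun; exact: sqrt_continuous.
rewrite /cholesky2 /mx2; under eq_fun do rewrite mxE.
case: i => -[|[|//]] hi; case: j => -[|[|//]] hj //=.
- exact: msqrt.
- exact: measurable_cst.
- by apply: measurable_funM => //; apply: measurable_inv; exact: msqrt.
- apply: msqrt; apply: measurable_funB => //; apply: measurable_funM => //.
    exact: measurable_funX.
  exact: measurable_inv.
Qed.

Let measurable_normal2_kernel U : measurable U ->
  measurable_fun [set: T] (normal2_kernel_fun S ^~ U).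
Proof.
move=> mU.
pose F (x : T * (mR * mR)) := mulmx2 (cholesky2 (eval_mx S x.1)) x.2.
have mF : measurable_fun setT F.
  apply: measurable_fun_pair => /=; apply: measurable_funD => //=;
    apply: measurable_funM => //=.
  - exact: (measurableT_comp (measurable_cholesky2 _ _) measurable_fst).
  - exact: (measurableT_comp measurable_fst_mR measurable_snd).
  - exact: (measurableT_comp (measurable_cholesky2 _ _) measurable_fst).
  - exact: (measurableT_comp measurable_snd_mR measurable_snd).
  - exact: (measurableT_comp (measurable_cholesky2 _ _) measurable_fst).
  - exact: (measurableT_comp measurable_fst_mR measurable_snd).
  - exact: (measurableT_comp (measurable_cholesky2 _ _) measurable_fst).
  - exact: (measurableT_comp measurable_snd_mR measurable_snd).
have mFU : measurable (F @^-1` U) by rewrite -[_ @^-1` _]setTI; exact: mF.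
rewrite [X in measurable_fun _ X](_ : _ =
    std_normal2 \o xsection (F @^-1` U)); last first.
  apply/funext => w /=; rewrite /normal2_kernel_fun /= /distribution.
  rewrite /pushforward; congr (std_normal2 _).
  by apply/seteqP; split => g /=; rewrite /xsection /= inE.
exact: measurable_fun_xsection.
Qed.

HB.instance Definition _ := isKernel.Build _ _ _ _ _
  (normal2_kernel_fun S) measurable_normal2_kernel.

Let normal2_kernel_setT w : normal2_kernel_fun S w [set: R * R] = 1%E.
Proof. exact: probability_setT. Qed.

HB.instance Definition _ := Kernel_isProbability.Build _ _ _ _ _
  (normal2_kernel_fun S) normal2_kernel_setT.

Definition normal2_kernel : R.-pker T ~> (R * R)%type := normal2_kernel_fun S.

End kernel.
End gaussian.

(* Main.v *)
(* The joint fluctuation splits into A_n = sqrt n (Z_n - Zoo) and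
   B_n = sqrt n (N_n - Z_n), which are asymptotically independent given Zoo with
   conditional variances c^2 Zoo (1 - Zoo) and (1 - c)^2 Zoo (1 - Zoo); the
   second coordinate is A_n + B_n. Instead of characteristic functions the proof
   uses centred Gaussian densities as test functions: adding independent
   N(0, v)-noise to both coordinates, weak convergence amounts to the convergence
   of E[heat v (a - A_n) * heat v (b - B_n)], where [heat v] is, up to a
   constant, the N(0, v)-density, and then v tends to 0.

   Summation by parts writes B_n as a sum of s_k (X_(k+1) - Z_k) with
   s_k small and sum of s_k^2 close to (1 - c)^2, while A_n is minus a tail sum
   of r_k (X_(k+1) - Z_k), whose squared coefficients, multiplied by n, add up to
   c^2. Replacing the increments one at a time (Lindeberg), the heat equation
   turns each sum of martingale increments into a change of the variance v. The
   variance Z_m (1 - Z_m) is frozen at a time m that is sent to infinity last.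

   Stability: the centred functions xi_n = heat v (a - A_n) * heat v (b - B_n) -
   limit satisfy E[xi_n xi_k] -> 0 as n -> oo, up to errors vanishing with k, so
   that xi_n tends to 0 weakly in L^2, in particular against the indicator of
   every event H. *)
Require Import Defs.
From HB Require Import structures.
From mathcomp Require Import all_boot all_order all_algebra.
From mathcomp Require Import ring lra zify.
From mathcomp Require Import all_classical all_reals all_analysis.
From mathcomp Require Import measurable_realfun.

Set Implicit Arguments.
Unset Strict Implicit.
Unset Printing Implicit Defensive.

Import Order.TTheory GRing.Theory Num.Theory.
Import numFieldNormedType.Exports.

Local Open Scope classical_set_scope.
Local Open Scope ring_scope.

(** Conditional expectations never appear: a version W of P(E | F_n) is used only through E[f 1_E] =
    E[f W] for bounded F_n-measurable f, so every replacement takes place under an integral against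
    such an f. This dictates the order of the replacements. B_n is F_n-measurable, so heat v (b -
    B_n) can serve as f while the innovations after time n are integrated out; with their variance
    frozen at time m, the factor they leave behind is F_m-measurable and serves as f for the
    innovations between m and n. Zoo itself need not be F_n-measurable for any n; it is traded for
    Z_m or for a late Z_(K n), at a cost controlled by E|Z_m - Zoo| -> 0. Gaussian test functions
    suit random variances: a variance enters only through the first argument of heat, which is
    smooth there away from 0, and integration against a centred normal law merely shifts that
    argument. An event H need not belong to the filtration. Convergence against F_m-measurable
    functions does not reach it, but asymptotic orthogonality does, because each xi_k is nearly
    F_m-measurable for large m. *)

Section bounded_measurable.
Context d (T : measurableType d) (R : realType).
Implicit Types f g : T -> R.

(** The sigma-algebra is a parameter: over a generated sub-sigma-algebra the same predicate
    expresses adaptedness, so the closure lemmas below serve adapted functions as well. *)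
Definition bmfun f := measurable_fun [set: T] f /\ exists M, forall x, `|f x| <= M.

Lemma bmfun_cst (a : R) : bmfun (fun=> a).
Proof. by split; [exact: measurable_cst|exists `|a|]. Qed.

Lemma bmfunD f g : bmfun f -> bmfun g -> bmfun (fun x => f x + g x).
Proof.
move=> [mf [M fM]] [mg [N gN]]; split; first exact: measurable_funD.
by exists (M + N) => x; rewrite (le_trans (ler_normD _ _))// lerD.
Qed.

Lemma bmfunN f : bmfun f -> bmfun (fun x => - f x).
Proof.
move=> [mf [M fM]]; split; first exact: measurableT_comp.
by exists M => x; rewrite normrN.
Qed.

Lemma bmfunB f g : bmfun f -> bmfun g -> bmfun (fun x => f x - g x).
Proof. by move=> ? ?; apply: bmfunD => //; exact: bmfunN. Qed.

Lemma bmfunM f g : bmfun f -> bmfun g -> bmfun (fun x => f x * g x).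
Proof.
move=> [mf [M fM]] [mg [N gN]]; split; first exact: measurable_funM.
by exists (M * N) => x; rewrite normrM ler_pM.
Qed.

Lemma bmfun_norm f : bmfun f -> bmfun (fun x => `|f x|).
Proof.
move=> [mf [M fM]]; split; first exact: measurableT_comp.
by exists M => x; rewrite normr_id.
Qed.

Lemma bmfunX f n : bmfun f -> bmfun (fun x => f x ^+ n).
Proof.
move=> bf; elim: n => [|n IHn]; first exact: bmfun_cst.
rewrite (_ : (fun x => _) = fun x => f x * f x ^+ n); first exact: bmfunM.
by apply/funext => x; rewrite exprS.
Qed.

Lemma bmfun_indic (A : set T) : measurable A -> bmfun (\1_A).
Proof.
move=> mA; split; first exact: measurable_indic.
by exists 1 => x; rewrite indicE ger0_norm// lern1 leq_b1.
Qed.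

Lemma bmfun_sum (I : Type) (s : seq I) (F : I -> T -> R) :
  (forall i, bmfun (F i)) -> bmfun (fun x => \sum_(i <- s) F i x).
Proof.
move=> bF; elim: s => [|i s IHs].
  by under eq_fun do rewrite big_nil; exact: bmfun_cst.
by under eq_fun do rewrite big_cons; exact: bmfunD.
Qed.

End bounded_measurable.

(** * Real-valued expectations of bounded functions *)

Section expectation_bounded.
Context d (T : measurableType d) (R : realType) (P : probability T R).
Implicit Types f g h : T -> R.

Definition Ex f : R := \int[P]_x f x.

Lemma bmfun_integrable f : bmfun f -> P.-integrable [set: T] (EFin \o f).
Proof.
move=> [mf [M fM]]; apply: measurable_bounded_integrable => //.
  by rewrite (le_lt_trans (probability_le1 _ _))// ltry.
exists M; split; first exact: num_real.
by move=> x Mx y _ /=; exact: (le_trans (fM y) (ltW Mx)).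
Qed.

Lemma Ex_EFin f : bmfun f -> (\int[P]_x (f x)%:E)%E = (Ex f)%:E.
Proof.
move=> /bmfun_integrable bf; rewrite /Ex /Rintegral fineK//.
exact: integrable_fin_num.
Qed.

Lemma Ex_cst a : Ex (fun=> a) = a.
Proof. by rewrite /Ex Rintegral_cst// [X in fine X](@probability_setT _ _ _ P) mulr1. Qed.

Lemma ExD f g : bmfun f -> bmfun g -> Ex (fun x => f x + g x) = Ex f + Ex g.
Proof. by move=> bf bg; rewrite /Ex RintegralD//; exact: bmfun_integrable. Qed.

Lemma ExB f g : bmfun f -> bmfun g -> Ex (fun x => f x - g x) = Ex f - Ex g.
Proof. by move=> bf bg; rewrite /Ex RintegralB//; exact: bmfun_integrable. Qed.

Lemma ExZ a f : bmfun f -> Ex (fun x => a * f x) = a * Ex f.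
Proof. by move=> bf; rewrite /Ex RintegralZl//; exact: bmfun_integrable. Qed.

Lemma eq_Ex f g : f =1 g -> Ex f = Ex g.
Proof. by move=> fg; congr Ex; exact/funext. Qed.

Lemma le_Ex f g : bmfun f -> bmfun g -> (forall x, f x <= g x) -> Ex f <= Ex g.
Proof.
by move=> bf bg fg; apply: le_Rintegral => //; exact: bmfun_integrable.
Qed.

Lemma Ex_ge0 f : (forall x, 0 <= f x) -> 0 <= Ex f.
Proof. by move=> f0; apply: Rintegral_ge0 => x _. Qed.

Lemma norm_Ex_le f : bmfun f -> `|Ex f| <= Ex (fun x => `|f x|).
Proof.
by move=> bf; apply: le_normr_Rintegral => //; exact: bmfun_integrable.
Qed.

Lemma norm_Ex_dom f g : bmfun f -> bmfun g -> (forall x, `|f x| <= g x) ->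
  `|Ex f| <= Ex g.
Proof.
move=> bf bg fg; apply: (le_trans (norm_Ex_le bf)).
by apply: le_Ex => //; exact: bmfun_norm.
Qed.

Lemma norm_Ex_cst f M : bmfun f -> (forall x, `|f x| <= M) -> `|Ex f| <= M.
Proof.
by move=> bf fM; rewrite -[leRHS](Ex_cst M); apply: norm_Ex_dom => //;
  exact: bmfun_cst.
Qed.

Lemma norm_ExB f g h : bmfun f -> bmfun g -> bmfun h ->
  (forall x, `|f x - g x| <= h x) -> `|Ex f - Ex g| <= Ex h.
Proof.
by move=> bf bg bh fgh; rewrite -ExB//; apply: norm_Ex_dom => //; exact: bmfunB.
Qed.

Lemma Ex_cvg (f_ : nat -> T -> R) f M : (forall n, measurable_fun [set: T] (f_ n)) ->
  measurable_fun [set: T] f ->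
  (forall n x, `|f_ n x| <= M) -> {ae P, forall x, f_ n x @[n --> \oo] --> f x} ->
  Ex (f_ n) @[n --> \oo] --> Ex f.
Proof.
move=> mf_ mf f_M f_f.
have [|||||intf _ h] := @dominated_convergence _ _ R P setT measurableT
  (fun n => EFin \o f_ n) (EFin \o f) (fun=> M%:E).
- by move=> n; exact/measurable_EFinP.
- exact/measurable_EFinP.
- apply: filterS f_f => x f_fx _; apply: cvg_EFin f_fx.
  exact: nearW.
- exact: (bmfun_integrable (bmfun_cst _ M)).
- by apply: aeW => x n _ /=; rewrite lee_fin.
- apply: (@fine_cvg _ _ _ _ _ (Ex f)).
  by rewrite /Ex /Rintegral fineK//; exact: integrable_fin_num.
Qed.

End expectation_bounded.

(** * The Gaussian profile, its derivatives and the heat equation *)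

Section bell.
Context (R : realType).
Implicit Types (x y z v w h : R).

Lemma mean_value_bound (F dF : R -> R) x y K :
  (forall t, is_derive t (1 : R) F (dF t)) ->
  (forall t, Num.min x y <= t <= Num.max x y -> `|dF t| <= K) ->
  `|F y - F x| <= K * `|y - x|.
Proof.
move=> dFP.
have main a b : (forall t, a <= t <= b -> `|dF t| <= K) -> a < b ->
    `|F b - F a| <= K * `|b - a|.
  move=> bdF ab; have [|c] := @MVT R F dF a b ab.
  - apply: continuous_subspaceT => t; apply: differentiable_continuous.
    by apply/derivable1_diffP; have [] := dFP t.
  rewrite in_itv/= => /andP[ac cb] ->; rewrite normrM ler_wpM2r//.
  by apply: bdF; rewrite !ltW.
have [xy|yx|->] := ltgtP x y => bdF.
- exact: main.
- by rewrite distrC [`|y - x|]distrC; exact: main.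
- by rewrite !subrr !normr0 mulr0.
Qed.

(** The k-th derivative of [bell] is (-1)^k He_k [bell], with He_k the Hermite polynomials; [bell1]
    to [bell3] are these derivatives. *)
Definition bell z : R := expR (- (z ^+ 2 / 2)).
Definition bell1 z : R := - z * bell z.
Definition bell2 z : R := (z ^+ 2 - 1) * bell z.
Definition bell3 z : R := (3 * z - z ^+ 3) * bell z.

Lemma is_derive_bell z : is_derive z (1 : R) bell (bell1 z).
Proof.
rewrite [bell](_ : _ = expR \o (- (2^-1 *: (@id R ^+ 2)))); last first.
  by apply/funext => t /=; rewrite /bell mulrC.
apply: is_derive_eq.
rewrite /bell1 /bell /GRing.scale /= expr1 mulr1 mulrA mulVf ?pnatr_eq0// mul1r.
by rewrite mulrN mulNr mulrC; congr (- (_ * expR (- _))); rewrite mulrC.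
Qed.

Lemma is_derive_bell1 z : is_derive z (1 : R) bell1 (bell2 z).
Proof.
rewrite [bell1](_ : _ = (- (@id R)) * bell); last exact/funext.
have := is_derive_bell z => ?; apply: is_derive_eq.
rewrite /bell2 /bell1 /GRing.scale /= !fctE; ring.
Qed.

Lemma is_derive_bell2 z : is_derive z (1 : R) bell2 (bell3 z).
Proof.
rewrite [bell2](_ : _ = ((@id R) ^+ 2 - cst 1) * bell); last exact/funext.
have := is_derive_bell z => ?; apply: is_derive_eq.
rewrite /bell3 /bell1 /GRing.scale /= !fctE expr1; ring.
Qed.

Lemma bell_gt0 z : 0 < bell z.
Proof. exact: expR_gt0. Qed.

(** Since exp (z^2 / 2) is the square of exp (z^2 / 4) >= 1 + z^2 / 4. It reduces each bound |p
    bell| <= C to the polynomial inequality |p| <= C (1 + z^2 / 4)^2, which suffices up to degree 4.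
    The constants below are only as sharp as this allows: the leading coefficient 1/16 explains the
    16 in [mul_bell3_le]. *)
Lemma sqr_bell_le1 z : (1 + z ^+ 2 / 4) ^+ 2 * bell z <= 1.
Proof.
have -> : bell z = (expR (z ^+ 2 / 4) ^+ 2)^-1.
  by rewrite -expRM_natl -expRN /bell; congr expR; field.
rewrite ler_pdivrMr ?exprn_gt0 ?expR_gt0// mul1r.
rewrite lerXn2r ?nnegrE ?expR_ge0 ?expR_ge1Dx//.
by rewrite addr_ge0// divr_ge0// sqr_ge0.
Qed.

Let poly_bell_le (p C z : R) : `|p| <= C * (1 + z ^+ 2 / 4) ^+ 2 -> `|p * bell z| <= C.
Proof.
move=> pC; rewrite normrM (gtr0_norm (bell_gt0 z)).
have C0 : 0 <= C.
  rewrite leNgt; apply/negP => C0.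
  have := le_trans (normr_ge0 _) pC.
  rewrite nmulr_rge0// => /le_lt_trans/(_ ltr01).
  have : 1 <= (1 + z ^+ 2 / 4) ^+ 2.
    by rewrite exprn_ege1// lerDl divr_ge0// sqr_ge0.
  by lra.
rewrite (le_trans (ler_wpM2r (ltW (bell_gt0 z)) pC))//.
by rewrite -mulrA ler_piMr// sqr_bell_le1.
Qed.

Let sq z : 0 <= z ^+ 2. Proof. exact: sqr_ge0. Qed.

Lemma bell_le1 z : bell z <= 1.
Proof. by rewrite /bell -expR0 ler_expR oppr_le0 divr_ge0// sqr_ge0. Qed.

Lemma bell1_le z : `|bell1 z| <= 2.
Proof.
apply: poly_bell_le; rewrite normrN ler_norml.
have := sq z; have := sq (z - 2); have := sq (z + 2).
by have := sq (z ^+ 2 / 4); rewrite !expr2; nra.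
Qed.

Lemma bell2_le z : `|bell2 z| <= 4.
Proof.
apply: poly_bell_le; rewrite ler_norml.
by have := sq z; have := sq (z ^+ 2 / 4); rewrite !expr2; nra.
Qed.

Lemma bell3_le z : `|bell3 z| <= 20.
Proof.
apply: poly_bell_le; rewrite ler_norml.
have := sq z; have := sq (z - 1); have := sq (z + 1).
have := sq (z ^+ 2 - z); have := sq (z ^+ 2 + z).
by rewrite !(exprS,expr0,mulr1); nra.
Qed.

Lemma mul_bell3_le z : `|z * bell3 z| <= 16.
Proof.
rewrite /bell3 mulrA; apply: poly_bell_le; rewrite ler_norml.
have := sq z; have := sq (z ^+ 2).
by rewrite !(exprS,expr0,mulr1); nra.
Qed.

Lemma bellB_le z y : `|bell y - bell z| <= 2 * `|y - z|.
Proof.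
by apply: (mean_value_bound is_derive_bell) => t _; exact: bell1_le.
Qed.

(** Three nested applications of the mean value inequality, starting from the bound 20 on [bell3];
    the factor 1/6 of Taylor's formula is given up. *)
Lemma bell_taylor z h :
  `|bell (z + h) - bell z - bell1 z * h - 2^-1 * bell2 z * h ^+ 2| <= 20 * `|h| ^+ 3.
Proof.
have d2 t : Num.min z (z + h) <= t <= Num.max z (z + h) ->
    `|bell2 t - bell2 z| <= 20 * `|h|.
  move=> zth; apply: (@le_trans _ _ (20 * `|t - z|)).
    by apply: (mean_value_bound is_derive_bell2) => s _; exact: bell3_le.
  rewrite ler_wpM2l// ler_norml; move: zth.
  by rewrite ge_min le_max; have := ler_norm h; have := ler_norm (- h); rewrite normrN; lra.
have seg t s : Num.min z (z + h) <= t <= Num.max z (z + h) ->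
    Num.min z t <= s <= Num.max z t ->
    Num.min z (z + h) <= s <= Num.max z (z + h).
  rewrite !ge_min !le_max; lra.
have le_seg t : Num.min z (z + h) <= t <= Num.max z (z + h) -> `|t - z| <= `|h|.
  rewrite ge_min le_max ler_norml.
  by have := ler_norm h; have := ler_norm (- h); rewrite normrN; lra.
have d1 t : Num.min z (z + h) <= t <= Num.max z (z + h) ->
    `|bell1 t - bell1 z - bell2 z * (t - z)| <= 20 * `|h| ^+ 2.
  move=> zth.
  pose F s := bell1 s - bell2 z * s.
  have dF s : is_derive s (1 : R) F (bell2 s - bell2 z).
    rewrite [F](_ : _ = bell1 - (bell2 z \*: id)); last exact/funext.
    have := is_derive_bell1 s => ?; apply: is_derive_eq.
    by rewrite /GRing.scale /= mulr1.
  rewrite (_ : _ - _ = F t - F z); last by rewrite /F; ring.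
  rewrite (le_trans (mean_value_bound (K := 20 * `|h|) dF _))//.
    by move=> s /(seg _ _ zth); exact: d2.
  by rewrite expr2 mulrA ler_wpM2l ?mulr_ge0// le_seg.
pose F s := bell s - bell1 z * s - 2^-1 * bell2 z * (s - z) ^+ 2.
have dF s : is_derive s (1 : R) F (bell1 s - bell1 z - bell2 z * (s - z)).
  rewrite [F](_ : _ = bell - (bell1 z \*: id) - ((2^-1 * bell2 z) \*: (id - cst z) ^+ 2)); last exact/funext.
  have := is_derive_bell s => ?; apply: is_derive_eq.
  by rewrite /GRing.scale /= !fctE expr1; field.
rewrite (_ : _ - _ = F (z + h) - F z); last by rewrite /F; ring.
rewrite (le_trans (mean_value_bound (K := 20 * `|h| ^+ 2) dF _))//.
by rewrite addrAC subrr add0r -mulrA -exprSr.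
Qed.

(* [dilate w x] is, up to the factor 1 / sqrt (2 pi), the density at x of the
   centred normal law of variance w^-2; its derivative in w is
   - bell2 (w x), which is the heat equation in disguise. *)
Definition dilate w x := w * bell (w * x).

Lemma dilate_lip_space w x y : 0 <= w ->
  `|dilate w y - dilate w x| <= 2 * w ^+ 2 * `|y - x|.
Proof.
move=> w0; rewrite /dilate -mulrBr normrM (ger0_norm w0).
rewrite -mulrA mulrCA expr2 -!mulrA ler_wpM2l//.
rewrite (le_trans (bellB_le _ _))// -mulrBr normrM (ger0_norm w0).
by rewrite mulrCA.
Qed.

Lemma is_derive_dilate x s : is_derive s (1 : R) (dilate ^~ x) (- bell2 (s * x)).
Proof.
rewrite [dilate ^~ x](_ : _ = id * (bell \o (x \*: id))); last first.
  by apply/funext => t; congr (t * bell _); exact: mulrC.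
have := is_derive_bell ((x \*: id) s) => ?; apply: is_derive_eq.
rewrite /GRing.scale /= /bell2 /bell1 (_ : x *: s = s * x); last exact: mulrC.
ring.
Qed.

Lemma dilate_lip_time w w' x :
  `|dilate w' x - dilate w x| <= 4 * `|w' - w|.
Proof.
apply: (mean_value_bound (is_derive_dilate x)) => t _.
by rewrite normrN bell2_le.
Qed.

Lemma dilate_taylor_space w x h : 0 <= w ->
  `|dilate w (x + h) - dilate w x - w ^+ 2 * bell1 (w * x) * h
    - 2^-1 * (w ^+ 3 * bell2 (w * x)) * h ^+ 2| <= 20 * w ^+ 4 * `|h| ^+ 3.
Proof.
move=> w0; rewrite (_ : _ - _ = w * (bell (w * x + w * h) - bell (w * x)
    - bell1 (w * x) * (w * h) - 2^-1 * bell2 (w * x) * (w * h) ^+ 2)); last first.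
  by rewrite /dilate mulrDr; ring.
rewrite normrM (ger0_norm w0).
rewrite (le_trans (ler_wpM2l w0 (bell_taylor _ _)))//.
by rewrite normrM (ger0_norm w0) exprMn le_eqVlt; apply/orP; left; apply/eqP; ring.
Qed.

(** The error must be uniform in x. The derivative of [bell2 (s * x)] in s is x bell3 (s x) = (s x)
    bell3 (s x) / s, so [mul_bell3_le] bounds it by 16 / w' whatever x is. *)
Lemma dilate_taylor_time w w' x : 0 < w' -> w' <= w ->
  `|dilate w' x - dilate w x + (w' - w) * bell2 (w * x)| <=
  16 * (w - w') ^+ 2 / w'.
Proof.
move=> w'0 w'w.
pose F s := dilate s x + s * bell2 (w * x).
have dF s : is_derive s (1 : R) F (bell2 (w * x) - bell2 (s * x)).
  rewrite [F](_ : _ = (dilate ^~ x) + (bell2 (w * x) \*: id)); last first.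
    by apply/funext => t /=; rewrite /F mulrC.
  have := is_derive_dilate x s => ?; apply: is_derive_eq.
  by rewrite /GRing.scale /= mulr1 addrC.
rewrite (_ : _ + _ = F w' - F w); last by rewrite /F; ring.
rewrite (le_trans (mean_value_bound (K := 16 * (w - w') / w') dF _))//; last first.
  by rewrite ler0_norm ?subr_le0// opprB expr2 le_eqVlt; apply/orP; left; apply/eqP; ring.
move=> t; rewrite ge_min le_max => wtw.
have [w't tw] : w' <= t /\ t <= w by split; lra.
have dG s : is_derive s (1 : R) (fun s => bell2 (s * x)) (x * bell3 (s * x)).
  rewrite [X in is_derive _ _ X](_ : _ = bell2 \o (x \*: id)); last first.
    by apply/funext => u /=; rewrite mulrC.
  have := is_derive_bell2 ((x \*: id) s) => ?; apply: is_derive_eq.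
  by rewrite /GRing.scale /= mulr1 mulrC [s * x]mulrC.
rewrite (le_trans (mean_value_bound (K := 16 / w') dG _))//.
  move=> s; rewrite ge_min le_max => tsw.
  have s0 : w' <= s by lra.
  rewrite ler_pdivlMr// (le_trans _ (mul_bell3_le (s * x)))//.
  rewrite -mulrA [leRHS]normrM (gtr0_norm (lt_le_trans w'0 s0)) mulrC.
  by rewrite ler_wpM2r.
rewrite ger0_norm ?subr_ge0// [leRHS]mulrAC ler_wpM2l ?divr_ge0 ?(ltW w'0)//; lra.
Qed.

(* w = v^-1/2 and w' = (v + dl)^-1/2 *)
Lemma invsqrt_incr w w' W dl : 0 < w' -> w' <= w -> w <= W -> 0 <= dl ->
  w ^+ 2 = w' ^+ 2 + dl * w ^+ 2 * w' ^+ 2 ->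
  [/\ w - w' <= dl * w * w' ^+ 2,
      w - w' <= dl * W ^+ 3 &
      `|w - w' - 2^-1 * dl * w ^+ 3| <= dl ^+ 2 * W ^+ 5].
Proof.
move=> w'0 w'w wW dl0 e.
have w0 : 0 < w by exact: lt_le_trans w'w.
have W0 : 0 < W by exact: lt_le_trans wW.
have d0 : 0 <= w - w' by rewrite subr_ge0.
have H1 : w - w' <= dl * w * w' ^+ 2.
  rewrite -(@ler_pM2r _ (w + w')) ?addr_gt0//.
  rewrite (_ : (w - w') * (w + w') = w ^+ 2 - w' ^+ 2); last by ring.
  rewrite e addrAC subrr add0r.
  rewrite (_ : _ * (w + w') = dl * w ^+ 2 * w' ^+ 2 + dl * w * w' ^+ 3); last by ring.
  by rewrite lerDl !mulr_ge0// ?exprn_ge0 ?ltW.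
have ww (i : nat) : w ^+ i <= W ^+ i by rewrite lerXn2r// nnegrE ltW.
have w'W (i : nat) : w' ^+ i <= W ^+ i.
  by rewrite lerXn2r ?nnegrE ?(ltW w'0) ?(ltW W0)//; exact: le_trans wW.
have H2 : w - w' <= dl * W ^+ 3.
  rewrite (le_trans H1)// -mulrA ler_wpM2l// (exprS W 2).
  by rewrite ler_pM ?exprn_ge0 ?(ltW w0) ?(ltW w'0).
split => //.
have w_ge0 := ltW w0; have w'_ge0 := ltW w'0; have W_ge0 := ltW W0.
(* Multiplying by w + w' turns w - w' into w^2 - w'^2, which the hypothesis [e] evaluates. The
   subtracted dl w^3 / 2 is the first-order term of the decrease of v^(-1/2) at v = w^-2. *)
rewrite -(@ler_pM2r _ (2 * (w + w'))) ?mulr_gt0 ?addr_gt0//.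
have -> : `|w - w' - 2^-1 * dl * w ^+ 3| * (2 * (w + w')) =
    dl * w ^+ 2 * ((2 * w' + w) * (w - w')).
  rewrite -{1}(gtr0_norm (_ : 0 < 2 * (w + w'))) ?mulr_gt0 ?addr_gt0// -normrM.
  rewrite (_ : _ * (2 * (w + w')) = 2 * (w ^+ 2 - w' ^+ 2) - dl * w ^+ 2 * (w * (w + w'))); last by field.
  rewrite {1}e (_ : 2 * (_ - _) - _ = dl * w ^+ 2 * (2 * w' ^+ 2 - w * (w + w'))); last by ring.
  rewrite normrM (ger0_norm (_ : 0 <= dl * w ^+ 2)) ?mulr_ge0 ?exprn_ge0//.
  congr (_ * _).
  rewrite (_ : 2 * w' ^+ 2 - _ = - ((2 * w' + w) * (w - w'))); last by ring.
  by rewrite normrN ger0_norm// mulr_ge0// addr_ge0 ?mulr_ge0.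
have -> : dl ^+ 2 * W ^+ 5 * (2 * (w + w')) = dl * W ^+ 2 * (2 * (w + w') * (dl * W ^+ 3)) by ring.
rewrite ler_pM ?ler_wpM2l ?mulr_ge0 ?exprn_ge0// ?addr_ge0 ?mulr_ge0//.
by rewrite ler_pM// ?addr_ge0 ?mulr_ge0//; lra.
Qed.

Definition isqrt v : R := v `^ (- 2^-1).

Lemma isqrt_gt0 v : 0 < v -> 0 < isqrt v.
Proof. by move=> v0; exact: powR_gt0. Qed.

Lemma sqr_isqrt v : 0 < v -> isqrt v ^+ 2 = v^-1.
Proof.
move=> v0; rewrite /isqrt -powR_mulrn ?powR_ge0// -powRrM mulNr mulVf ?pnatr_eq0//.
by rewrite powR_inv1// ltW.
Qed.

Lemma isqrt_le v v' : 0 < v -> v <= v' -> isqrt v' <= isqrt v.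
Proof.
move=> v0 vv'; have v'0 : 0 < v' by exact: lt_le_trans vv'.
rewrite -(@ler_pXn2r _ 2) ?nnegrE ?(ltW (isqrt_gt0 _))//.
by rewrite (sqr_isqrt v0) (sqr_isqrt v'0) lef_pV2.
Qed.

Lemma isqrtD v dl : 0 < v -> 0 <= dl ->
  isqrt v ^+ 2 = isqrt (v + dl) ^+ 2 + dl * isqrt v ^+ 2 * isqrt (v + dl) ^+ 2.
Proof.
move=> v0 dl0; rewrite !sqr_isqrt ?ltr_wpDr//.
by field; rewrite (gt_eqF v0) gt_eqF// ltr_wpDr.
Qed.

Definition heat v x := dilate (isqrt v) x.
(** [heat1] and [heat2] are the first two derivatives of [heat] in x; the derivative in v is half of
    [heat2]. *)
Definition heat1 v x := isqrt v ^+ 2 * bell1 (isqrt v * x).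
Definition heat2 v x := isqrt v ^+ 3 * bell2 (isqrt v * x).

Section heat_bounds.
Variables (v0 : R) (v0_gt0 : 0 < v0).
Let W := isqrt v0.

Let W_gt0 : 0 < W. Proof. exact: isqrt_gt0. Qed.

Let le_W v (i : nat) : v0 <= v -> isqrt v ^+ i <= W ^+ i.
Proof.
by move=> v0v; rewrite lerXn2r ?isqrt_le// nnegrE ltW// isqrt_gt0// (lt_le_trans v0_gt0).
Qed.

Let isq_gt0 v : v0 <= v -> 0 < isqrt v.
Proof. by move=> v0v; rewrite isqrt_gt0// (lt_le_trans v0_gt0). Qed.

Lemma heat_ge0 v x : v0 <= v -> 0 <= heat v x.
Proof. by move=> v0v; rewrite mulr_ge0// ?(ltW (bell_gt0 _)) ?ltW ?isq_gt0. Qed.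

Lemma heat_le v x : v0 <= v -> `|heat v x| <= isqrt v0.
Proof.
move=> v0v; rewrite ger0_norm ?heat_ge0// -[leRHS]mulr1 ler_pM ?bell_le1//.
- by rewrite ltW// isq_gt0.
- by rewrite ltW// bell_gt0.
- exact: isqrt_le.
Qed.

Lemma heat1_le v x : v0 <= v -> `|heat1 v x| <= W ^+ 2 * 2.
Proof.
move=> v0v; rewrite normrM ler_pM ?bell1_le//.
by rewrite ger0_norm ?le_W// exprn_ge0// ltW// isq_gt0.
Qed.

Lemma heat2_le v x : v0 <= v -> `|heat2 v x| <= W ^+ 3 * 4.
Proof.
move=> v0v; rewrite normrM ler_pM ?bell2_le//.
by rewrite ger0_norm ?le_W// exprn_ge0// ltW// isq_gt0.
Qed.

Let incr v dl : v0 <= v -> 0 <= dl ->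
  [/\ 0 < isqrt (v + dl), isqrt (v + dl) <= isqrt v,
      isqrt v - isqrt (v + dl) <= dl * isqrt v * isqrt (v + dl) ^+ 2,
      isqrt v - isqrt (v + dl) <= dl * W ^+ 3 &
      `|isqrt v - isqrt (v + dl) - 2^-1 * dl * isqrt v ^+ 3| <= dl ^+ 2 * W ^+ 5].
Proof.
move=> v0v dl0; have v_gt0 : 0 < v by exact: lt_le_trans v0v.
have w'0 : 0 < isqrt (v + dl) by rewrite isqrt_gt0// ltr_wpDr.
have w'w : isqrt (v + dl) <= isqrt v by rewrite isqrt_le// lerDl.
by have [] := invsqrt_incr w'0 w'w (isqrt_le v0_gt0 v0v) dl0 (isqrtD v_gt0 dl0).
Qed.

Lemma heat_lip v v' x x' : v0 <= v -> v0 <= v' ->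
  `|heat v x - heat v' x'| <= (4 * W ^+ 3 + 2 * W ^+ 2) * (`|v - v'| + `|x - x'|).
Proof.
have time u u' y : v0 <= u -> u <= u' ->
    `|heat u' y - heat u y| <= 4 * W ^+ 3 * `|u' - u|.
  move=> v0u uu'; rewrite (le_trans (dilate_lip_time _ _ _))// -mulrA ler_wpM2l//.
  have du : 0 <= u' - u by rewrite subr_ge0.
  have := incr v0u du; rewrite addrC subrK => -[_ w'w _ + _].
  by rewrite distrC !ger0_norm ?subr_ge0// mulrC.
move=> v0v v0v'.
rewrite -(subrK (heat v' x) (heat v x)) -addrA (le_trans (ler_normD _ _))// mulrDr lerD//.
  rewrite (@le_trans _ _ (4 * W ^+ 3 * `|v - v'|))//.
    by have [|/ltW] := leP v v' => vv'; [rewrite distrC [`|v - _|]distrC|]; exact: time.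
  by rewrite ler_wpM2r// lerDl mulr_ge0// exprn_ge0// ltW.
rewrite distrC [`|x - _|]distrC (le_trans (dilate_lip_space _ _ _))//.
  by rewrite ltW// isq_gt0.
rewrite ler_wpM2r// (@le_trans _ _ (2 * W ^+ 2))//.
  by rewrite ler_wpM2l// le_W.
by rewrite lerDr mulr_ge0// exprn_ge0// ltW.
Qed.

(** The analytic core of the replacement: for a centred increment h of variance dl, both subtracted
    terms have mean 0, so moving x by h and raising the variance by dl agree up to third order. The
    constants depend only on the lower bound v0, because the variances used later are random. *)
Lemma heat_taylor v dl x h : v0 <= v -> 0 <= dl ->
  `|heat v (x + h) - heat (v + dl) x - heat1 v x * h
    - 2^-1 * heat2 v x * (h ^+ 2 - dl)| <=
  20 * (W ^+ 4 + W ^+ 5) * (`|h| ^+ 3 + dl ^+ 2).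
Proof.
move=> v0v dl0; have [w'0 w'w i1 _ i3] := incr v0v dl0.
rewrite /heat /heat1 /heat2; have w0 := isq_gt0 v0v.
have le_w := @le_W v ^~ v0v.
move: (isqrt v) (isqrt (v + dl)) => w w' in w'0 w'w i1 i3 w0 le_w *.
have w'W (i : nat) : w' ^+ i <= W ^+ i.
  by rewrite (le_trans _ (le_w i))// lerXn2r// nnegrE ltW.
have T1 := dilate_taylor_space x h (ltW w0).
have T2 := dilate_taylor_time x w'0 w'w.
(* Taylor remainder in space, minus the one in time, minus the second-order error of v^(-1/2). *)
have -> : dilate w (x + h) - dilate w' x - w ^+ 2 * bell1 (w * x) * h -
    2^-1 * (w ^+ 3 * bell2 (w * x)) * (h ^+ 2 - dl) =
  (dilate w (x + h) - dilate w x - w ^+ 2 * bell1 (w * x) * h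
    - 2^-1 * (w ^+ 3 * bell2 (w * x)) * h ^+ 2)
  - (dilate w' x - dilate w x + (w' - w) * bell2 (w * x))
  - (w - w' - 2^-1 * dl * w ^+ 3) * bell2 (w * x) by field.
have T3 : `|(w - w' - 2^-1 * dl * w ^+ 3) * bell2 (w * x)| <= 4 * W ^+ 5 * dl ^+ 2.
  rewrite normrM (_ : 4 * W ^+ 5 * dl ^+ 2 = dl ^+ 2 * W ^+ 5 * 4); last by ring.
  by rewrite ler_pM// bell2_le.
have T2' : 16 * (w - w') ^+ 2 / w' <= 16 * W ^+ 5 * dl ^+ 2.
  rewrite ler_pdivrMr// -!mulrA ler_wpM2l//.
  rewrite (@le_trans _ _ ((dl * w * w' ^+ 2) ^+ 2))//.
    have w_ge0 := ltW w0; have w'_ge0 := ltW w'0.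
    by rewrite lerXn2r// nnegrE ?subr_ge0// !mulr_ge0// exprn_ge0.
  rewrite (_ : (dl * w * w' ^+ 2) ^+ 2 = w ^+ 2 * w' ^+ 3 * (dl ^+ 2 * w')); last by ring.
  rewrite [leRHS](_ : _ = W ^+ 2 * W ^+ 3 * (dl ^+ 2 * w')); last by ring.
  rewrite ler_wpM2r ?mulr_ge0 ?sqr_ge0 ?(ltW w'0)//.
  by rewrite ler_pM// ?exprn_ge0 ?(ltW w0) ?(ltW w'0).
have T1' : 20 * w ^+ 4 * `|h| ^+ 3 <= 20 * W ^+ 4 * `|h| ^+ 3.
  by rewrite ler_wpM2r ?exprn_ge0// ler_wpM2l.
rewrite (le_trans (ler_normB _ _))// (le_trans (lerD (ler_normB _ _) (lexx _)))//.
apply: (le_trans (lerD (lerD T1 T2) T3)).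
apply: (le_trans (lerD (lerD T1' T2') (lexx _))).
rewrite -subr_ge0 (_ : _ - _ = 20 * W ^+ 4 * dl ^+ 2 + 20 * W ^+ 5 * `|h| ^+ 3); last by ring.
by rewrite addr_ge0// !mulr_ge0// ?exprn_ge0// ltW.
Qed.

End heat_bounds.

Section heat_measurable.
Context d (T : measurableType d).

Implicit Types f g : T -> R.

Lemma measurable_bell f : measurable_fun [set: T] f ->
  measurable_fun [set: T] (fun t => bell (f t)).
Proof.
move=> mf; apply: (measurableT_comp (@measurable_expR R)).
apply: (measurableT_comp (@oppr_measurable R setT)).
by apply: measurable_funM; [exact: measurable_funX|exact: measurable_cst].
Qed.

Let measurable_isqrt f : measurable_fun [set: T] f ->
  measurable_fun [set: T] (fun t => isqrt (f t)).
Proof. by move=> mf; apply: (measurableT_comp (measurable_powR _)). Qed.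

Variables f g : T -> R.
Hypotheses (mf : measurable_fun [set: T] f) (mg : measurable_fun [set: T] g).

Let mfg : measurable_fun [set: T] (fun t => isqrt (f t) * g t).
Proof. by apply: measurable_funM => //; exact: measurable_isqrt. Qed.

Lemma measurable_heat : measurable_fun [set: T] (fun t => heat (f t) (g t)).
Proof.
by apply: measurable_funM; [exact: measurable_isqrt|exact: measurable_bell].
Qed.

Lemma measurable_heat1 : measurable_fun [set: T] (fun t => heat1 (f t) (g t)).
Proof.
apply: measurable_funM; first exact/measurable_funX/measurable_isqrt.
apply: measurable_funM; first exact: measurableT_comp.
exact: measurable_bell.
Qed.

Lemma measurable_heat2 : measurable_fun [set: T] (fun t => heat2 (f t) (g t)).
Proof.
apply: measurable_funM; first exact/measurable_funX/measurable_isqrt.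
apply: measurable_funM; last exact: measurable_bell.
by apply: measurable_funB => //; exact: measurable_funX.
Qed.

End heat_measurable.

End bell.

(** * Functionals determined by their values on indicators *)

Section bounded_linear_functionals.
Context d (T : measurableType d) (R : realType).

Definition bounded_linear (Phi : (T -> R) -> R) :=
  [/\ forall f g, bmfun f -> bmfun g -> Phi (fun x => f x + g x) = Phi f + Phi g,
      forall a f, bmfun f -> Phi (fun x => a * f x) = a * Phi f &
      exists C, forall f M, bmfun f -> (forall x, `|f x| <= M) -> `|Phi f| <= C * M].

(** The sum is the minimum of n and the integer part of y. *)
Lemma sum_le_indicators n (y : R) : 0 <= y ->
  let S := \sum_(i < n) ((i.+1%:R <= y)%R%:R : R) in
  S <= y /\ (S = n%:R \/ y <= S + 1).
Proof.
move=> y0 /=; suff : [/\ \sum_(i < n) ((i.+1%:R <= y)%R%:R : R) <= y,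
    \sum_(i < n) ((i.+1%:R <= y)%R%:R : R) <= n%:R &
    \sum_(i < n) ((i.+1%:R <= y)%R%:R : R) = n%:R \/
    y <= \sum_(i < n) ((i.+1%:R <= y)%R%:R : R) + 1] by case.
elim: n => [|n IHn]; first by rewrite big_ord0; split => //; left.
rewrite big_ord_recr /= -natr1; move: IHn.
set S := \sum_(i < n) _ => -[S1 S2 S3].
have [ny|yn] := leP (n%:R + 1) y; rewrite /= ?addr0.
  have S4 : S = n%:R by case: S3 => // ?; lra.
  by rewrite S4; split => //; left.
by split => //; [lra|right; case: S3 => [->|]; lra].
Qed.

(* A [0, 1]-valued function is, up to 1 / N, the average of the indicators of
   its superlevel sets at the levels i / N, 1 <= i <= N. *)
Lemma average_indicators N (x : R) : 0 <= x <= 1 ->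
  `|x - N.+1%:R^-1 * \sum_(i < N.+1) ((i.+1%:R <= N.+1%:R * x)%R%:R : R)| <= N.+1%:R^-1.
Proof.
move=> /andP[x0 x1]; have y0 : 0 <= N.+1%:R * x by rewrite mulr_ge0.
have := sum_le_indicators N.+1 y0; set S := \sum_(i < _) _ => /= -[S1 S2].
have S3 : N.+1%:R * x <= S + 1.
  case: S2 => // ->; have : N.+1%:R * x <= N.+1%:R by rewrite ler_piMr.
  by lra.
rewrite -(@ler_pM2l _ N.+1%:R)// mulfV// -{1}(@gtr0_norm _ N.+1%:R)// -normrM.
by rewrite mulrBr mulVKf// ler_norml; lra.
Qed.

Variables Phi Psi : (T -> R) -> R.
Hypotheses (PhiL : bounded_linear Phi) (PsiL : bounded_linear Psi).
Hypothesis PhiPsi : forall A, measurable A -> Phi (\1_A) = Psi (\1_A).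

Let bounded_linear_ext01 (f : T -> R) : bmfun f -> (forall x, 0 <= f x <= 1) ->
  Phi f = Psi f.
Proof.
move=> bf f01.
pose A N i := [set x | (i.+1%:R <= N.+1%:R * f x)%R] : set T.
have mA N i : measurable (A N i).
  have -> : A N i = [set: T] `&` (fun x => N.+1%:R * f x) @^-1` `[i.+1%:R, +oo[.
    by rewrite setTI; apply/seteqP; split => x /=; rewrite in_itv/= andbT.
  have mNf : measurable_fun [set: T] (fun x => N.+1%:R * f x).
    by apply: measurable_funM => //; case: bf.
  exact: mNf.
pose g N x := N.+1%:R^-1 * \sum_(i < N.+1) (\1_(A N i) x : R).
have g_near N x : `|f x - g N x| <= N.+1%:R^-1.
  rewrite (le_trans _ (average_indicators N (f01 x)))// /g.
  under eq_bigr do rewrite indicE.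
  rewrite le_eqVlt; apply/orP; left; apply/eqP.
  congr (`|_ - _ * _|); apply: eq_bigr => i _; congr (_%:R).
  rewrite (_ : (x \in _) = (i.+1%:R <= N.+1%:R * f x))//.
  by apply/idP/idP; rewrite inE.
have bA N i : @bmfun _ T R (\1_(A N i)) by exact/bmfun_indic.
have sum_ext N (n : nat) (s : seq 'I_n) :
    Phi (fun x => \sum_(i <- s) (\1_(A N i) x : R)) = Psi (fun x => \sum_(i <- s) (\1_(A N i) x : R)).
  have [PhiD PhiZ _] := PhiL; have [PsiD PsiZ _] := PsiL.
  elim: s => [|i s IHs].
    rewrite (_ : (fun x => _) = fun x => 0 * \1_setT x).
      by rewrite PhiZ ?PsiZ ?mul0r//; exact: bmfun_indic.
    by apply/funext => x; rewrite big_nil mul0r.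
  rewrite (_ : (fun x => _) = fun x => \1_(A N i) x + \sum_(i <- s) (\1_(A N i) x : R)).
    by rewrite PhiD ?PsiD ?IHs ?PhiPsi//; apply: bmfun_sum.
  by apply/funext => x; rewrite big_cons.
have bs N : bmfun (fun x => \sum_(i < N.+1) (\1_(A N i) x : R)) by exact: bmfun_sum.
have bg N : bmfun (g N) by exact: (bmfunM (bmfun_cst _ _) (bs N)).
have gE N : Phi (g N) = Psi (g N).
  have [_ PhiZ _] := PhiL; have [_ PsiZ _] := PsiL.
  by rewrite PhiZ// PsiZ// sum_ext.
have near_lin L C N : bounded_linear L ->
    (forall h M, bmfun h -> (forall x, `|h x| <= M) -> `|L h| <= C * M) ->
    `|L f - L (g N)| <= C * N.+1%:R^-1.
  move=> [LD LZ _] LC; have bNg := bmfunM (bmfun_cst T (-1 : R)) (bg N).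
  rewrite (_ : L f - L (g N) = L (fun x => f x + (- 1) * g N x)).
    apply: LC; first exact: (bmfunD bf bNg).
    by move=> x; rewrite mulN1r; exact: g_near.
  by rewrite LD// (LZ (- 1) (g N))// mulN1r.
have [_ _ [C PhiC]] := PhiL; have [_ _ [D PsiD]] := PsiL.
apply/eqP; rewrite -subr_eq0 -normr_le0 leNgt; apply/negP => d0.
have CD0 : 0 < `|C| + `|D| + 1 by rewrite ltr_wpDl// addr_ge0.
have [] := @ltr_add_invr R 0 (`|Phi f - Psi f| / (`|C| + `|D| + 1)).
  by rewrite divr_gt0.
move=> N; rewrite add0r ltr_pdivlMr//; apply/negP; rewrite -leNgt.
rewrite (le_trans (ler_distD (Phi (g N)) _ _))// mulrC !mulrDl -addrA lerD//.
  by rewrite (le_trans (near_lin _ _ N PhiL PhiC))// ler_wpM2r// ler_norm.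
rewrite gE distrC (le_trans (near_lin _ _ N PsiL PsiD))//.
by rewrite (le_trans (ler_wpM2r _ (ler_norm D)))// lerDl mul1r.
Qed.

(** It plays the role of a monotone class theorem. The approximation by averages of indicators is
    uniform, so continuity in the sup norm is enough and no monotone limit is taken. Conditional
    probabilities, the laws given H and mixtures are all specified on sets; this transfers their
    identities to bounded functions. *)
Lemma bounded_linear_ext (f : T -> R) : bmfun f -> Phi f = Psi f.
Proof.
move=> bf; have [mf [M0 fM0]] := bf; pose M := `|M0| + 1.
have M_gt0 : 0 < M by rewrite ltr_wpDl.
have fM x : - M <= f x <= M.
  by rewrite -ler_norml (le_trans (fM0 x))// (le_trans (ler_norm _))// lerDl.
(* Affine rescaling to [0, 1]; the 1 added in M makes the division legitimate. *)
pose g x := (2 * M)^-1 * (f x + M).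
have b1 : @bmfun _ T R (\1_setT) by exact: bmfun_indic.
have bg : bmfun g.
  exact: (bmfunM (bmfun_cst _ _) (bmfunD bf (bmfun_cst _ _))).
have g01 x : 0 <= g x <= 1.
  have /andP[f1 f2] := fM x; rewrite /g mulrC; apply/andP; split.
    by rewrite divr_ge0 ?mulr_ge0 ?(ltW M_gt0)//; lra.
  by rewrite ler_pdivrMr ?mulr_gt0//; lra.
have b2 := bmfunM (bmfun_cst T (2 * M)) bg; have b3 := bmfunM (bmfun_cst T (- M)) b1.
have -> : f = (fun x => 2 * M * g x + - M * \1_setT x).
  by apply/funext => x; rewrite indicE in_setT mulr1 /g mulrA mulfV ?gt_eqF ?mulr_gt0// mul1r addrK.
have [PhiD PhiZ _] := PhiL; have [PsiD PsiZ _] := PsiL.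
rewrite (PhiD _ _ b2 b3) (PsiD _ _ b2 b3) (PhiZ _ _ bg) (PsiZ _ _ bg).
by rewrite (PhiZ _ _ b1) (PsiZ _ _ b1) PhiPsi// bounded_linear_ext01.
Qed.

End bounded_linear_functionals.

Lemma bounded_linear_Ex d (T : measurableType d) (R : realType) (P : probability T R) :
  bounded_linear (Ex P).
Proof.
split; [exact: ExD|exact: ExZ|exists 1 => f M bf fM].
by rewrite mul1r; exact: norm_Ex_cst.
Qed.

(** * Conditional probabilities tested against bounded functions *)

Section conditional_probability.
Context d (T : measurableType d) (R : realType) (P : probability T R).
Variable G : set_system T.
Hypothesis G_meas : <<s G >> `<=` measurable.

Definition sub_measurable (f : T -> R) :=
  @measurable_fun _ _ (g_sigma_algebraType G) R [set: T] f.

Lemma sub_measurableW f : sub_measurable f -> measurable_fun [set: T] f.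
Proof.
by move=> mf _ Y mY; apply: G_meas; exact: (mf measurableT).
Qed.

Definition sub_bmfun (f : T -> R) := @bmfun _ (g_sigma_algebraType G) R f.

Lemma sub_bmfunW (f : T -> R) : sub_bmfun f -> bmfun f.
Proof. by move=> [mf bf]; split => //; exact: sub_measurableW. Qed.

Variables (E : set T) (W : T -> R).
Hypotheses (mE : measurable E) (EW : is_cond_prob P <<s G >> E W).

Hypothesis bW : bmfun W.

Let cond_prob_indic A : <<s G >> A ->
  Ex P (fun x => \1_A x * \1_E x) = Ex P (fun x => \1_A x * W x).
Proof.
move=> GA; have mA := G_meas GA.
have [_ intW /(_ _ GA) EWA] := EW.
have b1A := @bmfun_indic _ T R A mA.
apply: EFin_inj; rewrite -!Ex_EFin; [|exact: bmfunM..|]; last first.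
  by apply: bmfunM => //; exact: bmfun_indic.
transitivity (P (A `&` E)).
  under eq_integral do rewrite -[_ * _]/((\1_A \* \1_E) _) -indicI.
  by rewrite integral_indic ?setIT//; exact: measurableI.
rewrite setIC -EWA integral_mkcond; apply: eq_integral => x _.
by rewrite patchE indicE; case: ifPn => _; rewrite ?mul1r ?mul0r.
Qed.

(** The definition of a conditional probability is the case of indicators. This identity is the only
    channel through which the law of the X_n enters. *)
Lemma cond_prob_Ex (f : T -> R) : sub_bmfun f ->
  Ex P (fun x => f x * \1_E x) = Ex P (fun x => f x * W x).
Proof.
have lin (V : T -> R) : bmfun V -> @bounded_linear _ (g_sigma_algebraType G) R
    (fun f => Ex P (fun x => f x * V x)).
  move=> bV; have [_ [K VK]] := bV; split.
  - move=> h g sbh sbg; rewrite -ExD.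
    + by apply: eq_Ex => x; rewrite mulrDl.
    + exact: (bmfunM (sub_bmfunW sbh) bV).
    + exact: (bmfunM (sub_bmfunW sbg) bV).
  - move=> a h sbh; rewrite -ExZ; last exact: (bmfunM (sub_bmfunW sbh) bV).
    by apply: eq_Ex => x; rewrite mulrA.
  - exists K => h M sbh hM; apply: norm_Ex_cst.
      exact: (bmfunM (sub_bmfunW sbh) bV).
    by move=> x; rewrite normrM mulrC ler_pM.
apply: (@bounded_linear_ext _ (g_sigma_algebraType G) R
  (fun f => Ex P (fun x => f x * \1_E x)) (fun f => Ex P (fun x => f x * W x))).
- exact/lin/bmfun_indic.
- exact/lin.
- exact: cond_prob_indic.
Qed.

End conditional_probability.

(** * Asymptotics of the martingale coefficients *)

Section coefficient_asymptotics.
Context (R : realType) (c : R) (r : nat -> R).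
Hypothesis r_lim : n%:R * r n @[n --> \oo] --> c.

Lemma cvgn_bounded (u : nat -> R) (l : R) : u n @[n --> \oo] --> l ->
  exists2 M, 0 < M & forall n, `|u n| <= M.
Proof.
move=> ul; have /cvg_seq_bounded/pinfty_ex_gt0[M M_gt0 /= uM] : cvgn u.
  by apply/cvg_ex; exists l.
by exists M => // n; exact: uM.
Qed.

Lemma cvg_invn : n%:R^-1 @[n --> \oo] --> (0 : R).
Proof.
rewrite -(cvg_shiftS (fun n => n%:R^-1 : R)); exact: cvg_harmonic.
Qed.

Lemma cvg_inv_sqrtn : (Num.sqrt n%:R)^-1 @[n --> \oo] --> (0 : R).
Proof.
have -> : (fun n => (Num.sqrt n%:R)^-1 : R) = (fun n => Num.sqrt (n%:R^-1)).
  by apply/funext => n; rewrite sqrtrV.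
rewrite -(@sqrtr0 R); apply: continuous_cvg; last exact: cvg_invn.
exact: sqrt_continuous.
Qed.

Lemma r_cvg0 : r n @[n --> \oo] --> (0 : R).
Proof.
rewrite -(cvg_shiftS r).
have : n.+1%:R^-1 * (n.+1%:R * r n.+1) @[n --> \oo] --> 0 * c.
  apply: cvgM; first exact: cvg_harmonic.
  by rewrite (cvg_shiftS (fun n => n%:R * r n)).
by rewrite mul0r; under eq_fun do rewrite mulKf//.
Qed.

(** The coefficient of X_(k+1) - Z_k in n (N_n - Z_n), see [emp_sum]. *)
Definition past_coef k : R := 1 - k.+1%:R * r k.

Lemma past_coef_cvg : past_coef k @[k --> \oo] --> 1 - c.
Proof.
have -> : past_coef = (fun k => 1 - (k%:R * r k + r k)).
  by apply/funext => k; rewrite /past_coef -natr1 mulrDl mul1r.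
apply: cvgB; first exact: cvg_cst.
have : k%:R * r k + r k @[k --> \oo] --> c + 0.
  by apply: cvgD => //; exact: r_cvg0.
by rewrite addr0.
Qed.

Lemma mean_cvg (u : nat -> R) (l : R) m : u n @[n --> \oo] --> l ->
  n%:R^-1 * (\sum_(m <= k < n) u k) @[n --> \oo] --> l.
Proof.
move=> ul.
have ces : n%:R^-1 * (\sum_(0 <= k < n) u k) @[n --> \oo] --> l.
  by rewrite -(cvg_shiftS (fun n => n%:R^-1 * (\sum_(0 <= k < n) u k))); exact: cesaro.
have : n%:R^-1 * (\sum_(0 <= k < n) u k) - n%:R^-1 * (\sum_(0 <= k < m) u k)
    @[n --> \oo] --> l - 0 * (\sum_(0 <= k < m) u k).
  apply: cvgB => //; apply: cvgM; [exact: cvg_invn|exact: cvg_cst].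
rewrite mul0r subr0; apply: cvg_trans; apply: near_eq_cvg.
near=> n; rewrite -mulrBr (@big_cat_nat _ _ _ m 0 n)//=; last by near: n; exact: nbhs_infty_ge.
by rewrite addrAC subrr add0r.
Unshelve. all: by end_near. Qed.

Lemma past_variance_cvg m :
  \sum_(m <= k < n) (past_coef k / Num.sqrt n%:R) ^+ 2 @[n --> \oo] --> (1 - c) ^+ 2.
Proof.
have -> : (fun n => \sum_(m <= k < n) (past_coef k / Num.sqrt n%:R) ^+ 2) =
    (fun n => n%:R^-1 * \sum_(m <= k < n) past_coef k ^+ 2).
  apply/funext => n; rewrite mulr_sumr; apply: eq_bigr => k _.
  by rewrite expr_div_n sqr_sqrtr// mulrC.
apply: mean_cvg; rewrite expr2; under eq_fun do rewrite expr2.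
by apply: cvgM; exact: past_coef_cvg.
Qed.

Lemma past_coef_sup : exists2 B, 0 < B &
  forall k n, `|past_coef k / Num.sqrt n%:R| <= B / Num.sqrt n%:R.
Proof.
have [B B_gt0 tB] := cvgn_bounded past_coef_cvg; exists B => // k n.
by rewrite normrM [X in _ * X]ger0_norm ?invr_ge0// ler_wpM2r ?invr_ge0.
Qed.

Lemma sum_inv_sqr_ge n K : (0 < n <= K)%N ->
  n%:R^-1 - K%:R^-1 <= \sum_(n <= k < K) (k%:R ^+ 2)^-1 :> R.
Proof.
move=> /andP[n0 nK]; rewrite -(opprB (K%:R^-1)) -(telescope_sumr (fun k => k%:R^-1) nK).
rewrite -sumrN; apply: ler_sum_nat => k /andP[nk _].
have k0 : 0 < k%:R :> R by rewrite ltr0n (leq_trans n0).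
rewrite -natr1 opprB -subr_ge0 (_ : _ - _ = (k%:R ^+ 2 * (k%:R + 1))^-1).
  by rewrite invr_ge0 mulr_ge0 ?sqr_ge0// addr_ge0// ltW.
by field; rewrite (gt_eqF k0) gt_eqF// addr_gt0.
Qed.

Lemma sum_inv_sqr_le n K : (0 < n <= K)%N ->
  \sum_(n.+1 <= k < K.+1) (k%:R ^+ 2)^-1 <= n%:R^-1 :> R.
Proof.
move=> /andP[n0 nK]; rewrite big_add1/=.
apply: (@le_trans _ _ (n%:R^-1 - K%:R^-1)); last by rewrite gerBl invr_ge0.
rewrite -(opprB (K%:R^-1)) -(telescope_sumr (fun k => k%:R^-1) nK).
rewrite -sumrN; apply: ler_sum_nat => k /andP[nk _].
have k0 : 0 < k%:R :> R by rewrite ltr0n (leq_trans n0).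
rewrite -natr1 opprB -subr_ge0 (_ : _ - _ = (k%:R * (k%:R + 1) ^+ 2)^-1).
  by rewrite invr_ge0 mulr_ge0 ?sqr_ge0// ltW.
by field; rewrite (gt_eqF k0) gt_eqF// addr_gt0.
Qed.

(** Comparison with the telescoping sum of 1/k - 1/(k+1). Cutting the series at K n >= n^2 loses at
    most n / K n <= 1/n. *)
Lemma cvg_sum_inv_sqr (K : nat -> nat) : (forall n, (n ^ 2 <= K n)%N) ->
  n%:R * \sum_(n <= k < K n) (k%:R ^+ 2)^-1 @[n --> \oo] --> (1 : R).
Proof.
(* The shift keeps n - 1 positive, the index at which the upper estimate is applied. *)
move=> nK; rewrite -(cvg_shiftn 2).
apply: (@squeeze_cvgr _ _ _ _ (fun n => 1 - (n + 2)%:R^-1) (fun n => 1 + n.+1%:R^-1)).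
- near=> n; apply/andP; split.
    have nKn : (0 < n + 2 <= K (n + 2))%N.
      by rewrite addn2/= (leq_trans _ (nK n.+2))// leq_pmulr.
    have nK2 := nK (n + 2)%N.
    apply: le_trans (ler_wpM2l _ (sum_inv_sqr_ge nKn)) => //.
    rewrite mulrBr divff ?pnatr_eq0 ?addn2// lerD2l lerN2 -addn2.
    have /andP[n0 nK1] := nKn.
    rewrite ler_pdivrMr ?ltr0n ?(leq_trans n0)// mulrC ler_pdivlMr ?ltr0n//.
    by rewrite -natrM ler_nat (leq_trans _ nK2).
  have nK2 : (n.+2 <= K n.+2)%N by rewrite (leq_trans _ (nK n.+2))// leq_pmulr.
  have nKn : (0 < n.+1 <= (K n.+2).-1)%N by lia.
  have := sum_inv_sqr_le nKn; rewrite prednK; last by lia.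
  rewrite /= addn2.   move=> /(ler_wpM2l (ler0n _ n.+2))/le_trans; apply.
  by rewrite -natr1 mulrDl divff ?pnatr_eq0// mul1r.
- have : 1 - (n + 2)%:R^-1 @[n --> \oo] --> 1 - (0 : R).
    apply: cvgB; first exact: cvg_cst.
    by rewrite (cvg_shiftn 2 (fun n => n%:R^-1 : R)); exact: cvg_invn.
  by rewrite subr0.
- have : 1 + n.+1%:R^-1 @[n --> \oo] --> 1 + (0 : R).
    by apply: cvgD; [exact: cvg_cst|exact: cvg_harmonic].
  by rewrite addr0.
Unshelve. all: by end_near. Qed.

(** The sum weights (k r_k)^2 by n / k^2. For large n each (k r_k)^2 with k >= n is within e / 2 of
    c^2 and the total weight is at most 2, which leaves an error of at most e against c^2 times the
    total weight. *)
Lemma future_variance_cvg (K : nat -> nat) : (forall n, (n ^ 2 <= K n)%N) ->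
  \sum_(n <= k < K n) (Num.sqrt n%:R * r k) ^+ 2 @[n --> \oo] --> c ^+ 2.
Proof.
move=> nK; have aK := cvg_sum_inv_sqr nK.
set a := (fun n => n%:R * \sum_(n <= k < K n) (k%:R ^+ 2)^-1) in aK.
set tau := (fun n => _).
have ca : c ^+ 2 * a n @[n --> \oo] --> c ^+ 2.
  have : c ^+ 2 * a n @[n --> \oo] --> c ^+ 2 * 1.
    by apply: cvgM => //; exact: cvg_cst.
  by rewrite mulr1.
suff d0 : tau n - c ^+ 2 * a n @[n --> \oo] --> (0 : R).
  have : (tau n - c ^+ 2 * a n) + c ^+ 2 * a n @[n --> \oo] --> 0 + c ^+ 2.
    exact: cvgD.
  by rewrite add0r; under eq_fun do rewrite subrK.
have q : (n%:R * r n) ^+ 2 @[n --> \oo] --> c ^+ 2.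
  by rewrite expr2; under eq_fun do rewrite expr2; exact: cvgM.
apply/cvgr0Pnorm_le => e e0.
have a2 : \forall n \near \oo, a n <= 2 by apply: (cvgr_le 1) aK _ _; lra.
move/cvgrPdist_le: q => /(_ (e / 2) (divr_gt0 e0 (ltr0n _ 2)))[N _ qN].
near=> n.
have n0 : (0 < n)%N by near: n; exact: nbhs_infty_gt.
have Nn : (N <= n)%N by near: n; exact: nbhs_infty_ge.
have -> : tau n - c ^+ 2 * a n =
    n%:R * \sum_(n <= k < K n) ((k%:R * r k) ^+ 2 - c ^+ 2) * (k%:R ^+ 2)^-1.
  rewrite /tau /a !mulr_sumr -sumrB; apply: eq_big_nat => k /andP[nk _].
  rewrite exprMn sqr_sqrtr//; field.
  by rewrite pnatr_eq0 -lt0n (leq_trans n0).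
rewrite normrM ger0_norm//.
apply: (@le_trans _ _ (e / 2 * a n)); last first.
  rewrite -[leRHS](divfK (_ : 2 != 0))// ler_wpM2l ?divr_ge0 ?(ltW e0)//.
  by near: n.
rewrite /a mulrCA ler_wpM2l// mulr_sumr (le_trans (ler_norm_sum _ _ _))//.
apply: ler_sum_nat => k /andP[nk _].
rewrite normrM [X in _ * X]ger0_norm ?invr_ge0 ?sqr_ge0//.
rewrite ler_wpM2r ?invr_ge0 ?sqr_ge0// distrC qN//=.
exact: leq_trans nk.
Unshelve. all: by end_near. Qed.

Lemma future_coef_sup : exists2 C, 0 < C &
  forall n k, (0 < n <= k)%N -> `|Num.sqrt n%:R * r k| <= C / Num.sqrt n%:R.
Proof.
have [C C_gt0 rC] := cvgn_bounded r_lim; exists C => // n k /andP[n0 nk].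
rewrite normrM (ger0_norm (sqrtr_ge0 _)) ler_pdivlMr ?sqrtr_gt0 ?ltr0n//.
rewrite mulrAC -expr2 sqr_sqrtr// (le_trans _ (rC k))//.
by rewrite normrM ler_wpM2r// ger0_norm// ler_nat.
Qed.

End coefficient_asymptotics.

(** * Weak convergence of asymptotically orthogonal sequences *)

Section asymptotically_orthogonal.
Context d (T : measurableType d) (R : realType) (P : probability T R).
Variables (xi : nat -> T -> R) (M : R).
Hypothesis bxi : forall n, bmfun (xi n).
Hypothesis xiM : forall n w, `|xi n w| <= M.
Hypothesis xi_ortho : forall k,
  Ex P (fun w => xi n w * xi k w) @[n --> \oo] --> (0 : R).

(* Otherwise |E[xi_n eta]| > dl infinitely often. Adding such xi_n, with the
   right signs and chosen almost orthogonal to the previous ones, yields S with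
   E[S eta] >= p dl but E[S^2] = O(p), against the Cauchy-Schwarz inequality. *)
Lemma asymptotically_orthogonal_weak (eta : T -> R) : bmfun eta ->
  Ex P (fun w => xi n w * eta w) @[n --> \oo] --> (0 : R).
Proof.
move=> beta; apply/cvgr0Pnorm_le => dl dl0; apply: contrapT => nlim.
have often N : exists2 n, (N <= n)%N & dl < `|Ex P (fun w => xi n w * eta w)|.
  apply: contrapT => no; apply: nlim; exists N => // n /= Nn.
  by rewrite leNgt; apply/negP => dln; apply: no; exists n.
(* Each step adds at most M^2 + 2 to E[S^2]: M^2 from E[xi_n^2], and 2 from the cross term 2
   E[xi_n S] with n so late that |E[xi_n S]| <= 1. The second clause provides such n and is
   inherited thanks to [xi_ortho]. *)
have build p : exists S : T -> R, [/\ bmfun S,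
    Ex P (fun w => xi n w * S w) @[n --> \oo] --> (0 : R),
    p%:R * dl <= Ex P (fun w => S w * eta w) &
    Ex P (fun w => S w ^+ 2) <= p%:R * (M ^+ 2 + 2)].
  elim: p => [|p [S [bS Slim Seta S2]]].
    exists (fun=> 0); split; first exact: bmfun_cst.
    - under eq_fun do under eq_Ex do rewrite mulr0.
      by under eq_fun do rewrite Ex_cst; exact: cvg_cst.
    - by under eq_Ex do rewrite mul0r; rewrite Ex_cst mul0r.
    - by under eq_Ex do rewrite expr0n; rewrite Ex_cst mul0r.
  have [N _ small] : \forall n \near \oo, `|Ex P (fun w => xi n w * S w)| <= 1.
    by move/cvgr0Pnorm_le : Slim; apply.
  have [n Nn dln] := often N.
  pose sg : R := Num.sg (Ex P (fun w => xi n w * eta w)).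
  have bn : bmfun (fun w => sg * xi n w).
    by apply: bmfunM => //; exact: bmfun_cst.
  exists (fun w => S w + sg * xi n w); split.
  - exact: bmfunD.
  - have : Ex P (fun w => xi k w * S w) + sg * Ex P (fun w => xi k w * xi n w)
        @[k --> \oo] --> 0 + sg * 0.
      by apply: cvgD => //; apply: cvgM => //; exact: cvg_cst.
    rewrite mulr0 addr0; apply: cvg_trans; apply: near_eq_cvg; near=> k.
    have b1 := bmfunM (bxi k) bS; have b2 := bmfunM (bxi k) (bxi n).
    rewrite -ExZ// -ExD//; last by apply: bmfunM => //; exact: bmfun_cst.
    by apply: eq_Ex => w; ring.
  - have b1 := bmfunM bS beta; have b2 := bmfunM (bxi n) beta.
    have -> : Ex P (fun w => (S w + sg * xi n w) * eta w) =
        Ex P (fun w => S w * eta w) + sg * Ex P (fun w => xi n w * eta w).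
      rewrite -ExZ// -ExD//; last by apply: bmfunM => //; exact: bmfun_cst.
      by apply: eq_Ex => w; ring.
    by rewrite -natr1 mulrDl mul1r lerD// /sg -normrEsg ltW.
  - have b1 := bmfunX 2 bS; have b2 := bmfunM (bxi n) bS.
    have b3 := bmfunX 2 (bxi n).
    have -> : Ex P (fun w => (S w + sg * xi n w) ^+ 2) =
        Ex P (fun w => S w ^+ 2) + (2 * sg * Ex P (fun w => xi n w * S w)
        + sg ^+ 2 * Ex P (fun w => xi n w ^+ 2)).
      have b4 : bmfun (fun w => 2 * sg * (xi n w * S w)).
        by apply: bmfunM => //; exact: bmfun_cst.
      have b5 : bmfun (fun w => sg ^+ 2 * (xi n w ^+ 2)).
        by apply: bmfunM => //; exact: bmfun_cst.
      rewrite -ExZ// -[sg ^+ 2 * _]ExZ// -(ExD _ b4 b5) -ExD//; last exact: bmfunD.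
      by apply: eq_Ex => w; ring.
    rewrite -[p.+1%:R]natr1 [leRHS]mulrDl mul1r lerD// addrC lerD//.
      have sg1 : sg ^+ 2 <= 1.
        by rewrite /sg sqr_sg lern1 leq_b1.
      have E2 : Ex P (fun w => xi n w ^+ 2) <= M ^+ 2.
        rewrite -(Ex_cst P (M ^+ 2)); apply: le_Ex => // [|w]; first exact: bmfun_cst.
        by rewrite -real_normK ?num_real// lerXn2r ?nnegrE// (le_trans _ (xiM n w)).
      rewrite (le_trans (ler_piMl _ sg1))//.
      by apply: Ex_ge0 => w; exact: sqr_ge0.
    rewrite (le_trans (ler_norm _))// !normrM -mulrA ger0_norm// -[leRHS]mulr1 ler_wpM2l//.
    rewrite mulr_ile1 ?small//.
    by rewrite /sg normr_sg lern1 leq_b1.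
pose H := Ex P (fun w => eta w ^+ 2) + 1.
have H_gt0 : 0 < H.
  by rewrite /H ltr_wpDl// Ex_ge0// => w; exact: sqr_ge0.
have Q0 : 0 < dl ^+ 2 by rewrite exprn_gt0.
(* Large enough that p (M^2 + 2) < p^2 dl^2 / H; the 1 added in H makes it positive even for eta =
   0. *)
pose p := (Num.trunc (H * (M ^+ 2 + 2) / dl ^+ 2)).+1.
have p_gt : H * (M ^+ 2 + 2) / dl ^+ 2 < p%:R by exact: truncnS_gt.
have p_gt0 : 0 < p%:R :> R by rewrite ltr0n.
have [S [bS _ Seta S2]] := build p.
(* The minimiser of t^2 H - 2 t p dl, so that the nonnegative E[(t eta - S)^2] plays the part of the
   Cauchy-Schwarz inequality. *)
pose t := p%:R * dl / H.
have t_gt0 : 0 < t by rewrite divr_gt0// mulr_gt0.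
have : 0 <= Ex P (fun w => (t * eta w - S w) ^+ 2).
  by apply: Ex_ge0 => w; exact: sqr_ge0.
have -> : Ex P (fun w => (t * eta w - S w) ^+ 2) =
    t ^+ 2 * Ex P (fun w => eta w ^+ 2) - 2 * t * Ex P (fun w => S w * eta w)
    + Ex P (fun w => S w ^+ 2).
  have b1 := bmfunX 2 bS; have b2 := bmfunM bS beta; have b3 := bmfunX 2 beta.
  have b4 : bmfun (fun w => t ^+ 2 * eta w ^+ 2).
    by apply: bmfunM => //; exact: bmfun_cst.
  have b5 : bmfun (fun w => 2 * t * (S w * eta w)).
    by apply: bmfunM => //; exact: bmfun_cst.
  rewrite -ExZ// -[2 * t * _]ExZ// -ExB// -ExD//; last exact: bmfunB.
  by apply: eq_Ex => w; ring.
apply/negP; rewrite -ltNge.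
have h1 : t ^+ 2 * Ex P (fun w => eta w ^+ 2) <= t ^+ 2 * H.
  by rewrite ler_wpM2l ?sqr_ge0// /H lerDl.
have h2 : 2 * t * (p%:R * dl) <= 2 * t * Ex P (fun w => S w * eta w).
  by rewrite ler_wpM2l// mulr_ge0// ltW.
have h3 : t ^+ 2 * H - 2 * t * (p%:R * dl) = - (p%:R ^+ 2 * dl ^+ 2 / H).
  by rewrite /t; field; rewrite gt_eqF.
have h4 : p%:R * (M ^+ 2 + 2) < p%:R ^+ 2 * dl ^+ 2 / H.
  rewrite ltr_pdivlMr// expr2 -!mulrA ltr_pM2l//.
  by move: p_gt; rewrite ltr_pdivrMr// mulrC.
lra.
Unshelve. all: by end_near. Qed.

End asymptotically_orthogonal.

Lemma bmfun_heat d (T : measurableType d) (R : realType) (v : R) (u x : T -> R) :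
  0 < v -> measurable_fun [set: T] u -> measurable_fun [set: T] x ->
  (forall w, v <= u w) -> bmfun (fun w => heat (u w) (x w)).
Proof.
move=> v_gt0 mu mx vu; split; first exact: measurable_heat.
by exists (isqrt v) => w; exact: heat_le.
Qed.

(** * Lindeberg replacement for the reinforced process *)

Section reinforced_process.
Context d (T : measurableType d) (R : realType) (P : probability T R).
Variable G : nat -> set_system T.
Hypothesis G_meas : forall n, <<s G n >> `<=` measurable.
Hypothesis G_incr : forall m n, (m <= n)%N -> <<s G m >> `<=` <<s G n >>.
Variables Z X : nat -> T -> R.
Hypothesis Z_adapted : forall n, sub_measurable (G n) (Z n).
Hypothesis X_adapted : forall n, sub_measurable (G n.+1) (X n.+1).
Hypothesis Z01 : forall n w, 0 <= Z n w <= 1.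
Hypothesis X01 : forall n w, X n.+1 w = 0 \/ X n.+1 w = 1.
Hypothesis X_law : forall n,
  is_cond_prob P <<s G n >> (X n.+1 @^-1` [set 1]) (Z n).

Local Notation E := (Ex P).
Local Notation adapted n f := (sub_bmfun (G n) f).

Lemma sub_bmfun_le m n (f : T -> R) : (m <= n)%N -> adapted m f -> adapted n f.
Proof.
move=> mn [mf bf]; split => // _ Y mY; apply: (G_incr mn).
exact: (mf measurableT).
Qed.

Lemma adapted_bmfun n (f : T -> R) : adapted n f -> bmfun f.
Proof. by move=> /sub_bmfunW; apply. Qed.

Lemma adapted_Z m n : (m <= n)%N -> adapted n (Z m).
Proof.
move=> mn; apply: (sub_bmfun_le mn); split; first exact: Z_adapted.
by exists 1 => w; have /andP[? ?] := Z01 m w; rewrite ger0_norm.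
Qed.

Lemma adapted_X m n : (m < n)%N -> adapted n (X m.+1).
Proof.
move=> mn; apply: (sub_bmfun_le mn); split; first exact: X_adapted.
by exists 1 => w; case: (X01 m w) => ->; rewrite ?normr0 ?normr1.
Qed.

(** The index n is the time of prediction: [innov n] is centred given F_n but only
    F_(n+1)-measurable, and [cvar n] is its conditional variance given F_n. *)
Definition innov n w := X n.+1 w - Z n w.
Definition cvar n w := Z n w * (1 - Z n w).

Lemma innov_le1 n w : `|innov n w| <= 1.
Proof.
by rewrite ler_norml /innov; have := Z01 n w; case: (X01 n w) => ->; lra.
Qed.

Lemma cvar01 n w : 0 <= cvar n w <= 1.
Proof. by rewrite /cvar; have /andP[] := Z01 n w; nra. Qed.

Lemma adapted_innov m n : (m < n)%N -> adapted n (innov m).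
Proof.
by move=> mn; apply: bmfunB; [exact: adapted_X|exact/adapted_Z/ltnW].
Qed.

Lemma adapted_cvar m n : (m <= n)%N -> adapted n (cvar m).
Proof.
move=> mn; apply: bmfunM; first exact: adapted_Z.
by apply: bmfunB; [exact: bmfun_cst|exact: adapted_Z].
Qed.

Lemma Ex_mul_X n (f : T -> R) : adapted n f ->
  E (fun w => f w * X n.+1 w) = E (fun w => f w * Z n w).
Proof.
move=> af; rewrite -(cond_prob_Ex _ _ (X_law n))//.
- apply: eq_Ex => w; congr (_ * _); rewrite indicE.
  by case: (X01 n w) => Xw; [rewrite memNset|rewrite mem_set];
    rewrite //= Xw => /esym/eqP; rewrite oner_eq0.
- rewrite -[_ @^-1` _]setTI.
  by apply: (sub_measurableW (@G_meas n.+1) (@X_adapted n)) => //; exact: measurable_set1.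
- exact: (adapted_bmfun (adapted_Z (leqnn n))).
Qed.

Lemma Ex_innov n (f : T -> R) : adapted n f -> E (fun w => f w * innov n w) = 0.
Proof.
move=> af; have bf := adapted_bmfun af.
have bX := adapted_bmfun (adapted_X (ltnSn n)).
have bZ := adapted_bmfun (adapted_Z (leqnn n)).
rewrite (eq_Ex P (g := fun w => f w * X n.+1 w - f w * Z n w)); last first.
  by move=> w; rewrite mulrBr.
by rewrite ExB ?Ex_mul_X ?subrr//; exact: bmfunM.
Qed.

(** As X takes the values 0 and 1, [innov ^+ 2] equals [cvar] plus (1 - 2 Z) [innov], and the last
    term integrates to 0. Hence no second conditional moment has to be assumed. *)
Lemma Ex_sqr_innov n (f : T -> R) : adapted n f ->
  E (fun w => f w * innov n w ^+ 2) = E (fun w => f w * cvar n w).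
Proof.
move=> af; have bf := adapted_bmfun af.
have aZ := adapted_Z (leqnn n).
have bD := adapted_bmfun (adapted_innov (ltnSn n)).
have bV := adapted_bmfun (adapted_cvar (leqnn n)).
have af' : adapted n (fun w => f w * (1 - 2 * Z n w)).
  apply: bmfunM => //; apply: bmfunB; first exact: bmfun_cst.
  by apply: bmfunM => //; exact: bmfun_cst.
rewrite (eq_Ex P (g := fun w => f w * cvar n w + (f w * (1 - 2 * Z n w)) * innov n w)).
  rewrite ExD ?Ex_innov ?addr0//; first exact: bmfunM.
  by apply: bmfunM => //; exact: adapted_bmfun af'.
by move=> w; rewrite /innov /cvar; case: (X01 n w) => ->; ring.
Qed.

Lemma adapted_heat n v0 (v x : T -> R) : 0 < v0 -> adapted n v -> adapted n x ->
  (forall w, v0 <= v w) -> adapted n (fun w => heat (v w) (x w)).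
Proof.
move=> v0_gt0 [mv _] [mx _] v0v; split; first exact: measurable_heat.
by exists (isqrt v0) => w; exact: heat_le.
Qed.

(** 40 is twice the constant of [heat_taylor], whose two error terms are both at most |s|^3 here; 2
    W^3 is half the bound on [heat2]. *)
Definition lindeberg_cst v0 : R :=
  40 * (isqrt v0 ^+ 4 + isqrt v0 ^+ 5) + 2 * isqrt v0 ^+ 3.

(** In [heat_taylor] the linear term integrates to 0 and the quadratic one to (cvar n - u) s^2 / 2
    against [heat2]; |s| <= 1 absorbs the fourth-order remainder into |s|^3. Allowing a [u] other
    than [cvar n] is what lets the variance stay frozen along a whole block of increments. *)
Lemma lindeberg_step n v0 (v x u f : T -> R) s : 0 < v0 ->
  adapted n v -> adapted n x -> adapted n u -> adapted n f ->
  (forall w, v0 <= v w) -> (forall w, 0 <= u w <= 1) ->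
  (forall w, `|f w| <= 1) -> `|s| <= 1 ->
  `|E (fun w => f w * heat (v w) (x w + s * innov n w))
    - E (fun w => f w * heat (v w + u w * s ^+ 2) (x w))| <=
  lindeberg_cst v0 *
    (`|s| ^+ 3 + s ^+ 2 * E (fun w => `|cvar n w - u w|)).
Proof.
move=> v0_gt0 av ax au af v0v u01 f1 s1.
set W := isqrt v0; have W_ge0 : 0 <= W by rewrite ltW// isqrt_gt0.
have le_adapted (g : T -> R) : adapted n g -> adapted n.+1 g by exact: (sub_bmfun_le (leqnSn n)).
have aD : adapted n.+1 (innov n) by exact: adapted_innov.
have aV : adapted n (cvar n) by exact: adapted_cvar.
have acst N (a : R) : adapted N (fun _ : T => a) by exact: bmfun_cst.
have ah1 : adapted n (fun w => heat1 (v w) (x w)).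
  split; first by apply: measurable_heat1; [case: av|case: ax].
  by exists (W ^+ 2 * 2) => w; exact: heat1_le.
have ah2 : adapted n (fun w => heat2 (v w) (x w)).
  split; first by apply: measurable_heat2; [case: av|case: ax].
  by exists (W ^+ 3 * 4) => w; exact: heat2_le.
have au2 : adapted n (fun w => u w * s ^+ 2) by exact: (bmfunM au (acst n _)).
have us0 w : 0 <= u w * s ^+ 2.
  by rewrite mulr_ge0 ?sqr_ge0//; case/andP: (u01 w).
have a1 : adapted n.+1 (fun w => f w * heat (v w) (x w + s * innov n w)).
  apply: bmfunM; first exact: le_adapted.
  apply: (adapted_heat v0_gt0) => //; first exact: le_adapted.
  by apply: bmfunD; [exact: le_adapted|exact: (bmfunM (acst _ s) aD)].
have a2 : adapted n (fun w => f w * heat (v w + u w * s ^+ 2) (x w)).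
  apply: bmfunM => //; apply: (adapted_heat v0_gt0) => //.
    exact: (bmfunD av au2).
  by move=> w; rewrite (le_trans (v0v w))// lerDl.
have a3 : adapted n (fun w => s * (f w * heat1 (v w) (x w))).
  exact: (bmfunM (acst _ s) (bmfunM af ah1)).
have a4 : adapted n (fun w => 2^-1 * s ^+ 2 * (f w * heat2 (v w) (x w))).
  exact: (bmfunM (acst _ (2^-1 * s ^+ 2)) (bmfunM af ah2)).
have b1 := adapted_bmfun a1; have b2 := adapted_bmfun a2.
have b3 := adapted_bmfun a3; have b4 := adapted_bmfun a4.
have bD := adapted_bmfun aD; have bV := adapted_bmfun aV.
have bu := adapted_bmfun au.
pose rho w := f w * heat (v w) (x w + s * innov n w)
  - f w * heat (v w + u w * s ^+ 2) (x w)
  - s * (f w * heat1 (v w) (x w)) * innov n w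
  - 2^-1 * s ^+ 2 * (f w * heat2 (v w) (x w)) * (innov n w ^+ 2 - u w).
have brho : bmfun rho.
  apply: bmfunB; last by apply: bmfunM => //; apply: bmfunB => //; exact: bmfunX.
  by apply: bmfunB; [exact: bmfunB|exact: bmfunM].
have rho_le w : `|rho w| <= 40 * (W ^+ 4 + W ^+ 5) * `|s| ^+ 3.
  rewrite /rho (_ : _ - _ = f w * (heat (v w) (x w + s * innov n w)
    - heat (v w + u w * s ^+ 2) (x w) - heat1 (v w) (x w) * (s * innov n w)
    - 2^-1 * heat2 (v w) (x w) * ((s * innov n w) ^+ 2 - u w * s ^+ 2))); last by ring.
  rewrite normrM (le_trans (ler_piMl _ (f1 w)))//.
  rewrite (le_trans (heat_taylor v0_gt0 _ _ (v0v w) (us0 w)))//.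
  rewrite (_ : 40 * _ * _ = 20 * (W ^+ 4 + W ^+ 5) * (2 * `|s| ^+ 3)); last by ring.
  rewrite ler_wpM2l ?mulr_ge0 ?addr_ge0 ?exprn_ge0// (_ : 2 * _ = `|s| ^+ 3 + `|s| ^+ 3); last by ring.
  rewrite lerD//.
    by rewrite normrM exprMn ler_piMr ?exprn_ge0 ?exprn_ile1 ?innov_le1.
  rewrite -(real_normK (num_real s)).
  rewrite (_ : _ ^+ 2 = `|s| ^+ 3 * (u w ^+ 2 * `|s|)); last by ring.
  have /andP[u_ge0 u_le1] := u01 w.
  by rewrite ler_piMr ?exprn_ge0// mulr_ile1 ?sqr_ge0// exprn_ile1.
rewrite -ExB// (eq_Ex P (g := fun w => rho w + (s * (f w * heat1 (v w) (x w)) * innov n w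
  + (2^-1 * s ^+ 2 * (f w * heat2 (v w) (x w)) * innov n w ^+ 2
  - 2^-1 * s ^+ 2 * (f w * heat2 (v w) (x w)) * u w)))); last first.
  by move=> w; rewrite /rho; ring.
have bD2 : bmfun (fun w => 2^-1 * s ^+ 2 * (f w * heat2 (v w) (x w)) * innov n w ^+ 2).
  by apply: bmfunM => //; exact: bmfunX.
have b4V : bmfun (fun w => 2^-1 * s ^+ 2 * (f w * heat2 (v w) (x w)) * cvar n w).
  exact: bmfunM.
have b4u : bmfun (fun w => 2^-1 * s ^+ 2 * (f w * heat2 (v w) (x w)) * u w).
  exact: bmfunM.
have b3D : bmfun (fun w => s * (f w * heat1 (v w) (x w)) * innov n w).
  exact: bmfunM.
have bDu := bmfunB bD2 b4u.
rewrite ExD//; last exact: bmfunD.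
rewrite (ExD _ b3D bDu) (ExB _ bD2 b4u) Ex_innov// Ex_sqr_innov// add0r -ExB//.
have E0 : 0 <= E (fun w => `|cvar n w - u w|) by exact: Ex_ge0.
rewrite (le_trans (ler_normD _ _))//.
rewrite (@le_trans _ _ (40 * (W ^+ 4 + W ^+ 5) * `|s| ^+ 3
    + 2 * W ^+ 3 * (s ^+ 2 * E (fun w => `|cvar n w - u w|))))//; last first.
  rewrite /lindeberg_cst -/W -subr_ge0 (_ : _ - _ = 2 * W ^+ 3 * `|s| ^+ 3 +
    40 * (W ^+ 4 + W ^+ 5) * (s ^+ 2 * E (fun w => `|cvar n w - u w|))); last by ring.
  have s2 := sqr_ge0 s.
  by do ?[exact: s2 | exact: E0 | exact: (exprn_ge0 _ W_ge0) | exact: exprn_ge0 | apply: addr_ge0 | apply: mulr_ge0 | done].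
rewrite lerD//; first exact: norm_Ex_cst.
  rewrite [leRHS]mulrA -[leRHS]ExZ; last by apply: bmfun_norm; exact: bmfunB.
  apply: norm_Ex_dom; first exact: bmfunB.
    by apply: bmfunM; [exact: bmfun_cst|apply: bmfun_norm; exact: bmfunB].
move=> w; rewrite -mulrBr normrM ler_wpM2r//.
have s2 : 0 <= 2^-1 * s ^+ 2 by rewrite mulr_ge0 ?invr_ge0 ?sqr_ge0.
rewrite normrM (ger0_norm s2) normrM.
rewrite (_ : 2 * W ^+ 3 * _ = 2^-1 * s ^+ 2 * (1 * (W ^+ 3 * 4))); last by field.
by rewrite ler_wpM2l// ler_pM// heat2_le.
Qed.

Lemma adapted_sum_innov (s : nat -> R) m K n : (K <= n)%N ->
  adapted n (fun w => \sum_(m <= k < K) s k * innov k w).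
Proof.
elim: K => [|K IHK] Kn.
  by under eq_fun do rewrite big_geq//; exact: bmfun_cst.
have [mK|Km] := leqP m K; last first.
  by under eq_fun do rewrite big_geq//; exact: bmfun_cst.
under eq_fun do rewrite big_nat_recr//=.
apply: bmfunD; first exact/IHK/ltnW.
by apply: bmfunM; [exact: bmfun_cst|exact: adapted_innov].
Qed.

(* Telescoping along [v0 + V_m (tau p - tau j), b + S j], where S j collects
   the first j increments and tau j their variances divided by V_m. *)
Lemma lindeberg m p v0 (f : T -> R) (b : R) (s : nat -> R) : 0 < v0 ->
  adapted m f -> (forall w, `|f w| <= 1) ->
  (forall k, (m <= k)%N -> `|s k| <= 1) ->
  `|E (fun w => f w * heat v0 (b + \sum_(m <= k < m + p) s k * innov k w))
    - E (fun w => f w * heat (v0 + cvar m w * \sum_(m <= k < m + p) s k ^+ 2) b)|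
  <= lindeberg_cst v0 * \sum_(m <= k < m + p)
    (`|s k| ^+ 3 + s k ^+ 2 * E (fun w => `|cvar k w - cvar m w|)).
Proof.
move=> v0_gt0 af f1 s1.
pose S j w := \sum_(m <= k < m + j) s k * innov k w.
pose tau j := \sum_(m <= k < m + j) s k ^+ 2.
pose a j := E (fun w => f w * heat (v0 + cvar m w * (tau p - tau j)) (b + S j w)).
pose e j := `|s (m + j)%N| ^+ 3 +
  s (m + j)%N ^+ 2 * E (fun w => `|cvar (m + j) w - cvar m w|).
have tauS j : tau j.+1 = tau j + s (m + j)%N ^+ 2.
  by rewrite /tau addnS big_nat_recr ?leq_addr.
have step j : (j < p)%N -> `|a j.+1 - a j| <= lindeberg_cst v0 * e j.
  move=> jp.
  have -> : a j.+1 = E (fun w => f w * heat (v0 + cvar m w * (tau p - tau j.+1))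
      (b + S j w + s (m + j)%N * innov (m + j) w)).
    apply: eq_Ex => w; rewrite /S addnS big_nat_recr ?leq_addr//=.
    by rewrite addrA.
  have -> : a j = E (fun w => f w * heat (v0 + cvar m w * (tau p - tau j.+1)
      + cvar m w * s (m + j)%N ^+ 2) (b + S j w)).
    by apply: eq_Ex => w; rewrite tauS; congr (_ * heat _ _); ring.
  have acst (c : R) : adapted (m + j)%N (fun _ : T => c) by exact: bmfun_cst.
  have aV : adapted (m + j)%N (cvar m) by exact/adapted_cvar/leq_addr.
  have sj1 : `|s (m + j)%N| <= 1 by rewrite s1// leq_addr.
  apply: lindeberg_step => //.
  - exact: (bmfunD (acst v0) (bmfunM aV (acst _))).
  - apply: (bmfunD (acst b)).
    exact: adapted_sum_innov.
  - exact: (sub_bmfun_le (leq_addr _ _)).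
  - move=> w; rewrite lerDl mulr_ge0 ?subr_ge0//.
      by case/andP: (cvar01 m w).
    rewrite /tau [leRHS](@big_cat_nat _ _ _ (m + j.+1)%N) ?leq_addr ?leq_add2l//=.
    by rewrite lerDl sumr_ge0// => k _; exact: sqr_ge0.
  - exact: cvar01.
have telescope j : (j <= p)%N ->
    `|a j - a 0%N| <= lindeberg_cst v0 * \sum_(0 <= i < j) e i.
  clear s1; clearbody a e; elim: j => [|j IHj] jp; first by rewrite subrr normr0 big_geq// mulr0.
  rewrite big_nat_recr//= mulrDr -(subrK (a j) (a j.+1)) -addrA addrC.
  rewrite (le_trans (ler_normD _ _))// lerD ?step// IHj//.
  exact: ltnW.
have := telescope p (leqnn p).
rewrite (_ : a 0%N = E (fun w => f w * heat (v0 + cvar m w * tau p) b)); last first.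
  by apply: eq_Ex => w; rewrite /S /tau addn0 !(big_geq (leqnn m)) subr0 addr0.
rewrite (_ : a p = E (fun w => f w * heat v0 (b + S p w))); last first.
  by apply: eq_Ex => w; rewrite subrr mulr0 addr0.
move=> /le_trans; apply; rewrite -[in leRHS](add0n m) big_addn addKn.
by under [in leRHS]eq_bigr do rewrite addnC.
Qed.

(** Bounding |s k|^3 by dl s_k^2 makes the whole error a small factor times the sum of the s_k^2,
    and this sum converges in both applications. The rescaling by Cf admits a heat factor inside
    f. *)
Lemma lindeberg_tail m p v0 (f : T -> R) (b : R) (s : nat -> R) Cf dl e :
  0 < v0 -> adapted m f -> 0 < Cf -> (forall w, `|f w| <= Cf) -> dl <= 1 ->
  (forall k, (m <= k)%N -> `|s k| <= dl) ->
  (forall k, (m <= k)%N -> E (fun w => `|cvar k w - cvar m w|) <= e) ->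
  `|E (fun w => f w * heat v0 (b + \sum_(m <= k < m + p) s k * innov k w))
    - E (fun w => f w * heat (v0 + cvar m w * \sum_(m <= k < m + p) s k ^+ 2) b)|
  <= Cf * lindeberg_cst v0 * ((dl + e) * \sum_(m <= k < m + p) s k ^+ 2).
Proof.
move=> v0_gt0 af Cf0 fC dl1 sdl Ve.
have acst N (a : R) : adapted N (fun _ : T => a) by exact: bmfun_cst.
have af' : adapted m (fun w => Cf^-1 * f w) by exact: (bmfunM (acst m _) af).
have fE h : bmfun h -> E (fun w => f w * h w) = Cf * E (fun w => Cf^-1 * f w * h w).
  move=> bh; rewrite -ExZ; last exact: (bmfunM (adapted_bmfun af')).
  by apply: eq_Ex => w; rewrite !mulrA mulfV ?mul1r// gt_eqF.
have aV : adapted m (cvar m) by exact: adapted_cvar.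
have aS : adapted (m + p)%N (fun w => \sum_(m <= k < m + p) s k * innov k w).
  exact: adapted_sum_innov.
have ah1 := adapted_heat v0_gt0 (acst (m + p)%N v0) (bmfunD (acst (m + p)%N b) aS)
  (fun w => lexx _).
have ah2 : adapted m (fun w => heat (v0 + cvar m w * \sum_(m <= k < m + p) s k ^+ 2) b).
  apply: (adapted_heat v0_gt0) => //; first exact: (bmfunD (acst m v0) (bmfunM aV (acst m _))).
  move=> w; rewrite lerDl mulr_ge0//; first by case/andP: (cvar01 m w).
  by rewrite sumr_ge0// => k _; exact: sqr_ge0.
rewrite (fE _ (adapted_bmfun ah1)) (fE _ (adapted_bmfun ah2)) -mulrBr normrM gtr0_norm//.
rewrite -mulrA ler_pM2l//.
have f1 w : `|Cf^-1 * f w| <= 1.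
  by rewrite normrM gtr0_norm ?invr_gt0// mulrC ler_pdivrMr// mul1r.
have s1 k : (m <= k)%N -> `|s k| <= 1 by move=> /sdl/le_trans; apply.
rewrite (le_trans (lindeberg p b v0_gt0 af' f1 s1))//.
have W0 : 0 <= isqrt v0 by rewrite ltW// isqrt_gt0.
rewrite ler_wpM2l//.
  by rewrite /lindeberg_cst addr_ge0 ?mulr_ge0 ?addr_ge0 ?exprn_ge0.
rewrite mulr_sumr; apply: ler_sum_nat => k /andP[mk _].
rewrite mulrDl lerD//; last by rewrite mulrC ler_wpM2r ?sqr_ge0// Ve.
by rewrite exprS real_normK ?num_real// ler_wpM2r ?sqr_ge0// sdl.
Qed.

Definition heat_lip_cst v0 : R := 4 * isqrt v0 ^+ 3 + 2 * isqrt v0 ^+ 2.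

Lemma lindeberg_cst_ge0 v0 : 0 < v0 -> 0 <= lindeberg_cst v0.
Proof.
move=> /isqrt_gt0/ltW i0.
by rewrite /lindeberg_cst addr_ge0 ?mulr_ge0 ?addr_ge0 ?exprn_ge0.
Qed.

Lemma heat_lip_cst_ge0 v0 : 0 < v0 -> 0 <= heat_lip_cst v0.
Proof.
move=> /isqrt_gt0/ltW i0.
by rewrite /heat_lip_cst addr_ge0 ?mulr_ge0 ?exprn_ge0.
Qed.

Lemma Ex_heat_lip v0 (f v v' x x' h : T -> R) Cf : 0 < v0 ->
  bmfun f -> bmfun v -> bmfun v' -> bmfun x -> bmfun x' -> bmfun h ->
  (forall w, `|f w| <= Cf) -> (forall w, v0 <= v w) -> (forall w, v0 <= v' w) ->
  (forall w, `|v w - v' w| + `|x w - x' w| <= h w) ->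
  `|E (fun w => f w * heat (v w) (x w)) - E (fun w => f w * heat (v' w) (x' w))|
  <= Cf * heat_lip_cst v0 * E h.
Proof.
move=> v0_gt0 bf bv bv' bx bx' bh fC v0v v0v' vxh.
have bheat (u y : T -> R) : bmfun u -> bmfun y -> (forall w, v0 <= u w) ->
    bmfun (fun w => heat (u w) (y w)).
  move=> [mu _] [my _] v0u; split; first exact: measurable_heat.
  by exists (isqrt v0) => w; exact: heat_le.
rewrite -ExZ//; apply: norm_ExB.
- exact: (bmfunM bf (bheat _ _ bv bx v0v)).
- exact: (bmfunM bf (bheat _ _ bv' bx' v0v')).
- by apply: bmfunM => //; exact: bmfun_cst.
- move=> w; rewrite -mulrBr normrM -mulrA ler_pM//.
  rewrite (le_trans (heat_lip v0_gt0 _ _ (v0v w) (v0v' w)))// ler_wpM2l//.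
  by rewrite addr_ge0 ?mulr_ge0 ?exprn_ge0// ltW// isqrt_gt0.
Qed.

Variables (c : R) (r : nat -> R) (Zoo : T -> R).
Hypothesis r_lim : n%:R * r n @[n --> \oo] --> c.
Hypothesis Z_rec : forall n w, Z n.+1 w = Z n w + r n * innov n w.
Hypothesis mZoo : measurable_fun [set: T] Zoo.
Hypothesis Zoo01 : forall w, 0 <= Zoo w <= 1.
Hypothesis Zoo_lim : {ae P, forall w, Z n w @[n --> \oo] --> Zoo w}.

Lemma Z_sum m n w : (m <= n)%N ->
  Z n w = Z m w + \sum_(m <= k < n) r k * innov k w.
Proof.
move=> /subnK <-; elim: (n - m)%N => [|p IHp]; first by rewrite big_geq// addr0.
by rewrite addSn Z_rec big_nat_recr ?leq_addl//= IHp addrA.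
Qed.

Definition emp n w := n%:R^-1 * \sum_(0 <= k < n) X k.+1 w.

(** One more draw changes X_1 + ... + X_n - n Z_n by (1 - (n+1) r_n) (X_(n+1) - Z_n). *)
Lemma emp_sum n w : (0 < n)%N ->
  emp n w - Z n w = n%:R^-1 * \sum_(0 <= k < n) past_coef r k * innov k w.
Proof.
move=> n0; rewrite /emp -[Z n w](mulKf (_ : n%:R != 0)) ?pnatr_eq0 -?lt0n// -mulrBr.
congr (_ * _); elim: n {n0} => [|n IHn]; first by rewrite !big_geq// mul0r subrr.
by rewrite !big_nat_recr//= -IHn Z_rec /past_coef /innov -natr1; ring.
Qed.

Definition limvar w := Zoo w * (1 - Zoo w).

Lemma bmfun_Zoo : bmfun Zoo.
Proof.
by split => //; exists 1 => w; have /andP[? ?] := Zoo01 w; rewrite ger0_norm.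
Qed.

Lemma limvar01 w : 0 <= limvar w <= 1.
Proof. by rewrite /limvar; have /andP[] := Zoo01 w; nra. Qed.

Lemma bmfun_limvar : bmfun limvar.
Proof.
have b := bmfun_Zoo; apply: (bmfunM b).
by apply: bmfunB => //; exact: bmfun_cst.
Qed.

Lemma bmfun_Z n : bmfun (Z n).
Proof. exact: (adapted_bmfun (adapted_Z (leqnn n))). Qed.

Lemma bmfun_cvar n : bmfun (cvar n).
Proof. exact: (adapted_bmfun (adapted_cvar (leqnn n))). Qed.

Lemma bmfun_distZ n : bmfun (fun w => `|Z n w - Zoo w|).
Proof. by apply: bmfun_norm; exact: (bmfunB (bmfun_Z n) bmfun_Zoo). Qed.

Lemma cvar_dist n w : `|cvar n w - limvar w| <= `|Z n w - Zoo w|.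
Proof.
rewrite /cvar /limvar (_ : _ - _ = (Z n w - Zoo w) * (1 - Z n w - Zoo w)); last by ring.
rewrite normrM ler_piMr// ler_norml.
by have /andP[] := Z01 n w; have /andP[] := Zoo01 w; lra.
Qed.

Lemma cvar_dist2 m n w :
  `|cvar n w - cvar m w| <= `|Z n w - Zoo w| + `|Z m w - Zoo w|.
Proof.
rewrite -(subrK (limvar w) (cvar n w)) -addrA (le_trans (ler_normD _ _))//.
by rewrite lerD ?cvar_dist// distrC cvar_dist.
Qed.

Lemma Ex_distZ_cvg : E (fun w => `|Z n w - Zoo w|) @[n --> \oo] --> (0 : R).
Proof.
rewrite -(Ex_cst P 0); apply: (@Ex_cvg _ _ _ _ _ _ 1).
- by move=> n; case: (bmfun_distZ n).
- exact: measurable_cst.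
- move=> n w; rewrite normr_id ler_norml.
  by have /andP[] := Z01 n w; have /andP[] := Zoo01 w; lra.
- apply: filterS Zoo_lim => w Zw.
  rewrite -(@normr0 _ R); apply: cvg_norm; rewrite -(subrr (Zoo w)).
  by apply: cvgB => //; exact: cvg_cst.
Qed.

Definition fluctA n w := Num.sqrt n%:R * (Z n w - Zoo w).
Definition fluctB n w := Num.sqrt n%:R * (emp n w - Z n w).

Lemma fluctB_sum n w : fluctB n w =
  \sum_(0 <= k < n) past_coef r k / Num.sqrt n%:R * innov k w.
Proof.
(* For n = 0 both sides vanish: sqrt 0 = 0 and the sum is empty. *)
have [->|n0] := posnP n; first by rewrite /fluctB sqrtr0 mul0r big_geq.
rewrite /fluctB emp_sum// mulr_sumr mulr_sumr; apply: eq_bigr => k _.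
rewrite -{2}(@sqr_sqrtr _ n%:R)//; field.
by rewrite sqrtr_eq0 -ltNge ltr0n.
Qed.

Lemma adapted_fluctB n : adapted n (fluctB n).
Proof.
have -> : fluctB n = (fun w => \sum_(0 <= k < n) past_coef r k / Num.sqrt n%:R * innov k w).
  by apply/funext => w; exact: fluctB_sum.
exact: (adapted_sum_innov (fun k => past_coef r k / Num.sqrt n%:R)).
Qed.

(** Zoo involves all later innovations, whereas the replacement handles finitely many. With n fixed,
    E|Z_k - Zoo| -> 0 yields a time K n at which even the factor sqrt n is harmless; K n >= n^2
    keeps the truncated variance asymptotic to c^2. *)
Lemma exists_horizon : exists K : nat -> nat,
  forall n, (n ^ 2 <= K n)%N /\
    Num.sqrt n%:R * E (fun w => `|Z (K n) w - Zoo w|) <= n.+1%:R^-1.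
Proof.
suff ex n : exists k, (n ^ 2 <= k)%N /\
    Num.sqrt n%:R * E (fun w => `|Z k w - Zoo w|) <= n.+1%:R^-1.
  by have [K KP] := choice ex; exists K.
have h : Num.sqrt n%:R * E (fun w => `|Z k w - Zoo w|) @[k --> \oo] --> Num.sqrt n%:R * (0 : R).
  by apply: cvgM; [exact: cvg_cst|exact: Ex_distZ_cvg].
rewrite mulr0 in h.
have := @cvgr_le _ _ _ _ _ _ h n.+1%:R^-1.
rewrite invr_gt0 ltr0n => /(_ _ isT) hn.
have [k] : \forall k \near \oo, (n ^ 2 <= k)%N /\
    Num.sqrt n%:R * E (fun w => `|Z k w - Zoo w|) <= n.+1%:R^-1.
  by near=> k; split; [near: k; exact: nbhs_infty_ge|near: k].
by move=> _ /(_ k (leqnn k)) ?; exists k.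
Unshelve. all: by end_near. Qed.

(** * Joint limit against functions of the past *)

Section joint_limit.
Variables (m0 : nat) (f : T -> R) (v1 v2 a b : R).
Hypotheses (af : adapted m0 f) (f1 : forall w, `|f w| <= 1).
Hypotheses (v1_gt0 : 0 < v1) (v2_gt0 : 0 < v2).

Let C := (isqrt v1 + isqrt v2 + 1) *
  (lindeberg_cst v1 + lindeberg_cst v2 + heat_lip_cst v1 + heat_lip_cst v2).

Let C_ge (W L x y : R) : 0 <= W -> 0 <= L -> W <= isqrt v1 + isqrt v2 + 1 ->
  L <= lindeberg_cst v1 + lindeberg_cst v2 + heat_lip_cst v1 + heat_lip_cst v2 ->
  0 <= x -> x <= y -> W * L * x <= C * y.
Proof.
move=> W0 L0 WW LL x0 xy.
exact: (ler_pM (mulr_ge0 W0 L0) x0 (ler_pM W0 L0 WW LL) xy).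
Qed.

Let lip_step v0 g u u' x x' h W y : 0 < v0 -> bmfun g -> bmfun u -> bmfun u' ->
  bmfun x -> bmfun x' -> bmfun h -> (forall w, `|g w| <= W) ->
  (forall w, v0 <= u w) -> (forall w, v0 <= u' w) ->
  (forall w, `|u w - u' w| + `|x w - x' w| <= h w) ->
  W <= isqrt v1 + isqrt v2 + 1 ->
  heat_lip_cst v0 <= lindeberg_cst v1 + lindeberg_cst v2 +
    heat_lip_cst v1 + heat_lip_cst v2 -> E h <= y ->
  `|E (fun w => g w * heat (u w) (x w)) - E (fun w => g w * heat (u' w) (x' w))|
    <= C * y.
Proof.
move=> v0_gt0 bg bu bu' bx bx' bh gW v0u v0u' uxh WW Lle hy.
apply: (le_trans (Ex_heat_lip v0_gt0 bg bu bu' bx bx' bh gW v0u v0u' uxh)).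
apply: (C_ge _ (heat_lip_cst_ge0 v0_gt0) WW Lle _ hy).
- exact: (le_trans (normr_ge0 (g point)) (gW point)).
- apply: Ex_ge0 => w; apply: le_trans (uxh w).
  exact: (addr_ge0 (normr_ge0 _) (normr_ge0 _)).
Qed.

Let le_sum3 (x y : R) : 0 < x -> 0 < y -> x <= x + y + 1 /\ y <= x + y + 1.
Proof. by move=> *; split; lra. Qed.

Let le_sum4 (x y z t : R) : 0 <= x -> 0 <= y -> 0 <= z -> 0 <= t ->
  (x <= x + y + z + t /\ y <= x + y + z + t) /\
  (z <= x + y + z + t /\ t <= x + y + z + t).
Proof. by move=> *; do !split; lra. Qed.

Let dist_mul_le (v t s z : R) : 0 <= v <= 1 -> 0 <= s ->
  `|v * t - s * z| <= `|t - s| + s * `|v - z|.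
Proof.
move=> /andP[v0 v1'] s0.
rewrite (_ : _ - _ = v * (t - s) + s * (v - z)); last by ring.
rewrite (le_trans (ler_normD _ _))// !normrM lerD//.
  by rewrite ler_piMl// ger0_norm.
by rewrite ger0_norm.
Qed.

(** Write V_k = Z_k (1 - Z_k) and Voo = Zoo (1 - Zoo). The seven summands are the costs of seven
    replacements, in this order: Zoo by Z_(K n) in A_n; the innovations in [n, K n) by the variance
    tau1 V_n; tau1 V_n by c^2 V_m; omission of the first m innovations of B_n; those in [m, n) by
    the variance tau2 V_m; tau2 V_m by (1 - c)^2 Voo; and V_m by Voo in the first factor. *)
Lemma joint_limit_bound (K : nat -> nat) (B1 B2 : R) m n e tau1 tau2 :
  0 < B1 -> 0 < B2 ->
  (forall k n, `|past_coef r k / Num.sqrt n%:R| <= B1 / Num.sqrt n%:R) ->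
  (forall n k, (0 < n <= k)%N -> `|Num.sqrt n%:R * r k| <= B2 / Num.sqrt n%:R) ->
  (m0 <= m < n)%N -> (n <= K n)%N ->
  B1 / Num.sqrt n%:R <= 1 -> B2 / Num.sqrt n%:R <= 1 ->
  (forall k, (m <= k)%N -> E (fun w => `|Z k w - Zoo w|) <= e) ->
  tau1 = \sum_(n <= k < K n) (Num.sqrt n%:R * r k) ^+ 2 ->
  tau2 = \sum_(m <= k < n) (past_coef r k / Num.sqrt n%:R) ^+ 2 ->
  `|E (fun w => f w * (heat v1 (a - fluctA n w) * heat v2 (b - fluctB n w)))
    - E (fun w => f w * (heat (v1 + c ^+ 2 * limvar w) a
                       * heat (v2 + (1 - c) ^+ 2 * limvar w) b))|
  <= C * (Num.sqrt n%:R * E (fun w => `|Z (K n) w - Zoo w|)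
     + (B2 / Num.sqrt n%:R + 2 * e) * tau1
     + (`|tau1 - c ^+ 2| + 2 * c ^+ 2 * e)
     + m%:R * (B1 / Num.sqrt n%:R)
     + (B1 / Num.sqrt n%:R + 2 * e) * tau2
     + (`|tau2 - (1 - c) ^+ 2| + (1 - c) ^+ 2 * e)
     + c ^+ 2 * e).
Proof.
move=> B1_gt0 B2_gt0 pB1 fB2 /andP[m0m mn] nK B1n B2n distZ tau1E tau2E.
set W1 := isqrt v1; set W2 := isqrt v2.
have W1_gt0 : 0 < W1 by exact: isqrt_gt0.
have W2_gt0 : 0 < W2 by exact: isqrt_gt0.
have [W1le W2le] : W1 <= W1 + W2 + 1 /\ W2 <= W1 + W2 + 1.
  exact: le_sum3.
have [[K1 K2] [L1 L2]] := ((lindeberg_cst_ge0 v1_gt0, lindeberg_cst_ge0 v2_gt0),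
  (heat_lip_cst_ge0 v1_gt0, heat_lip_cst_ge0 v2_gt0)).
set M := lindeberg_cst v1 + lindeberg_cst v2 + heat_lip_cst v1 + heat_lip_cst v2.
have [[K1le K2le] [L1le L2le]] : (lindeberg_cst v1 <= M /\ lindeberg_cst v2 <= M) /\
    (heat_lip_cst v1 <= M /\ heat_lip_cst v2 <= M).
  exact: le_sum4.
have n0 : (0 < n)%N by exact: leq_ltn_trans mn.
have e0 : 0 <= e by apply: le_trans (distZ m (leqnn m)); exact: Ex_ge0.
have distV i j : (m <= i)%N -> (m <= j)%N ->
    E (fun w => `|cvar i w - cvar j w|) <= 2 * e.
  move=> mi mj; apply: (@le_trans _ _ (E (fun w => `|Z i w - Zoo w| + `|Z j w - Zoo w|))).
    apply: le_Ex; last by move=> w; exact: cvar_dist2.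
      by apply: bmfun_norm; exact: (bmfunB (bmfun_cvar i) (bmfun_cvar j)).
    exact: (bmfunD (bmfun_distZ i) (bmfun_distZ j)).
  rewrite ExD; [|exact: bmfun_distZ..].
  by rewrite (_ : 2 * e = e + e); [rewrite lerD// distZ|ring].
have tau1_ge0 : 0 <= tau1 by rewrite tau1E sumr_ge0// => k _; exact: sqr_ge0.
have tau2_ge0 : 0 <= tau2 by rewrite tau2E sumr_ge0// => k _; exact: sqr_ge0.
have af' N : (m <= N)%N -> adapted N f.
  by move=> mN; exact: (sub_bmfun_le (leq_trans m0m mN)).
have acst N (x : R) : adapted N (fun _ : T => x) by exact: bmfun_cst.
have bcst (x : R) : bmfun (fun _ : T => x) by exact: bmfun_cst.
have bf : bmfun f := adapted_bmfun af.
have [W1_ge0 W2_ge0] := (ltW W1_gt0, ltW W2_gt0).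
have aB := adapted_fluctB n.
have aVn : adapted n (cvar n) by exact: adapted_cvar.
have aVm : adapted m (cvar m) by exact: adapted_cvar.
have V0 i w : 0 <= cvar i w by case/andP: (cvar01 i w).
have Voo0 w : 0 <= limvar w by case/andP: (limvar01 w).
have aBx : adapted n (fun w => b - fluctB n w) by exact: (bmfunB (acst n b) aB).
have ahB := adapted_heat v2_gt0 (acst n v2) aBx (fun=> lexx _).
have ahVm : adapted m (fun w => heat (v1 + c ^+ 2 * cvar m w) a).
  apply: (adapted_heat v1_gt0) => //.
    exact: (bmfunD (acst m v1) (bmfunM (acst m (c ^+ 2)) aVm)).
  by move=> w; rewrite lerDl mulr_ge0 ?sqr_ge0.
pose g1 w := f w * heat v2 (b - fluctB n w).
have ag1 : adapted n g1 by exact: (bmfunM (af' n (ltnW mn)) ahB).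
have g1W w : `|g1 w| <= W2.
  by rewrite normrM -[leRHS]mul1r ler_pM// heat_le.
pose g2 w := f w * heat (v1 + c ^+ 2 * cvar m w) a.
have ag2 : adapted m g2 by exact: (bmfunM (af' m (leqnn m)) ahVm).
have g2W w : `|g2 w| <= W1.
  rewrite normrM -[leRHS]mul1r ler_pM//; apply: heat_le => //.
  by rewrite lerDl mulr_ge0 ?sqr_ge0.
have bheat v (u : T -> R) x : 0 < v -> bmfun u -> (forall w, v <= u w) ->
    bmfun (fun w => heat (u w) x).
  move=> v_gt0 [mu _] vu; split; first exact: measurable_heat.
  by exists (isqrt v) => w; exact: heat_le.
have bVoo v y : bmfun (fun w => v + y * limvar w).
  exact: (bmfunD (bcst v) (bmfunM (bcst y) bmfun_limvar)).
have bV i v y : bmfun (fun w => v + y * cvar i w).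
  exact: (bmfunD (bcst v) (bmfunM (bcst y) (bmfun_cvar i))).
have leV i v y w : 0 <= y -> v <= v + y * cvar i w by move=> y0; rewrite lerDl mulr_ge0.
have leVoo v y w : 0 <= y -> v <= v + y * limvar w by move=> y0; rewrite lerDl mulr_ge0.
pose g3 w := f w * heat (v2 + (1 - c) ^+ 2 * limvar w) b.
have bg3 : bmfun g3.
  apply: (bmfunM bf); apply: (bheat v2) => // w; exact/leVoo/sqr_ge0.
have g3W w : `|g3 w| <= W2.
  rewrite normrM -[leRHS]mul1r ler_pM//; apply: heat_le => //.
  exact/leVoo/sqr_ge0.
have bg1 := adapted_bmfun ag1; have bg2 := adapted_bmfun ag2.
have EC := Ex_cst P.
(* The signs differ because the test functions take a - A_n and b - B_n: A_n is minus a tail sum,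
   B_n is plus a sum. *)
pose s1 k := Num.sqrt n%:R * r k.
pose s2 k := - (past_coef r k / Num.sqrt n%:R).
pose x1 w := a + \sum_(n <= k < K n) s1 k * innov k w.
pose x2 w := b + \sum_(m <= k < n) s2 k * innov k w.
have bx1 : bmfun x1.
  exact: (bmfunD (bcst a) (adapted_bmfun (adapted_sum_innov s1 n (leqnn (K n))))).
have bx2 : bmfun x2.
  exact: (bmfunD (bcst b) (adapted_bmfun (adapted_sum_innov s2 m (leqnn n)))).
have bA : bmfun (fun w => a - fluctA n w).
  apply: (bmfunB (bcst a)); apply: (bmfunM (bcst _)).
  exact: (bmfunB (bmfun_Z n) bmfun_Zoo).
have -> : E (fun w => f w * (heat v1 (a - fluctA n w) * heat v2 (b - fluctB n w))) =
    E (fun w => g1 w * heat v1 (a - fluctA n w)).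
  by apply: eq_Ex => w; rewrite /g1 -mulrA; congr (_ * _); exact: mulrC.
have -> : E (fun w => f w * (heat (v1 + c ^+ 2 * limvar w) a
    * heat (v2 + (1 - c) ^+ 2 * limvar w) b)) =
    E (fun w => g3 w * heat (v1 + c ^+ 2 * limvar w) a).
  by apply: eq_Ex => w; rewrite /g3 -mulrA; congr (_ * _); exact: mulrC.
pose T1 := E (fun w => g1 w * heat v1 (x1 w)).
pose T2 := E (fun w => g1 w * heat (v1 + cvar n w * tau1) a).
pose T3 := E (fun w => g1 w * heat (v1 + c ^+ 2 * cvar m w) a).
pose T4 := E (fun w => g2 w * heat v2 (x2 w)).
pose T5 := E (fun w => g2 w * heat (v2 + cvar m w * tau2) b).
pose T6 := E (fun w => g3 w * heat (v1 + c ^+ 2 * cvar m w) a).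
(* The same product regrouped: the factor in a is now F_m-measurable and becomes the prefactor,
   while the factor in b absorbs the innovations. [T6E] regroups back. *)
have T3E : T3 = E (fun w => g2 w * heat v2 (b - fluctB n w)).
  by apply: eq_Ex => w; exact: mulrAC.
have T6E : T6 = E (fun w => g2 w * heat (v2 + (1 - c) ^+ 2 * limvar w) b).
  by apply: eq_Ex => w; exact: mulrAC.
have bdV i j : bmfun (fun w => `|cvar i w - cvar j w|).
  by apply: bmfun_norm; exact: (bmfunB (bmfun_cvar i) (bmfun_cvar j)).
have cc0 : 0 <= c ^+ 2 by exact: sqr_ge0.
have dd0 : 0 <= (1 - c) ^+ 2 by exact: sqr_ge0.
have mm : (m <= m)%N by [].
have bV' i v y : bmfun (fun w => v + cvar i w * y).
  exact: (bmfunD (bcst v) (bmfunM (bmfun_cvar i) (bcst y))).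
have leV' i v y w : 0 <= y -> v <= v + cvar i w * y by rewrite mulrC; exact: leV.
have bsq y i : bmfun (fun w => y * `|Z i w - Zoo w|).
  exact: (bmfunM (bcst _) (bmfun_distZ i)).
have dist0 (x y z : R) : `|x + y - (x + z)| + `|a - a| = `|y - z|.
  by rewrite subrr normr0 addr0 opprD addrACA subrr add0r.
have dist0b (x y z : R) : `|x + y - (x + z)| + `|b - b| = `|y - z|.
  by rewrite subrr normr0 addr0 opprD addrACA subrr add0r.
have n_ge0 : 0 <= Num.sqrt n%:R :> R by exact: sqrtr_ge0.
have B1n_ge0 : 0 <= B1 / Num.sqrt n%:R by exact: (divr_ge0 (ltW B1_gt0) n_ge0).
have B2n_ge0 : 0 <= B2 / Num.sqrt n%:R by exact: (divr_ge0 (ltW B2_gt0) n_ge0).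
have e2_ge0 : 0 <= 2 * e by exact: mulr_ge0.
have step7 : `|T6 - E (fun w => g3 w * heat (v1 + c ^+ 2 * limvar w) a)| <= C * (c ^+ 2 * e).
  apply: (@lip_step v1 g3 _ _ (fun=> a) (fun=> a) (fun w => c ^+ 2 * `|Z m w - Zoo w|) W2
    _ v1_gt0 bg3 (bV _ _ _) (bVoo _ _) (bcst a) (bcst a) (bsq _ _) g3W
    (fun w => leV _ _ _ w cc0) (fun w => leVoo _ _ w cc0) _ W2le L1le).
    move=> w; rewrite dist0 -mulrBr normrM (ger0_norm cc0).
    exact: (ler_wpM2l cc0 (cvar_dist _ _)).
  by rewrite (ExZ _ _ (bmfun_distZ m)); exact: (ler_wpM2l cc0 (distZ m mm)).
have step6 : `|T5 - T6| <= C * (`|tau2 - (1 - c) ^+ 2| + (1 - c) ^+ 2 * e).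
  rewrite T6E.
  apply: (@lip_step v2 g2 _ _ (fun=> b) (fun=> b)
    (fun w => `|tau2 - (1 - c) ^+ 2| + (1 - c) ^+ 2 * `|Z m w - Zoo w|) W1
    _ v2_gt0 bg2 (bV' _ _ _) (bVoo _ _) (bcst b) (bcst b) (bmfunD (bcst _) (bsq _ _)) g2W
    (fun w => leV' _ _ _ w tau2_ge0) (fun w => leVoo _ _ w dd0) _ W1le L2le).
    move=> w; rewrite dist0b; apply: (le_trans (dist_mul_le _ _ (cvar01 m w) dd0)).
    exact: (lerD (lexx _) (ler_wpM2l dd0 (cvar_dist _ _))).
  rewrite (ExD _ (bcst _) (bsq _ _)) EC (ExZ _ _ (bmfun_distZ m)).
  exact: (lerD (lexx _) (ler_wpM2l dd0 (distZ m mm))).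
have step5 : `|T4 - T5| <= C * ((B1 / Num.sqrt n%:R + 2 * e) * tau2).
  have s2le k : (m <= k)%N -> `|s2 k| <= B1 / Num.sqrt n%:R.
    by move=> _; rewrite /s2 normrN; exact: pB1.
  have := @lindeberg_tail m (n - m) v2 g2 b s2 W1 (B1 / Num.sqrt n%:R) (2 * e)
    v2_gt0 ag2 W1_gt0 g2W B1n s2le (fun k mk => distV k m mk mm).
  rewrite (subnKC (ltnW mn)) (_ : \sum_(m <= k < n) s2 k ^+ 2 = tau2); last first.
    by rewrite tau2E; apply: eq_bigr => k _; exact: sqrrN.
  move=> /le_trans; apply; apply: (C_ge W1_ge0 K2 W1le K2le _ (lexx _)).
  exact: (mulr_ge0 (addr_ge0 B1n_ge0 e2_ge0) tau2_ge0).
have step4 : `|T3 - T4| <= C * (m%:R * (B1 / Num.sqrt n%:R)).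
  rewrite T3E.
  apply: (@lip_step v2 g2 (fun=> v2) (fun=> v2) _ x2 (fun=> m%:R * (B1 / Num.sqrt n%:R)) W1
    _ v2_gt0 bg2 (bcst _) (bcst _) (adapted_bmfun aBx) bx2 (bcst _) g2W
    (fun=> lexx _) (fun=> lexx _) _ W1le L2le).
    move=> w; rewrite subrr normr0 add0r fluctB_sum /x2 /s2.
    under [X in _ - (_ + X)]eq_bigr do rewrite mulNr.
    rewrite sumrN (@big_cat_nat _ _ _ m 0 n _ _ (leq0n m) (ltnW mn))/=.
    rewrite (_ : _ - _ = - \sum_(0 <= k < m) past_coef r k / Num.sqrt n%:R * innov k w); last by ring.
    rewrite normrN; apply: (le_trans (ler_norm_sum _ _ _)).
    rewrite -[m in leRHS]subn0 mulr_natl -sumr_const_nat.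
    apply: ler_sum => k _; rewrite normrM -[leRHS]mulr1.
    exact: (ler_pM (normr_ge0 _) (normr_ge0 _) (pB1 k n) (innov_le1 k w)).
  by rewrite EC.
have step3 : `|T2 - T3| <= C * (`|tau1 - c ^+ 2| + 2 * c ^+ 2 * e).
  have bdd : bmfun (fun w => c ^+ 2 * `|cvar n w - cvar m w|).
    exact: (bmfunM (bcst _) (bdV n m)).
  apply: (@lip_step v1 g1 _ _ (fun=> a) (fun=> a)
    (fun w => `|tau1 - c ^+ 2| + c ^+ 2 * `|cvar n w - cvar m w|) W2
    _ v1_gt0 bg1 (bV' _ _ _) (bV _ _ _) (bcst a) (bcst a) (bmfunD (bcst _) bdd) g1W
    (fun w => leV' _ _ _ w tau1_ge0) (fun w => leV _ _ _ w cc0) _ W2le L1le).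
    by move=> w; rewrite dist0; exact: (dist_mul_le _ _ (cvar01 n w) cc0).
  rewrite (ExD _ (bcst _) bdd) EC (ExZ _ _ (bdV n m)).
  rewrite (_ : 2 * c ^+ 2 * e = c ^+ 2 * (2 * e)); last by ring.
  exact: (lerD (lexx _) (ler_wpM2l cc0 (distV n m (ltnW mn) mm))).
have step2 : `|T1 - T2| <= C * ((B2 / Num.sqrt n%:R + 2 * e) * tau1).
  have s1le k : (n <= k)%N -> `|s1 k| <= B2 / Num.sqrt n%:R.
    by move=> nk; apply: fB2; rewrite n0.
  have := @lindeberg_tail n (K n - n) v1 g1 a s1 W2 (B2 / Num.sqrt n%:R) (2 * e)
    v1_gt0 ag1 W2_gt0 g1W B2n s1le
    (fun k nk => distV k n (leq_trans (ltnW mn) nk) (ltnW mn)).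
  rewrite (subnKC nK) (_ : \sum_(n <= k < K n) s1 k ^+ 2 = tau1); last by rewrite tau1E.
  move=> /le_trans; apply; apply: (C_ge W2_ge0 K1 W2le K1le _ (lexx _)).
  exact: (mulr_ge0 (addr_ge0 B2n_ge0 e2_ge0) tau1_ge0).
have step1 : `|E (fun w => g1 w * heat v1 (a - fluctA n w)) - T1| <=
    C * (Num.sqrt n%:R * E (fun w => `|Z (K n) w - Zoo w|)).
  apply: (@lip_step v1 g1 (fun=> v1) (fun=> v1) _ x1
    (fun w => Num.sqrt n%:R * `|Z (K n) w - Zoo w|) W2
    _ v1_gt0 bg1 (bcst _) (bcst _) bA bx1 (bsq _ _) g1W
    (fun=> lexx _) (fun=> lexx _) _ W2le L1le).
    move=> w; rewrite subrr normr0 add0r /x1 /s1 /fluctA (Z_sum w nK).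
    under [X in _ - (_ + X)]eq_bigr do rewrite -mulrA.
    rewrite -mulr_sumr -{3}(ger0_norm n_ge0) -normrM -normrN.
    by rewrite le_eqVlt; apply/orP; left; apply/eqP; congr `|_|; ring.
  by rewrite (ExZ _ _ (bmfun_distZ (K n))).
clearbody T1 T2 T3 T4 T5 T6 C.
apply: (le_trans (ler_distD T6 _ _)); rewrite mulrDr; apply: lerD step7.
apply: (le_trans (ler_distD T5 _ _)); rewrite mulrDr; apply: lerD step6.
apply: (le_trans (ler_distD T4 _ _)); rewrite mulrDr; apply: lerD step5.
apply: (le_trans (ler_distD T3 _ _)); rewrite mulrDr; apply: lerD step4.
apply: (le_trans (ler_distD T2 _ _)); rewrite mulrDr; apply: lerD step3.
apply: (le_trans (ler_distD T1 _ _)); rewrite mulrDr; exact: lerD step2.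
Qed.

Lemma joint_limit :
  E (fun w => f w * (heat v1 (a - fluctA n w) * heat v2 (b - fluctB n w)))
    @[n --> \oo] -->
  E (fun w => f w * (heat (v1 + c ^+ 2 * limvar w) a
                   * heat (v2 + (1 - c) ^+ 2 * limvar w) b)).
Proof.
have [K KP] := exists_horizon.
have [B1 B1_gt0 pB1] := past_coef_sup r_lim.
have [B2 B2_gt0 fB2] := future_coef_sup r_lim.
have C_ge0 : 0 <= C.
  apply: mulr_ge0.
    by rewrite !addr_ge0 ?(ltW (isqrt_gt0 _)).
  have [k1 k2] := (lindeberg_cst_ge0 v1_gt0, lindeberg_cst_ge0 v2_gt0).
  have [l1 l2] := (heat_lip_cst_ge0 v1_gt0, heat_lip_cst_ge0 v2_gt0).
  exact: (addr_ge0 (addr_ge0 (addr_ge0 k1 k2) l1) l2).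
(* The coefficient of e that survives n -> oo in the bound: (2 + 2 + 1) c^2 + (2 + 1) (1 - c)^2. *)
pose S := 5 * c ^+ 2 + 3 * (1 - c) ^+ 2.
have S_ge0 : 0 <= S.
  exact: (addr_ge0 (mulr_ge0 (ler0n _ 5) (sqr_ge0 c)) (mulr_ge0 (ler0n _ 3) (sqr_ge0 _))).
apply/cvgrPdist_le => eps eps_gt0.
pose e := eps / (C * S + 1).
have CS1 : 0 < C * S + 1 := ltr_wpDl (mulr_ge0 C_ge0 S_ge0) ltr01.
have e_gt0 : 0 < e by exact: divr_gt0.
have [N _ distN] : \forall n \near \oo, E (fun w => `|Z n w - Zoo w|) <= e.
  exact: (cvgr_le 0 Ex_distZ_cvg).
pose m := maxn m0 N.
have distm k : (m <= k)%N -> E (fun w => `|Z k w - Zoo w|) <= e.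
  by move=> mk; apply: distN; exact: leq_trans (leq_maxr m0 N) mk.
pose t1 n := \sum_(n <= k < K n) (Num.sqrt n%:R * r k) ^+ 2.
pose t2 n := \sum_(m <= k < n) (past_coef r k / Num.sqrt n%:R) ^+ 2.
pose u n := C * (Num.sqrt n%:R * E (fun w => `|Z (K n) w - Zoo w|)
     + (B2 / Num.sqrt n%:R + 2 * e) * t1 n
     + (`|t1 n - c ^+ 2| + 2 * c ^+ 2 * e)
     + m%:R * (B1 / Num.sqrt n%:R)
     + (B1 / Num.sqrt n%:R + 2 * e) * t2 n
     + (`|t2 n - (1 - c) ^+ 2| + (1 - c) ^+ 2 * e)
     + c ^+ 2 * e).
have t1_cvg : t1 n @[n --> \oo] --> c ^+ 2.
  by apply: future_variance_cvg => // n; case: (KP n).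
have t2_cvg : t2 n @[n --> \oo] --> (1 - c) ^+ 2 by exact: past_variance_cvg.
have B_cvg (B : R) : B / Num.sqrt n%:R @[n --> \oo] --> (0 : R).
  have : B / Num.sqrt n%:R @[n --> \oo] --> B * 0.
    by apply: cvgM; [exact: cvg_cst|exact: cvg_inv_sqrtn].
  by rewrite mulr0.
have d_cvg (x : nat -> R) l : x n @[n --> \oo] --> l -> `|x n - l| @[n --> \oo] --> (0 : R).
  move=> xl; have : `|x n - l| @[n --> \oo] --> `|l - l|.
    by apply: cvg_norm; apply: cvgB => //; exact: cvg_cst.
  by rewrite subrr normr0.
have K_cvg : Num.sqrt n%:R * E (fun w => `|Z (K n) w - Zoo w|) @[n --> \oo] --> (0 : R).
  apply: (@squeeze_cvgr _ _ _ _ (fun=> 0) (fun n => n.+1%:R^-1)).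
  - near=> n; have [_ ->] := KP n; rewrite andbT mulr_ge0//.
    exact: Ex_ge0.
  - exact: cvg_cst.
  - exact: cvg_harmonic.
have u_cvg : u n @[n --> \oo] --> C * (0 + (0 + 2 * e) * c ^+ 2
    + (0 + 2 * c ^+ 2 * e) + m%:R * 0 + (0 + 2 * e) * (1 - c) ^+ 2
    + (0 + (1 - c) ^+ 2 * e) + c ^+ 2 * e).
  apply: cvgM; first exact: cvg_cst.
  have cst (x : R) : (fun=> x) n @[n --> \oo] --> x by exact: cvg_cst.
  apply: cvgD (cst _); apply: cvgD; last exact: cvgD (d_cvg _ _ t2_cvg) (cst _).
  apply: cvgD; last exact: cvgM (cvgD (B_cvg _) (cst _)) t2_cvg.
  apply: cvgD; last exact: cvgM (cst _) (B_cvg _).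
  apply: cvgD; last exact: cvgD (d_cvg _ _ t1_cvg) (cst _).
  apply: cvgD => //; exact: cvgM (cvgD (B_cvg _) (cst _)) t1_cvg.
have u_le : \forall n \near \oo, u n <= eps.
  apply: (cvgr_le _ u_cvg); rewrite (_ : _ * _ = C * S * e); last by rewrite /S; ring.
  by rewrite /e mulrA ltr_pdivrMr// mulrC ltr_pM2l// ltrDl.
have B_le (B : R) : \forall n \near \oo, B / Num.sqrt n%:R <= 1.
  exact: (cvgr_le 0 (B_cvg B)).
near=> n; rewrite distrC.
have mn : (m0 <= m < n)%N.
  by rewrite leq_maxl; near: n; exact: nbhs_infty_gt.
have nK : (n <= K n)%N.
  have [+ _] := KP n; apply: leq_trans; rewrite -mulnn leq_pmulr//.
  by case/andP: mn => _; exact: leq_ltn_trans.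
have B1n : B1 / Num.sqrt n%:R <= 1 by near: n; exact: B_le.
have B2n : B2 / Num.sqrt n%:R <= 1 by near: n; exact: B_le.
apply: (le_trans (joint_limit_bound B1_gt0 B2_gt0 pB1 fB2 mn nK B1n B2n distm erefl erefl)).
by near: n.
Unshelve. all: by end_near. Qed.

End joint_limit.

(** * From past functions to arbitrary events *)

Section stable_limit.
Variables (v1 v2 a b : R).
Hypotheses (v1_gt0 : 0 < v1) (v2_gt0 : 0 < v2).

Definition limheat w :=
  heat (v1 + c ^+ 2 * limvar w) a * heat (v2 + (1 - c) ^+ 2 * limvar w) b.

Definition heat_defect n w :=
  heat v1 (a - fluctA n w) * heat v2 (b - fluctB n w) - limheat w.

(* The approximation of [heat_defect k] in which Z m stands for Zoo. *)
Definition heat_defect_at m k w :=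
  heat v1 (a - Num.sqrt k%:R * (Z k w - Z m w)) * heat v2 (b - fluctB k w)
  - heat (v1 + c ^+ 2 * cvar m w) a * heat (v2 + (1 - c) ^+ 2 * cvar m w) b.

Let M := 2 * (isqrt v1 * isqrt v2).

Let M_gt0 : 0 < M.
Proof. by rewrite !mulr_gt0 ?isqrt_gt0. Qed.

Let defect_bound (u1 u2 u3 u4 x1 x2 x3 x4 : R) : v1 <= u1 -> v2 <= u2 ->
  v1 <= u3 -> v2 <= u4 ->
  `|heat u1 x1 * heat u2 x2 - heat u3 x3 * heat u4 x4| <= M.
Proof.
move=> u1v u2v u3v u4v; rewrite (le_trans (ler_normB _ _))//.
rewrite /M [leRHS](_ : _ = isqrt v1 * isqrt v2 + isqrt v1 * isqrt v2); last by ring.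
by rewrite lerD// normrM ler_pM// heat_le.
Qed.

Let cc0 : 0 <= c ^+ 2. Proof. exact: sqr_ge0. Qed.
Let dd0 : 0 <= (1 - c) ^+ 2. Proof. exact: sqr_ge0. Qed.

Let le_cvar v y m w : 0 <= y -> v <= v + y * cvar m w.
Proof.
by move=> y0; rewrite lerDl; apply: (mulr_ge0 y0); case/andP: (cvar01 m w).
Qed.

Let le_limvar v y w : 0 <= y -> v <= v + y * limvar w.
Proof.
by move=> y0; rewrite lerDl; apply: (mulr_ge0 y0); case/andP: (limvar01 w).
Qed.

Lemma heat_defect_le n w : `|heat_defect n w| <= M.
Proof. by apply: defect_bound => //; exact: le_limvar. Qed.

Lemma heat_defect_at_le m k w : `|heat_defect_at m k w| <= M.
Proof. by apply: defect_bound => //; exact: le_cvar. Qed.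

Lemma bmfun_limheat : bmfun limheat.
Proof.
apply: bmfunM; apply: bmfun_heat; [exact: v1_gt0| |exact: measurable_cst| |exact: v2_gt0| |exact: measurable_cst|].
- exact: (proj1 (bmfunD (bmfun_cst _ _) (bmfunM (bmfun_cst _ _) bmfun_limvar))).
- by move=> w; exact: le_limvar.
- exact: (proj1 (bmfunD (bmfun_cst _ _) (bmfunM (bmfun_cst _ _) bmfun_limvar))).
- by move=> w; exact: le_limvar.
Qed.

Lemma bmfun_heat_product n :
  bmfun (fun w => heat v1 (a - fluctA n w) * heat v2 (b - fluctB n w)).
Proof.
apply: bmfunM; apply: bmfun_heat; [exact: v1_gt0|exact: measurable_cst| | |exact: v2_gt0|exact: measurable_cst| |] => //.
- apply: (proj1 (bmfunB (bmfun_cst _ _) (bmfunM (bmfun_cst _ _) _))).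
  exact: (bmfunB (bmfun_Z n) bmfun_Zoo).
- exact: (proj1 (bmfunB (bmfun_cst _ _) (adapted_bmfun (adapted_fluctB n)))).
Qed.

Lemma bmfun_heat_defect n : bmfun (heat_defect n).
Proof. exact: (bmfunB (bmfun_heat_product n) bmfun_limheat). Qed.

Lemma adapted_heat_defect_at m k : (k <= m)%N -> adapted m (heat_defect_at m k).
Proof.
move=> km.
have acst (x : R) : adapted m (fun _ : T => x) by exact: bmfun_cst.
have aV : adapted m (cvar m) by exact: adapted_cvar.
apply: bmfunB; apply: bmfunM.
- apply: (adapted_heat v1_gt0 (acst _)) => //.
  apply: (bmfunB (acst a)); apply: (bmfunM (acst _)).
  exact: (bmfunB (adapted_Z km) (adapted_Z (leqnn m))).
- apply: (adapted_heat v2_gt0 (acst _)) => //.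
  exact: (bmfunB (acst b) (sub_bmfun_le km (adapted_fluctB k))).
- apply: (adapted_heat v1_gt0 _ (acst _)) => [|w]; last exact: le_cvar.
  exact: (bmfunD (acst _) (bmfunM (acst _) aV)).
- apply: (adapted_heat v2_gt0 _ (acst _)) => [|w]; last exact: le_cvar.
  exact: (bmfunD (acst _) (bmfunM (acst _) aV)).
Qed.

Let normM_dist (x x' y y' A B : R) : `|x'| <= A -> `|y| <= B ->
  `|x * y - x' * y'| <= B * `|x - x'| + A * `|y - y'|.
Proof.
move=> xX yY; rewrite (_ : _ - _ = y * (x - x') + x' * (y - y')); last by ring.
rewrite (le_trans (ler_normD _ _))// !normrM.
by apply: lerD; exact: ler_wpM2r.
Qed.

(** Lipschitz continuity of [heat] in both arguments. D grows like sqrt k, which is harmless because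
    k is fixed while m tends to infinity. *)
Lemma heat_defect_at_dist k : exists2 D, 0 <= D &
  forall m w, `|heat_defect k w - heat_defect_at m k w| <= D * `|Z m w - Zoo w|.
Proof.
have [W1 W2] := (ltW (isqrt_gt0 v1_gt0), ltW (isqrt_gt0 v2_gt0)).
have [L1 L2] := (heat_lip_cst_ge0 v1_gt0, heat_lip_cst_ge0 v2_gt0).
exists (isqrt v2 * (heat_lip_cst v1 * Num.sqrt k%:R) +
  (isqrt v2 * (heat_lip_cst v1 * c ^+ 2) + isqrt v1 * (heat_lip_cst v2 * (1 - c) ^+ 2))).
  exact: (addr_ge0 (mulr_ge0 W2 (mulr_ge0 L1 (sqrtr_ge0 _)))
    (addr_ge0 (mulr_ge0 W2 (mulr_ge0 L1 cc0)) (mulr_ge0 W1 (mulr_ge0 L2 dd0)))).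
move=> m w; rewrite /heat_defect /limheat /heat_defect_at.
have rearrange (x y z t : R) : x - y - (z - t) = x - z - (y - t) by ring.
rewrite rearrange.
rewrite mulrDl; apply: (le_trans (ler_normB _ _)); apply: lerD.
  rewrite -mulrBl normrM mulrC -!mulrA.
  apply: ler_pM => //; first exact: heat_le.
  apply: (le_trans (heat_lip v1_gt0 _ _ (lexx _) (lexx _))); rewrite subrr normr0 add0r.
  apply: ler_wpM2l; first exact: L1.
  rewrite [in leRHS]distrC -{2}(ger0_norm (sqrtr_ge0 (k%:R : R))) -normrM /fluctA le_eqVlt.
  by apply/orP; left; apply/eqP; congr `|_|; ring.
have dV : `|limvar w - cvar m w| <= `|Z m w - Zoo w| by rewrite distrC cvar_dist.
have h (v y x : R) : 0 < v -> 0 <= y ->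
    `|heat (v + y * limvar w) x - heat (v + y * cvar m w) x|
    <= heat_lip_cst v * y * `|Z m w - Zoo w|.
  move=> v_gt0 y0.
  apply: (le_trans (heat_lip v_gt0 _ _ (le_limvar _ _ y0) (le_cvar _ _ _ y0))).
  rewrite -mulrA; apply: ler_wpM2l; first exact: heat_lip_cst_ge0.
  rewrite subrr normr0 addr0 opprD addrACA subrr add0r -mulrBr normrM (ger0_norm y0).
  exact: ler_wpM2l.
rewrite [leRHS]mulrDl; apply: (le_trans (@normM_dist _ _ _ _ (isqrt v1) (isqrt v2) _ _)).
- by apply: heat_le => //; exact: le_cvar.
- by apply: heat_le => //; exact: le_limvar.
by apply: lerD; rewrite -[leRHS]mulrA; (apply: ler_wpM2l; first by []); exact: h.
Qed.

(** Orthogonality comes from [joint_limit] with f the F_m-measurable proxy of [heat_defect k],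
    divided by M to meet |f| <= 1: the integral of f against the product of heats tends to the
    integral of f against [limheat]. *)
Lemma Ex_heat_defect_event (H : set T) : measurable H ->
  E (fun w => heat_defect n w * \1_H w) @[n --> \oo] --> (0 : R).
Proof.
move=> mH; apply: (@asymptotically_orthogonal_weak _ _ _ _ _ M).
- exact: bmfun_heat_defect.
- exact: heat_defect_le.
- move=> k; apply/cvgr0Pnorm_le => eps eps_gt0.
  have [D D_ge0 distD] := heat_defect_at_dist k.
  have MD_gt0 : 0 < 2 * (M * D + 1) by rewrite mulr_gt0// ltr_wpDl// mulr_ge0// ltW.
  have [N _ distN] : \forall m \near \oo, E (fun w => `|Z m w - Zoo w|) <= eps / (2 * (M * D + 1)).
    by apply: (cvgr_le 0 Ex_distZ_cvg); rewrite divr_gt0.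
  (* m >= k makes the proxy F_m-measurable, m >= N makes the cost of using it at most eps / 2. *)
  pose m := maxn k N.
  have km : (k <= m)%N by exact: leq_maxl.
  have am := adapted_heat_defect_at km.
  have bm := adapted_bmfun am.
  have lim0 : E (fun w => heat_defect n w * heat_defect_at m k w) @[n --> \oo] --> (0 : R).
    have acst (x : R) : adapted m (fun _ : T => x) by exact: bmfun_cst.
    have af : adapted m (fun w => M^-1 * heat_defect_at m k w) by exact: (bmfunM (acst _) am).
    have f1 w : `|M^-1 * heat_defect_at m k w| <= 1.
      by rewrite normrM ger0_norm ?invr_ge0 ?(ltW M_gt0)// mulrC ler_pdivrMr// mul1r heat_defect_at_le.
    have := @joint_limit m _ v1 v2 a b af f1 v1_gt0 v2_gt0.
    have bf := adapted_bmfun af.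
    set l := E _ => jl.
    have : M * (E (fun w => M^-1 * heat_defect_at m k w *
        (heat v1 (a - fluctA n w) * heat v2 (b - fluctB n w))) - l)
        @[n --> \oo] --> M * (l - l).
      apply: cvgM; first exact: cvg_cst.
      exact: (cvgB jl (cvg_cst _)).
    rewrite subrr mulr0; apply: cvg_trans; apply: near_eq_cvg; near=> n.
    rewrite -ExB; last first.
    - exact: (bmfunM bf bmfun_limheat).
    - exact: (bmfunM bf (bmfun_heat_product n)).
    rewrite -ExZ; last first.
      apply: bmfunB; first exact: (bmfunM bf (bmfun_heat_product n)).
      exact: (bmfunM bf bmfun_limheat).
    have cancelM (x y : R) : M * (M^-1 * x * y) = y * x.
      by rewrite -mulrA mulVKf ?gt_eqF// mulrC.
    apply: eq_Ex => w; rewrite -mulrBr -/(limheat w) -/(heat_defect n w).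
    exact: cancelM.
  have half : \forall n \near \oo, `|E (fun w => heat_defect n w * heat_defect_at m k w)| <= eps / 2.
    by move/cvgr0Pnorm_le : lim0; apply; rewrite divr_gt0.
  near=> n.
  rewrite -(subrK (E (fun w => heat_defect n w * heat_defect_at m k w))
    (E (fun w => heat_defect n w * heat_defect k w))).
  apply: (le_trans (ler_normD _ _)); rewrite [eps]splitr lerD//; last by near: n.
  have bD : bmfun (fun w => M * (D * `|Z m w - Zoo w|)).
    exact: (bmfunM (bmfun_cst _ _) (bmfunM (bmfun_cst _ _) (bmfun_distZ m))).
  apply: (@le_trans _ _ (E (fun w => M * (D * `|Z m w - Zoo w|)))).
    apply: norm_ExB => //.
    - exact: (bmfunM (bmfun_heat_defect n) (bmfun_heat_defect k)).
    - exact: (bmfunM (bmfun_heat_defect n) bm).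
    - move=> w; rewrite -mulrBr normrM.
      exact: (ler_pM (normr_ge0 _) (normr_ge0 _) (heat_defect_le n w) (distD m w)).
  rewrite ExZ; last exact: (bmfunM (bmfun_cst _ _) (bmfun_distZ m)).
  rewrite ExZ; last exact: bmfun_distZ.
  rewrite mulrA (le_trans (ler_wpM2l _ (distN m (leq_maxr k N))))//.
    by rewrite mulr_ge0// ltW.
  have MD : 0 <= M * D by rewrite mulr_ge0// ltW.
  have MD1 : 0 < M * D + 1 by rewrite ltr_wpDl.
  rewrite [leLHS](_ : _ = eps / 2 * (M * D / (M * D + 1))); last first.
    by field; rewrite gt_eqF.
  by rewrite ler_piMr ?divr_ge0 ?(ltW eps_gt0)// ler_pdivrMr// mul1r lerDl.
- exact: bmfun_indic.
Unshelve. all: by end_near. Qed.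

End stable_limit.

End reinforced_process.

(** * Integrals of Gaussian densities *)

Section gaussian_integrals.
Context (R : realType).
Local Notation mR := (measurableTypeR R).
Local Notation leb := (@lebesgue_measure R).
Implicit Types (v m s t x y : R).

Definition normal_scale : R := (Num.sqrt (pi *+ 2))^-1.

Lemma normal_scale_gt0 : 0 < normal_scale.
Proof. by rewrite invr_gt0 sqrtr_gt0 pmulrn_lgt0// pi_gt0. Qed.

Lemma normal_pdf_dilate m s y : 0 < s ->
  normal_pdf m s y = normal_scale * dilate s^-1 (y - m).
Proof.
move=> s0; rewrite normal_pdfE ?gt_eqF// /normal_peak /normal_fun /dilate.
rewrite -mulrnAr sqrtrM ?sqr_ge0// sqrtr_sqr gtr0_norm// invfM.
rewrite [s^-1 * _]mulrC -mulrA; congr (_ * (_ * expR _)).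
by field; rewrite gt_eqF.
Qed.

Lemma integral_dilate w m : 0 < w ->
  (\int[leb]_(y in [set: mR]) (normal_scale * dilate w (y - m))%:E = 1)%E.
Proof.
move=> w0; rewrite -(integral_normal_pdf m w^-1); apply: eq_integral => y _.
by rewrite normal_pdf_dilate ?invr_gt0// invrK.
Qed.

(** Completing the square in g: the joint density is the marginal density in x times the conditional
    normal density of g, of mean t x / (v + t^2) and variance v / (v + t^2). The case t = 0 is
    included, which accommodates degenerate limits. *)
Lemma dilate_mul v t x g : 0 < v ->
  heat v (x - t * g) * normal_pdf 0 1 g =
  heat (v + t ^+ 2) x *
    normal_pdf (t * x / (v + t ^+ 2)) (isqrt (v + t ^+ 2) / isqrt v) g.
Proof.
move=> v0; have v0' : 0 < v + t ^+ 2 by rewrite ltr_wpDr// sqr_ge0.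
have [w0 w'0] := (isqrt_gt0 v0, isqrt_gt0 v0').
rewrite !normal_pdf_dilate ?divr_gt0// /heat /dilate.
rewrite invr1 !mul1r subr0 /bell.
rewrite invf_div [LHS](_ : _ = isqrt v * normal_scale *
   (expR (- ((isqrt v * (x - t * g)) ^+ 2 / 2)) * expR (- (g ^+ 2 / 2)))); last by ring.
rewrite [RHS](_ : _ = isqrt v * normal_scale *
  (expR (- ((isqrt (v + t ^+ 2) * x) ^+ 2 / 2)) *
   expR (- ((isqrt v / isqrt (v + t ^+ 2) * (g - t * x / (v + t ^+ 2))) ^+ 2 / 2)))); last first.
  by field; rewrite gt_eqF.
rewrite -!expRD; congr (_ * expR _).
rewrite !exprMn exprVn !sqr_isqrt//.
by field; rewrite !gt_eqF.
Qed.

(** The Radon-Nikodym derivative of the normal law is identified almost everywhere with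
    [normal_pdf], both having the same integral over every measurable set. *)
Lemma integral_normal_prob m s (f : mR -> R) M : s != 0 ->
  measurable_fun [set: mR] f -> (forall x, `|f x| <= M) ->
  (\int[normal_prob m s]_x (f x)%:E =
   \int[leb]_(x in [set: mR]) (f x * normal_pdf m s x)%:E)%E.
Proof.
move=> s0 mf fM.
have intf : (normal_prob m s).-integrable [set: mR] (EFin \o f).
  by apply: (@bmfun_integrable _ _ _ (normal_prob m s)); split => //; exists M.
rewrite -(Radon_Nikodym_change_of_variables (normal_prob_dominates m s))//=.
under [in RHS]eq_integral do rewrite EFinM.
apply: ae_eq_integral => //.
- apply: emeasurable_funM => //; first exact/measurable_EFinP.
  apply: (measurable_int leb).
  by apply: Radon_Nikodym_integrable; exact: normal_prob_dominates.
- apply: emeasurable_funM => //=; apply/measurable_EFinP => //.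
  exact: measurable_normal_pdf.
- apply: ae_eqe_mul2l => /=.
  rewrite Radon_NikodymE//=; first exact: normal_prob_dominates.
  move=> dom; case: cid => /= h [h1 h2 h3].
  apply: integral_ae_eq => //=.
  + by apply/measurable_EFinP; exact: measurable_normal_pdf.
  + by move=> E E01 mE; rewrite -h3.
Qed.

Lemma integral_normal_heat v t x : 0 < v ->
  (\int[normal_prob 0 1]_g (heat v (x - t * g))%:E = (heat (v + t ^+ 2) x)%:E)%E.
Proof.
move=> v0; have v0' : 0 < v + t ^+ 2 by rewrite ltr_wpDr// sqr_ge0.
rewrite (@integral_normal_prob _ _ _ (isqrt v))//; last 2 first.
- apply: (@measurable_heat _ _ mR); first exact: measurable_cst.
  by apply: measurable_funB => //; exact: measurable_funM.
- by move=> g; exact: heat_le.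
under eq_integral do rewrite dilate_mul// EFinM.
rewrite ge0_integralZl//=; last 3 first.
- by apply/measurable_EFinP; exact: measurable_normal_pdf.
- by move=> g _; rewrite lee_fin normal_pdf_ge0.
- by rewrite lee_fin; exact: (heat_ge0 v0').
by rewrite integral_normal_pdf mule1.
Qed.

(** Doubling the variance absorbs the factor |t|, through |z| <= 1 + z^2 / 4 <= exp (z^2 / 4).
    Integrated, it bounds the first absolute moment by that of a constant times a probability
    density, so no moment is computed. *)
Lemma norm_heat_le v t : 0 < v -> `|t| * heat v t <= (isqrt (2 * v))^-1 * heat (2 * v) t.
Proof.
move=> v0; have v20 : 0 < 2 * v by rewrite mulr_gt0.
have w20 := isqrt_gt0 v20; have w0 := isqrt_gt0 v0.
rewrite /heat /dilate [leRHS]mulrA mulVf ?gt_eqF// mul1r mulrA.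
rewrite -{1}(gtr0_norm w0) -normrM [t * _]mulrC.
have -> : bell (isqrt (2 * v) * t) = expR (- ((isqrt v * t) ^+ 2 / 4)).
  rewrite /bell; congr expR; rewrite !exprMn !sqr_isqrt//.
  by field; rewrite gt_eqF.
move: (isqrt v * t) => z.
rewrite /bell [X in _ * expR X](_ : _ = - (z ^+ 2 / 4) + - (z ^+ 2 / 4)); last by field.
rewrite expRD mulrA ler_piMl ?expR_ge0// expRN ler_pdivrMr ?expR_gt0// mul1r.
rewrite (le_trans _ (expR_ge1Dx _))// ler_norml.
have := sqr_ge0 (z / 2 - 1); have := sqr_ge0 (z / 2 + 1).
by rewrite !expr2; lra.
Qed.

End gaussian_integrals.

Lemma integral_prod_mul d1 d2 (T1 : measurableType d1) (T2 : measurableType d2)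
    (R : realType) (m1 : {sigma_finite_measure set T1 -> \bar R})
    (m2 : {sigma_finite_measure set T2 -> \bar R}) (g1 : T1 -> R) (g2 : T2 -> R) :
  measurable_fun [set: T1] g1 -> measurable_fun [set: T2] g2 ->
  (forall x, 0 <= g1 x) -> (forall x, 0 <= g2 x) ->
  (\int[m1 \x m2]_z (g1 z.1 * g2 z.2)%:E =
   \int[m1]_x (g1 x)%:E * \int[m2]_y (g2 y)%:E)%E.
Proof.
move=> mg1 mg2 g1_ge0 g2_ge0.
rewrite (fubini_tonelli1 (fun z => (g1 z.1 * g2 z.2)%:E)); last 2 first.
- apply/measurable_EFinP; apply: measurable_funM.
    exact: (measurableT_comp mg1 measurable_fst).
  exact: (measurableT_comp mg2 measurable_snd).
- by move=> z; rewrite lee_fin mulr_ge0.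
have mg2E : measurable_fun [set: T2] (EFin \o g2) by exact/measurable_EFinP.
have -> : fubini_F m2 (fun z => (g1 z.1 * g2 z.2)%:E) =
    (fun x => (g1 x)%:E * \int[m2]_y (g2 y)%:E)%E.
  apply/funext => x; rewrite /fubini_F/=.
  under eq_integral do rewrite EFinM.
  by rewrite ge0_integralZl// => [y _|]; rewrite lee_fin.
rewrite ge0_integralZr//.
- exact/measurable_EFinP.
- by move=> x _; rewrite lee_fin.
- by apply: integral_ge0 => y _; rewrite lee_fin.
Qed.

(** * Smoothing by Gaussian densities in the plane *)

Section plane_measure.
Context (R : realType).
Local Notation mR := (measurableTypeR R).
Local Notation leb := (@lebesgue_measure R).

(** Named so that it can carry the sigma-finite structure required by the exchanges of integrals
    below; squares of an exhaustion of the line exhaust the plane. *)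
Definition plane_measure : set (mR * mR)%type -> \bar R := (leb \x leb)%E.

HB.instance Definition _ := Measure.on plane_measure.

Let sigma_finite_plane_measure : sigma_finite setT plane_measure.
Proof.
have /sigma_finiteP[F [TF ndF Foo]] := sigma_finiteT leb.
exists (fun n => F n `*` F n) => [|n].
  apply/esym/seteqP; split => // -[x y] _.
  have [[i _ Fx] [j _ Fy]] : (\bigcup_n F n) x /\ (\bigcup_n F n) y by rewrite -TF.
  exists (maxn i j) => //; split.
    by move: x Fx; apply/subsetPset/ndF; exact: leq_maxl.
  by move: y Fy; apply/subsetPset/ndF; exact: leq_maxr.
have [mF Fn] := Foo n; split; first exact: measurableX.
by rewrite /plane_measure product_measure1E// lte_mul_pinfty// ge0_fin_numE.
Qed.

HB.instance Definition _ := Measure_isSigmaFinite.Build _ _ _ plane_measure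
  sigma_finite_plane_measure.

End plane_measure.

Section smoothing.
Context (R : realType).
Local Notation mR := (measurableTypeR R).
Local Notation leb := (@lebesgue_measure R).
Local Notation leb2 := (@plane_measure R).
Variables (v : R) (v_gt0 : 0 < v).

Let g (m t : R) : R := normal_scale R * heat v (t - m).
Let k (m t : R) : R := `|t - m| * g m t.

Let g_ge0 m t : 0 <= g m t.
Proof. by rewrite mulr_ge0 ?(ltW (normal_scale_gt0 R))// (heat_ge0 v_gt0). Qed.

Let k_ge0 m t : 0 <= k m t. Proof. by rewrite mulr_ge0. Qed.

Let kg_ge0 m t m' t' : 0 <= k m t * g m' t'. Proof. exact: mulr_ge0. Qed.

Let gk_ge0 m t m' t' : 0 <= g m t * k m' t'. Proof. exact: mulr_ge0. Qed.

Let mg m : measurable_fun [set: mR] (g m).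
Proof.
apply: measurable_funM => //; apply: (@measurable_heat _ _ mR) => //.
exact: measurable_funB.
Qed.

Let mk m : measurable_fun [set: mR] (k m).
Proof.
apply: measurable_funM => //; apply: measurableT_comp => //.
exact: measurable_funB.
Qed.

Let int_g m : (\int[leb]_(t in [set: mR]) (g m t)%:E = 1)%E.
Proof. exact: (integral_dilate _ (isqrt_gt0 v_gt0)). Qed.

(** This is sqrt (2 v), an upper bound for the first absolute moment of N(0, v). *)
Let dlt : R := (isqrt (2 * v))^-1.

Let v2_gt0 : 0 < 2 * v. Proof. by rewrite mulr_gt0. Qed.

Let dlt_gt0 : 0 < dlt. Proof. by rewrite invr_gt0 isqrt_gt0. Qed.

Let g2v (m t : R) : R := normal_scale R * heat (2 * v) (t - m).

Let g2v_ge0 m t : 0 <= g2v m t.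
Proof. by rewrite mulr_ge0 ?(ltW (normal_scale_gt0 R))// (heat_ge0 v2_gt0). Qed.

Let mg2v m : measurable_fun [set: mR] (g2v m).
Proof.
apply: measurable_funM => //; apply: (@measurable_heat _ _ mR) => //.
exact: measurable_funB.
Qed.

Let int_k m : (\int[leb]_(t in [set: mR]) (k m t)%:E <= dlt%:E)%E.
Proof.
have <- : (\int[leb]_(t in [set: mR]) (dlt%:E * (g2v m t)%:E) = dlt%:E)%E.
  rewrite (ge0_integralZl leb measurableT _ _ _)//.
  - by rewrite (integral_dilate _ (isqrt_gt0 v2_gt0)) mule1.
  - exact/measurable_EFinP.
  - by move=> t _; rewrite lee_fin.
  - by rewrite lee_fin ltW.
apply: ge0_le_integral => //.
- by move=> t _; rewrite lee_fin.
- exact/measurable_EFinP.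
- by apply/measurable_EFinP; exact: measurable_funM.
- move=> t _; rewrite -EFinM lee_fin /k /g /g2v mulrCA [leRHS]mulrCA.
  rewrite ler_wpM2l ?(ltW (normal_scale_gt0 R))//.
  exact: norm_heat_le.
Qed.

(* The law of (x.1 + G, x.2 - x.1 + G'), with G and G' independent centred
   normal variables of variance v, has density [bump x]. *)
Definition bump (x : R * R) (z : mR * mR) : R := g x.1 z.1 * g (x.2 - x.1) z.2.

(** The heat test functions factor in the coordinates (x.1, x.2 - x.1), which correspond to (A_n,
    B_n); [shear] expresses f in them. *)
Definition shear (f : R * R -> R) (z : mR * mR) : R := f (z.1, z.1 + z.2).

(** The expectation of f (x.1 + G, x.2 + G + G') for the noise (G, G') described at [bump]. *)
Definition smooth (f : R * R -> R) (x : R * R) : \bar R :=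
  (\int[leb2]_z (shear f z * bump x z)%:E)%E.

Lemma bump_ge0 x z : 0 <= bump x z. Proof. by rewrite mulr_ge0. Qed.

Lemma measurable_bump_pair d (T : measurableType d) (x : T -> R * R) (z : T -> mR * mR) :
  measurable_fun [set: T] x -> measurable_fun [set: T] z ->
  measurable_fun [set: T] (fun t => bump (x t) (z t)).
Proof.
move=> mx mz.
have mx1 : measurable_fun [set: T] (fun t => (x t).1).
  exact: (measurableT_comp measurable_fst mx).
have mx2 : measurable_fun [set: T] (fun t => (x t).2).
  exact: (measurableT_comp measurable_snd mx).
have mz1 : measurable_fun [set: T] (fun t => (z t).1 : R).
  exact: (measurableT_comp measurable_fst mz).
have mz2 : measurable_fun [set: T] (fun t => (z t).2 : R).
  exact: (measurableT_comp measurable_snd mz).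
by apply: measurable_funM; apply: measurable_funM => //;
  apply: measurable_heat => //; apply: measurable_funB => //; exact: measurable_funB.
Qed.

Lemma measurable_shear f : measurable_fun [set: R * R] f ->
  measurable_fun [set: (mR * mR)%type] (shear f).
Proof.
move=> mf; apply: (measurableT_comp mf).
have m1 : measurable_fun [set: (mR * mR)%type] (fun z : mR * mR => z.1 : R).
  exact: measurable_fst.
have m2 : measurable_fun [set: (mR * mR)%type] (fun z : mR * mR => z.2 : R).
  exact: measurable_snd.
by apply: measurable_fun_pair => //; exact: measurable_funD.
Qed.

Let int_bump x : (\int[leb2]_z (bump x z)%:E = 1)%E.
Proof. by rewrite [LHS]integral_prod_mul// !int_g mule1. Qed.

Let mbumpE x : measurable_fun [set: (mR * mR)%type] (fun z => (bump x z)%:E).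
Proof.
apply/measurable_EFinP; apply: measurable_bump_pair; last exact: measurable_id.
exact: measurable_cst.
Qed.

Let int_cbump (a : R) x : 0 <= a -> (\int[leb2]_z (a%:E * (bump x z)%:E) = a%:E)%E.
Proof.
move=> a_ge0; rewrite (ge0_integralZl leb2 measurableT (mbumpE x) _ (_ : 0 <= a%:E)%E).
- by rewrite int_bump mule1.
- by move=> z _; rewrite lee_fin; exact: bump_ge0.
- by rewrite lee_fin.
Qed.

Section lipschitz.
Variables (f : R * R -> R) (L : R).
Hypotheses (mf : measurable_fun [set: R * R] f) (f_ge0 : forall x, 0 <= f x).
Hypothesis (L_ge0 : 0 <= L).
Hypothesis lipf : forall x y, f x <= f y + L * (`|x.1 - y.1| + `|x.2 - y.2|).

(** The noise of the first coordinate displaces both arguments of f, that of the second only one;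
    hence the weights 2 L and L, and the total 3 L in [int_err]. *)
Let err (x : R * R) (z : mR * mR) : R :=
  2 * L * (k x.1 z.1 * g (x.2 - x.1) z.2) + L * (g x.1 z.1 * k (x.2 - x.1) z.2).

Let merr x : measurable_fun [set: (mR * mR)%type] (EFin \o err x).
Proof.
have m1 (h : mR -> R) : measurable_fun [set: mR] h ->
    measurable_fun [set: (mR * mR)%type] (fun z => h z.1).
  by move=> mh; exact: (measurableT_comp mh measurable_fst).
have m2 (h : mR -> R) : measurable_fun [set: mR] h ->
    measurable_fun [set: (mR * mR)%type] (fun z => h z.2).
  by move=> mh; exact: (measurableT_comp mh measurable_snd).
apply/measurable_EFinP; apply: measurable_funD; apply: measurable_funM => //.
- exact: (measurable_funM (m1 _ (mk _)) (m2 _ (mg _))).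
- exact: (measurable_funM (m1 _ (mg _)) (m2 _ (mk _))).
Qed.

Let err_ge0 x z : 0 <= err x z.
Proof.
exact: (addr_ge0 (mulr_ge0 (mulr_ge0 (ler0n _ 2) L_ge0) (kg_ge0 _ _ _ _))
  (mulr_ge0 L_ge0 (gk_ge0 _ _ _ _))).
Qed.

Let int_err x : (\int[leb2]_z (err x z)%:E <= (3 * L * dlt)%:E)%E.
Proof.
have m1 (h : mR -> R) : measurable_fun [set: mR] h ->
    measurable_fun [set: (mR * mR)%type] (fun z => h z.1).
  by move=> mh; exact: (measurableT_comp mh measurable_fst).
have m2 (h : mR -> R) : measurable_fun [set: mR] h ->
    measurable_fun [set: (mR * mR)%type] (fun z => h z.2).
  by move=> mh; exact: (measurableT_comp mh measurable_snd).
have mkg := measurable_funM (m1 _ (mk x.1)) (m2 _ (mg (x.2 - x.1))).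
have mgk := measurable_funM (m1 _ (mg x.1)) (m2 _ (mk (x.2 - x.1))).
under eq_integral do rewrite /err EFinD (EFinM (2 * L)) (EFinM L).
have L2 : 0 <= 2 * L by rewrite mulr_ge0.
rewrite ge0_integralD//; last 4 first.
- by move=> z _; rewrite -EFinM lee_fin; exact: mulr_ge0 L2 (kg_ge0 _ _ _ _).
- by apply: measurable_funeM; exact/measurable_EFinP.
- by move=> z _; rewrite -EFinM lee_fin; exact: mulr_ge0 L_ge0 (gk_ge0 _ _ _ _).
- by apply: measurable_funeM; exact/measurable_EFinP.
rewrite (ge0_integralZl leb2 measurableT _ _ (_ : 0 <= (2 * L)%:E)%E); last 3 first.
- exact/measurable_EFinP.
- by move=> z _; rewrite lee_fin; exact: kg_ge0.
- by rewrite lee_fin.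
rewrite (ge0_integralZl leb2 measurableT _ _ (_ : 0 <= L%:E)%E); last 3 first.
- exact/measurable_EFinP.
- by move=> z _; rewrite lee_fin; exact: gk_ge0.
- by rewrite lee_fin.
rewrite !integral_prod_mul// !int_g mule1 mul1e.
rewrite (_ : 3 * L * dlt = 2 * L * dlt + L * dlt); last by ring.
by rewrite EFinD !(EFinM _ dlt) leeD// lee_wpmul2l.
Qed.

Let mbump x : measurable_fun [set: (mR * mR)%type] (fun z => bump x z).
Proof. by apply: measurable_bump_pair => //; exact: measurable_cst. Qed.

Let mfb x : measurable_fun [set: (mR * mR)%type] (fun z => shear f z * bump x z).
Proof. by apply: measurable_funM => //; exact: measurable_shear. Qed.

Let fb_ge0 x z : 0 <= shear f z * bump x z.
Proof. exact: mulr_ge0 (f_ge0 _) (bump_ge0 _ _). Qed.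

Let dist_shear (x : R * R) (z : mR * mR) :
  L * (`|z.1 - x.1| + `|z.1 + z.2 - x.2|) * bump x z <= err x z.
Proof.
rewrite /err /bump /k.
rewrite [leRHS](_ : _ = L * (2 * `|z.1 - x.1| + `|z.2 - (x.2 - x.1)|) *
  (g x.1 z.1 * g (x.2 - x.1) z.2)); last by ring.
apply: ler_wpM2r; first exact: mulr_ge0 (g_ge0 _ _) (g_ge0 _ _).
apply: (ler_wpM2l L_ge0).
rewrite mulr_natl mulr2n. rewrite -[leRHS]addrA lerD2l (_ : _ - x.2 = (z.1 - x.1) + (z.2 - (x.2 - x.1))).
  exact: ler_normD.
by ring.
Qed.

Lemma smooth_le x : (smooth f x <= (f x)%:E + (3 * L * dlt)%:E)%E.
Proof.
apply: (@le_trans _ _ (\int[leb2]_z ((f x)%:E * (bump x z)%:E + (err x z)%:E))%E).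
  apply: ge0_le_integral => //.
  - by move=> z _; rewrite lee_fin.
  - exact/measurable_EFinP.
  - apply: emeasurable_funD; last exact: merr.
    by apply: measurable_funeM; exact/measurable_EFinP.
  - move=> z _; rewrite -EFinM -EFinD lee_fin.
    rewrite (le_trans (ler_wpM2r (bump_ge0 _ _) (lipf _ x)))//= mulrDl lerD2l.
    exact: dist_shear.
have h1 z : [set: (mR * mR)%type] z -> (0 <= (f x)%:E * (bump x z)%:E)%E.
  by move=> _; rewrite -EFinM lee_fin; exact: mulr_ge0 (f_ge0 _) (bump_ge0 _ _).
have h2 z : [set: (mR * mR)%type] z -> (0 <= (err x z)%:E)%E.
  by move=> _; rewrite lee_fin; exact: err_ge0.
have mb : measurable_fun [set: (mR * mR)%type] (fun z => (bump x z)%:E).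
  exact/measurable_EFinP.
rewrite (ge0_integralD leb2 measurableT h1 (measurable_funeM _ mb) h2 (merr x)).
by rewrite int_cbump// leeD2l.
Qed.

Lemma smooth_ge x : ((f x)%:E <= smooth f x + (3 * L * dlt)%:E)%E.
Proof.
rewrite -{1}(int_cbump x (f_ge0 x)).
apply: (@le_trans _ _ (\int[leb2]_z ((shear f z * bump x z)%:E + (err x z)%:E))%E).
  apply: ge0_le_integral => //.
  - by move=> z _; rewrite -EFinM lee_fin; exact: mulr_ge0 (f_ge0 _) (bump_ge0 _ _).
  - exact: measurable_funeM _ (mbumpE x).
  - by apply: emeasurable_funD; [exact/measurable_EFinP|exact: merr].
  - move=> z _; rewrite -EFinM -EFinD lee_fin.
    rewrite (le_trans (ler_wpM2r (bump_ge0 _ _) (lipf _ (z.1, z.1 + z.2))))//= mulrDl lerD2l.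
    by rewrite distrC [`|x.2 - _|]distrC; exact: dist_shear.
have h1 z : [set: (mR * mR)%type] z -> (0 <= (shear f z * bump x z)%:E)%E.
  by move=> _; rewrite lee_fin; exact: fb_ge0.
have h2 z : [set: (mR * mR)%type] z -> (0 <= (err x z)%:E)%E.
  by move=> _; rewrite lee_fin; exact: err_ge0.
have mb : measurable_fun [set: (mR * mR)%type] (fun z => (shear f z * bump x z)%:E).
  exact/measurable_EFinP.
rewrite (ge0_integralD leb2 measurableT h1 mb h2 (merr x)).
exact: leeD2l (int_err x).
Qed.

End lipschitz.

(** The measure now enters only through its integrals of [bump], which are multiples of heat test
    integrals. *)
Lemma integral_smooth (mu : probability (R * R)%type R) (f : R * R -> R) :
  measurable_fun [set: R * R] f -> (forall x, 0 <= f x) ->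
  (\int[mu]_x smooth f x = \int[leb2]_z ((shear f z)%:E * \int[mu]_x (bump x z)%:E))%E.
Proof.
move=> mf f_ge0.
have mfb : measurable_fun [set: ((R * R) * (mR * mR))%type]
    (fun p => (shear f p.2 * bump p.1 p.2)%:E).
  apply/measurable_EFinP; apply: measurable_funM.
    exact: (measurableT_comp (measurable_shear mf) measurable_snd).
  by apply: measurable_bump_pair; [exact: measurable_fst|exact: measurable_snd].
have fb0 p : (0 <= (shear f p.2 * bump p.1 p.2)%:E)%E.
  by rewrite lee_fin; exact: mulr_ge0 (f_ge0 _) (bump_ge0 _ _).
transitivity (\int[leb2]_z \int[mu]_x (shear f z * bump x z)%:E)%E.
  exact: (fubini_tonelli _ mfb fb0).
apply: eq_integral => z _.
under eq_integral do rewrite EFinM.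
rewrite ge0_integralZl//.
- by apply/measurable_EFinP; apply: measurable_bump_pair => //; exact: measurable_cst.
- by move=> x _; rewrite lee_fin; exact: bump_ge0.
- by rewrite lee_fin; exact: f_ge0.
Qed.

Lemma bmfun_bump z : bmfun (fun x : R * R => bump x z).
Proof.
split.
  by apply: measurable_bump_pair => //; exact: measurable_cst.
exists (normal_scale R * isqrt v * (normal_scale R * isqrt v)) => x.
have n0 := ltW (normal_scale_gt0 R).
rewrite normrM; apply: ler_pM; rewrite ?normr_ge0// /g normrM (ger0_norm n0);
  by apply: (ler_wpM2l n0); exact: heat_le.
Qed.

Lemma measurable_smooth (f : R * R -> R) :
  measurable_fun [set: R * R] f -> (forall x, 0 <= f x) ->
  measurable_fun [set: R * R] (smooth f).
Proof.
move=> mf f_ge0.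
have mfb : measurable_fun [set: ((R * R) * (mR * mR))%type]
    (fun p => (shear f p.2 * bump p.1 p.2)%:E).
  apply/measurable_EFinP; apply: measurable_funM.
    exact: (measurableT_comp (measurable_shear mf) measurable_snd).
  by apply: measurable_bump_pair; [exact: measurable_fst|exact: measurable_snd].
have fb0 p : (0 <= (shear f p.2 * bump p.1 p.2)%:E)%E.
  by rewrite lee_fin; exact: mulr_ge0 (f_ge0 _) (bump_ge0 _ _).
exact: (@measurable_fun_fubini_tonelli_F _ _ _ _ _ leb2 _ mfb fb0).
Qed.

Lemma smooth_ge0 (f : R * R -> R) x : (forall x, 0 <= f x) -> (0 <= smooth f x)%E.
Proof.
move=> f_ge0; apply: integral_ge0 => z _.
by rewrite lee_fin; exact: mulr_ge0 (f_ge0 _) (bump_ge0 _ _).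
Qed.

End smoothing.

(** * From heat test functions to Lipschitz functions *)

Section weak_convergence.
Context (R : realType).
Local Notation mR := (measurableTypeR R).
Local Notation leb2 := (@plane_measure R).
Variables (mu_ : nat -> probability (R * R)%type R) (nu : probability (R * R)%type R).
Hypothesis heat_cvg : forall v a b, 0 < v ->
  Ex (mu_ n) (fun x => heat v (a - x.1) * heat v (b - (x.2 - x.1))) @[n --> \oo] -->
  Ex nu (fun x => heat v (a - x.1) * heat v (b - (x.2 - x.1))).

(** The smoothed densities converge pointwise, but over a plane of infinite measure and without a
    dominating function; Fatou's lemma still gives a lower bound for every nonnegative f. *)
Lemma smooth_fatou v (f : R * R -> R) : 0 < v ->
  measurable_fun [set: R * R] f -> (forall x, 0 <= f x) ->
  (\int[nu]_x smooth v f x <= limn_einf (fun n => \int[mu_ n]_x smooth v f x))%E.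
Proof.
move=> v0 mf f_ge0.
pose dens (mu : probability (R * R)%type R) z := Ex mu (fun x => bump v x z).
have densE (mu : probability (R * R)%type R) z :
    (\int[mu]_x (bump v x z)%:E = (dens mu z)%:E)%E.
  by rewrite Ex_EFin//; exact: bmfun_bump.
have dens_cvg z : dens (mu_ n) z @[n --> \oo] --> dens nu z.
  have bh : bmfun (fun x : R * R => heat v (z.1 - x.1) * heat v (z.2 - (x.2 - x.1))).
    have [mb _] := bmfun_bump v0 z.
    split.
      by apply: measurable_funM; apply: measurable_heat => //; apply: measurable_funB => //;
        apply: measurable_funB.
    exists (isqrt v * isqrt v) => x; rewrite normrM.
    by apply: ler_pM; rewrite ?normr_ge0//; exact: heat_le.
  have E mu : dens mu z = normal_scale R ^+ 2 *
      Ex mu (fun x => heat v (z.1 - x.1) * heat v (z.2 - (x.2 - x.1))).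
    rewrite -ExZ//; apply: eq_Ex => x; rewrite /bump; ring.
  rewrite E; under eq_fun do rewrite E.
  by apply: cvgM; [exact: cvg_cst|exact: heat_cvg].
have mdens (mu : probability (R * R)%type R) :
    measurable_fun [set: (mR * mR)%type] (fun z => (dens mu z)%:E).
  under eq_fun do rewrite -densE.
  have mb : measurable_fun [set: ((R * R) * (mR * mR))%type] (fun p => (bump v p.1 p.2)%:E).
    apply/measurable_EFinP.
    by apply: measurable_bump_pair; [exact: measurable_fst|exact: measurable_snd].
  have b0 p : (0 <= (bump v p.1 p.2)%:E)%E.
    by rewrite lee_fin; exact: bump_ge0.
  exact: (@measurable_fun_fubini_tonelli_G _ _ _ _ _ mu _ mb b0).
pose h n z := ((shear f z)%:E * (dens (mu_ n) z)%:E)%E.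
have mh n : measurable_fun [set: (mR * mR)%type] (h n).
  by apply: emeasurable_funM => //; apply/measurable_EFinP; exact: measurable_shear.
have h0 n z : [set: (mR * mR)%type] z -> (0 <= h n z)%E.
  move=> _; rewrite /h -EFinM lee_fin; apply: mulr_ge0; first exact: f_ge0.
  by apply: Ex_ge0 => x; exact: bump_ge0.
have -> : (\int[nu]_x smooth v f x = \int[leb2]_z limn_einf (h^~ z))%E.
  rewrite integral_smooth//; apply: eq_integral => z _; rewrite densE.
  have hz : (shear f z * dens (mu_ n) z)%:E @[n --> \oo] --> (shear f z * dens nu z)%:E.
    apply: cvg_EFin; first exact: nearW.
    by apply: cvgM; [exact: cvg_cst|exact: dens_cvg].
  by rewrite -EFinM -(cvg_limn_einf_sup hz).1.
rewrite [X in limn_einf X](_ : _ = (fun n => \int[leb2]_z h n z)%E); last first.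
  apply/funext => n; rewrite integral_smooth//; apply: eq_integral => z _.
  by rewrite densE.
exact: (fatou leb2 measurableT mh h0).
Qed.

Lemma lipschitz_liminf (f : R * R -> R) L e :
  bmfun f -> (forall x, 0 <= f x) -> 0 <= L ->
  (forall x y, f x <= f y + L * (`|x.1 - y.1| + `|x.2 - y.2|)) -> 0 < e ->
  \forall n \near \oo, Ex nu f - e <= Ex (mu_ n) f.
Proof.
move=> bf f_ge0 L_ge0 lipf e_gt0; have [mf [M fM]] := bf.
(* D is to be the value of sqrt (2 v): it makes the smoothing error 3 L D strictly smaller than e /
   2. *)
pose D := e / (2 * (3 * L + 1)).
have L3 : 0 < 3 * L + 1 by rewrite ltr_wpDl// mulr_ge0.
have D_gt0 : 0 < D by rewrite divr_gt0// mulr_gt0.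
pose v := D ^+ 2 / 2.
have v_gt0 : 0 < v by rewrite divr_gt0// exprn_gt0.
have vD : (isqrt (2 * v))^-1 = D.
  have v2 : 2 * v = D ^+ 2 by rewrite /v; field.
  apply/eqP; rewrite -(@eqrXn2 _ 2)// ?invr_ge0 ?(ltW D_gt0)//; last first.
    by rewrite ltW// isqrt_gt0// v2 exprn_gt0.
  by rewrite exprVn sqr_isqrt ?invrK v2// exprn_gt0.
have LD : 3 * L * D < e / 2.
  rewrite /D [ltLHS](_ : _ = e / 2 * (3 * L / (3 * L + 1))); last first.
    by field; rewrite gt_eqF.
  by rewrite gtr_pMr ?divr_gt0// ltr_pdivrMr// mul1r ltrDl.
have c_ge0 : 0 <= 3 * L * D by exact: mulr_ge0 (mulr_ge0 (ler0n _ 3) L_ge0) (ltW D_gt0).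
have mS := measurable_smooth v_gt0 mf f_ge0.
have mfE : measurable_fun [set: R * R] (EFin \o f) by exact/measurable_EFinP.
have S0 x : [set: R * R] x -> (0 <= smooth v f x)%E by move=> _; exact: smooth_ge0.
have mcst (a : \bar R) : measurable_fun [set: R * R] (fun=> a) by exact: measurable_cst.
have fin (mu : probability (R * R)%type R) : (\int[mu]_x (f x)%:E = (Ex mu f)%:E)%E.
  exact: Ex_EFin.
have up (mu : probability (R * R)%type R) :
    (\int[mu]_x smooth v f x <= (Ex mu f + 3 * L * D)%:E)%E.
  have -> : Ex mu f + 3 * L * D = Ex mu (fun x => f x + 3 * L * D).
    by rewrite ExD ?Ex_cst//; exact: bmfun_cst.
  have bfc : bmfun (fun x => f x + 3 * L * D) by exact: (bmfunD bf (bmfun_cst _ _)).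
  rewrite -Ex_EFin//; apply: ge0_le_integral => //.
    by apply/measurable_EFinP; case: bfc.
  by move=> x _; rewrite EFinD -vD; exact: smooth_le.
have low (mu : probability (R * R)%type R) :
    ((Ex mu f - 3 * L * D)%:E <= \int[mu]_x smooth v f x)%E.
  rewrite EFinB leeBlDr// -fin.
  have c0 x : [set: R * R] x -> (0 <= (3 * L * D)%:E)%E by rewrite lee_fin.
  have <- : (\int[mu]_x (smooth v f x + (3 * L * D)%:E) =
      \int[mu]_x smooth v f x + (3 * L * D)%:E)%E.
    rewrite (ge0_integralD mu measurableT S0 mS c0 (mcst _)); congr (_ + _)%E.
    by rewrite Ex_EFin ?Ex_cst//; exact: bmfun_cst.
  apply: ge0_le_integral => //.
  - by move=> x _; rewrite lee_fin.
  - by apply: emeasurable_funD.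
  - by move=> x _; rewrite -vD; exact: smooth_ge.
have := smooth_fatou v_gt0 mf f_ge0.
move=> /(le_trans (low nu)) lim.
(* The slack between 3 L D and e / 2 makes the inequality strict, so that some tail infimum already
   exceeds the left side and the lower limit becomes a statement about all large n. *)
have : ((Ex nu f - e / 2)%:E < ereal_sup (range (einfs (fun n => \int[mu_ n]_x smooth v f x))))%E.
  rewrite -(cvg_lim _ (@cvg_einfs_sup _ _))// -limn_einf_lim (lt_le_trans _ lim)//.
  by rewrite lte_fin; lra.
move=> /ereal_sup_gt[_ [N _ <-]] hN.
exists N => // n /= Nn.
have : (einfs (fun n => \int[mu_ n]_x smooth v f x) N <= \int[mu_ n]_x smooth v f x)%E.
  by apply: ereal_inf_lbound; exists n.
move=> /(lt_le_trans hN)/lt_le_trans/(_ (up (mu_ n))).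
by rewrite lte_fin; lra.
Qed.

End weak_convergence.

(** * Approximating continuous functions by Lipschitz functions from below *)

Section lipschitz_regularization.
Context (R : realType) (f : R * R -> R) (M : R).
Hypotheses (cf : continuous f) (f_ge0 : forall x, 0 <= f x) (fM : forall x, f x <= M).

(** An enumeration of the rational plane; an index that decodes to nothing merely repeats the
    origin. *)
Definition rational_point (n : nat) : R * R :=
  if (unpickle n : option (rat * rat)) is Some p then (ratr p.1, ratr p.2) else (0, 0).

Definition taxicab (x y : R * R) : R := `|x.1 - y.1| + `|x.2 - y.2|.

Lemma taxicab_triangle x y z : taxicab x z <= taxicab x y + taxicab y z.
Proof.
rewrite /taxicab addrACA.
by apply: lerD; exact: ler_distD.
Qed.

Lemma taxicab_ge0 x y : 0 <= taxicab x y. Proof. exact: addr_ge0. Qed.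

Lemma rational_point_dense x e : 0 < e -> exists n, taxicab x (rational_point n) < e.
Proof.
move=> e0; have e2 : 0 < e / 2 by rewrite divr_gt0.
have near_rat (t : R) : exists q : rat, `|t - ratr q| < e / 2.
  have ne : ball t (e / 2) !=set0 by exists t; exact: ballxx.
  by have [y [tq [q _ qy]]] := dense_rat ne (ball_open t (e / 2)); exists q; rewrite qy.
have [p hp] := near_rat x.1; have [q hq] := near_rat x.2.
exists (pickle (p, q)); rewrite /rational_point pickleK/= /taxicab/=.
by rewrite [ltRHS]splitr ltrD.
Qed.

Definition lip_term k x n := f (rational_point n) + k%:R * taxicab x (rational_point n).

(** The inf-convolution of f with k times the taxicab distance, restricted to rational points: as a
    countable infimum it is measurable, and density together with continuity of f keeps it below
    f. *)
Definition lip_reg k x : R := infs (lip_term k x) 0.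

Lemma lip_term_ge0 k x n : 0 <= lip_term k x n.
Proof. by rewrite addr_ge0// mulr_ge0// taxicab_ge0. Qed.

Let has_lb k x : has_lbound (sdrop (lip_term k x) 0).
Proof. by exists 0 => _ [n _ <-]; exact: lip_term_ge0. Qed.

Lemma lip_reg_le_term k x n : lip_reg k x <= lip_term k x n.
Proof. by apply: ge_inf => //; exists n. Qed.

Lemma le_lip_reg k x a : (forall n, a <= lip_term k x n) -> a <= lip_reg k x.
Proof.
move=> h; apply: lb_le_inf; first by exists (lip_term k x 0); exists 0%N.
by move=> _ [n _ <-].
Qed.

Lemma lip_reg_ge0 k x : 0 <= lip_reg k x.
Proof. by apply: le_lip_reg => n; exact: lip_term_ge0. Qed.

Lemma lip_reg_lip k x y : lip_reg k x <= lip_reg k y + k%:R * taxicab x y.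
Proof.
rewrite -lerBlDr; apply: le_lip_reg => n; rewrite lerBlDr.
rewrite (le_trans (lip_reg_le_term k x n))// /lip_term -addrA lerD2l -mulrDr.
by rewrite ler_wpM2l// addrC taxicab_triangle.
Qed.

Let continuity x e : 0 < e -> exists2 dl, 0 < dl &
  forall y, taxicab x y < dl -> `|f x - f y| < e.
Proof.
move=> e0; have /cvgrPdist_lt/(_ _ e0)/nbhs_ballP[dl /= dl0 h] := @cf x.
exists dl => // y xy; apply: h; split => /=; rewrite /ball/=.
  by rewrite (le_lt_trans _ xy)// lerDl.
by rewrite (le_lt_trans _ xy)// lerDr.
Qed.

Lemma lip_reg_le k x : lip_reg k x <= f x.
Proof.
apply/ler_addgt0Pr => e e0; have e2 : 0 < e / 2 by rewrite divr_gt0.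
have [dl dl0 xdl] := continuity x e2.
have k1 : 0 < k%:R + 1 :> R by rewrite ltr_wpDl.
have ek : 0 < e / 2 / (k%:R + 1) by rewrite divr_gt0.
have [n] : exists n, taxicab x (rational_point n) < Num.min dl (e / 2 / (k%:R + 1)).
  by apply: rational_point_dense; rewrite lt_min dl0.
rewrite lt_min => /andP[/xdl]; rewrite ltr_norml => /andP[h1 h2] h3.
rewrite (le_trans (lip_reg_le_term k x n))// /lip_term.
have h4 : k%:R * taxicab x (rational_point n) <= e / 2.
  rewrite ltr_pdivlMr// in h3; rewrite mulrC (le_trans _ (ltW h3))//.
  by rewrite ler_wpM2l ?taxicab_ge0// lerDl.
by rewrite [e]splitr; lra.
Qed.

Lemma lip_reg_cvg x : lip_reg k x @[k --> \oo] --> f x.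
Proof.
apply/cvgrPdist_le => e e0; have [dl dl0 xdl] := continuity x e0.
near=> k; rewrite ger0_norm ?subr_ge0 ?lip_reg_le// lerBlDr -lerBlDl.
apply: le_lip_reg => n; rewrite /lip_term.
have [/xdl|xn] := ltP (taxicab x (rational_point n)) dl.
  rewrite ltr_norml => /andP[_ h].
  have : 0 <= k%:R * taxicab x (rational_point n) by rewrite mulr_ge0// taxicab_ge0.
  by lra.
(* Rational points at distance at least dl then contribute at least M >= f x; the nearer ones are
   handled by continuity. *)
have h1 : M <= k%:R * dl.
  rewrite -ler_pdivrMr//; near: k; exact: nbhs_infty_ger.
have h2 : k%:R * dl <= k%:R * taxicab x (rational_point n) by rewrite ler_wpM2l.
have := f_ge0 (rational_point n); have := fM x; lra.
Unshelve. all: by end_near. Qed.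

Lemma bmfun_lip_reg k : bmfun (lip_reg k).
Proof.
split; last first.
  by exists M => x; rewrite ger0_norm ?lip_reg_ge0// (le_trans (lip_reg_le k x)).
apply: (@measurable_fun_infs _ _ _ _ (fun n x => lip_term k x n)).
- by move=> x _; exists 0 => _ [n _ <-]; exact: lip_term_ge0.
- move=> n; apply: measurable_funD => //; apply: measurable_funM => //.
  by apply: measurable_funD; apply: measurableT_comp => //; apply: measurable_funB.
Qed.

(** The sigma-algebra on the plane is the product one; a continuous f is measurable for it as the
    pointwise limit of the regularisations. *)
Lemma bmfun_continuous_ge0 : bmfun f.
Proof.
split; last by exists M => x; rewrite ger0_norm.
apply: (@measurable_fun_cvg _ _ _ _ lip_reg) => [k|x _]; last exact: lip_reg_cvg.
by case: (bmfun_lip_reg k).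
Qed.

End lipschitz_regularization.

(** * The weak convergence criterion *)

Section weak_convergence_criterion.
Context (R : realType).
Variables (mu_ : nat -> probability (R * R)%type R) (nu : probability (R * R)%type R).
Hypothesis heat_cvg : forall v a b, 0 < v ->
  Ex (mu_ n) (fun x => heat v (a - x.1) * heat v (b - (x.2 - x.1))) @[n --> \oo] -->
  Ex nu (fun x => heat v (a - x.1) * heat v (b - (x.2 - x.1))).

Let liminf (f : R * R -> R) M e : continuous f -> (forall x, 0 <= f x <= M) -> 0 < e ->
  \forall n \near \oo, Ex nu f - e <= Ex (mu_ n) f.
Proof.
move=> cf f0M e0; have e2 : 0 < e / 2 by rewrite divr_gt0.
have f_ge0 x : 0 <= f x by case/andP: (f0M x).
have fM x : f x <= M by case/andP: (f0M x).
have bf := bmfun_continuous_ge0 cf f_ge0 fM.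
have breg := bmfun_lip_reg cf f_ge0 fM.
have lim : Ex nu (lip_reg f k) @[k --> \oo] --> Ex nu f.
  apply: (@Ex_cvg _ _ _ _ _ _ M).
  - by move=> k; case: (breg k).
  - by case: bf.
  - move=> k x; rewrite ger0_norm ?lip_reg_ge0//.
    exact: le_trans (lip_reg_le cf f_ge0 k x) (fM x).
  - by apply: aeW => x; exact: (lip_reg_cvg cf f_ge0 fM).
have [k _ hk] : \forall k \near \oo, Ex nu f - Ex nu (lip_reg f k) <= e / 2.
  move/cvgrPdist_le : lim => /(_ _ e2); apply: filterS => k.
  by apply: le_trans; exact: ler_norm.
have := lipschitz_liminf heat_cvg (breg k) (lip_reg_ge0 f_ge0 k) (ler0n R k)
  (lip_reg_lip f_ge0 k) e2.
apply: filterS => n hn.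
have h1 := hk k (leqnn k).
have h2 : Ex (mu_ n) (lip_reg f k) <= Ex (mu_ n) f.
  by apply: le_Ex => // x; exact: lip_reg_le.
by rewrite [e]splitr; lra.
Qed.

(** Only lower bounds for nonnegative functions are available. Applied to M + f and M - f they bound
    the lower and the upper limit, since all measures, the limit included, have total mass 1. *)
Lemma weak_cvg_heat : weak_cvg mu_ nu.
Proof.
move=> f cf [M fM].
have cfD (s : R) : continuous (fun x => s * f x + M).
  move=> x; apply: cvgD; last exact: cvg_cst.
  by apply: cvgM; [exact: cvg_cst|exact: cf].
have f0M (s : R) x : `|s| = 1 -> 0 <= s * f x + M <= 2 * M.
  by move=> s1; have : `|s * f x| <= M; [rewrite normrM s1 mul1r|rewrite ler_norml; lra].
have n1 : `|1| = 1 :> R by rewrite normr1.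
have nN1 : `|-1| = 1 :> R by rewrite normrN1.
have bfM := bmfun_continuous_ge0 (cfD 1) (fun x => proj1 (andP (f0M 1 x n1)))
  (fun x => proj2 (andP (f0M 1 x n1))).
have bf : bmfun f.
  have := bmfunB bfM (bmfun_cst _ M).
  by congr bmfun; apply/funext => x; rewrite mul1r addrK.
have ED (mu : probability (R * R)%type R) s : Ex mu (fun x => s * f x + M) = s * Ex mu f + M.
  have bsf : bmfun (fun x => s * f x) by apply: bmfunM => //; exact: bmfun_cst.
  by rewrite ExD// ?Ex_cst ?ExZ//; exact: bmfun_cst.
rewrite Ex_EFin//; under eq_fun do rewrite Ex_EFin//.
apply: cvg_EFin; first exact: nearW.
apply/cvgrPdist_le => e e0.
have l1 := liminf (cfD 1) (fun x => f0M 1 x n1) e0.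
have l2 := liminf (cfD (-1)) (fun x => f0M (-1) x nN1) e0.
apply: filterS2 l1 l2 => n; rewrite !ED ler_norml/=; lra.
Qed.

End weak_convergence_criterion.

Lemma Ex_indic d (T : measurableType d) (R : realType) (P : probability T R)
    (A : set T) : measurable A ->
  Ex P (\1_A) = fine (P A).
Proof.
move=> mA; apply: EFin_inj; rewrite -Ex_EFin; last exact: bmfun_indic.
by rewrite integral_indic// setIT fineK// fin_num_measure.
Qed.

(** * Conditional laws, mixtures and Gaussian kernels *)

Section change_of_measure.
Context d (T : measurableType d) (R : realType).

Lemma Ex_cond_proba (P : probability T R) (H : set T) (mH : measurable H) (f : T -> R) :
  (0 < P H)%E -> bmfun f ->
  Ex (cond_proba P mH) f = (fine (P H))^-1 * Ex P (fun w => f w * \1_H w).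
Proof.
move=> PH bf; have b1 := @bmfun_indic _ T R H mH.
apply: (@bounded_linear_ext _ _ _ _
  (fun f => (fine (P H))^-1 * Ex P (fun w => f w * \1_H w))
  (bounded_linear_Ex _) _ _ f bf).
  split.
  - move=> g h bg bh; rewrite -mulrDr -ExD; last 2 first.
    + exact: (bmfunM bg b1).
    + exact: (bmfunM bh b1).
    by congr (_ * _); apply: eq_Ex => w; rewrite mulrDl.
  - move=> a g bg; rewrite mulrCA -(ExZ _ _ (bmfunM bg b1)).
    by congr (_ * _); apply: eq_Ex => w; rewrite mulrA.
  - exists `|(fine (P H))^-1| => g M bg gM; rewrite normrM ler_wpM2l//.
    apply: (norm_Ex_cst _ (bmfunM bg b1)) => w.
    rewrite normrM indicE -[leRHS]mulr1 ler_pM//.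
    by case: (_ \in _); rewrite ?normr1 ?normr0.
move=> A mA; rewrite Ex_indic// cond_probaE//.
rewrite fineM ?fin_num_measure//; last exact: measurableI.
rewrite mulrC/= -(Ex_indic P (measurableI _ _ mA mH)).
by congr (_ * _); apply: eq_Ex => w; rewrite indicI.
Qed.

Context d' (T' : measurableType d').

Lemma bmfun_comp (Y : {mfun T >-> T'}) (f : T' -> R) : bmfun f -> bmfun (fun w => f (Y w)).
Proof.
move=> [mf [M fM]]; split; first exact: (measurableT_comp mf).
by exists M.
Qed.

Lemma Ex_distribution (P : probability T R) (Y : {mfun T >-> T'}) (f : T' -> R) :
  bmfun f -> Ex (distribution P Y) f = Ex P (fun w => f (Y w)).
Proof.
move=> bf; apply: EFin_inj; rewrite -!Ex_EFin//; last exact: bmfun_comp.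
have mf : measurable_fun [set: T'] (EFin \o f) by apply/measurable_EFinP; case: bf.
rewrite (integral_distribution mf)//.
exact: (bmfun_integrable P (bmfun_comp Y bf)).
Qed.

Section mixture.
Variables (Q : probability T R) (K : R.-pker T ~> T') (k : T -> probability T' R).
Hypothesis Kk : forall w U, measurable U -> K w U = k w U.

Lemma bmfun_Ex_kernel (f : T' -> R) : bmfun f -> bmfun (fun w => Ex (k w) f).
Proof.
move=> bf; have [mf [M fM]] := bf; split; last first.
  by exists M => w; exact: norm_Ex_cst.
have bM := bmfun_cst T' (M : R).
(* Adding M makes the integrand nonnegative, as the measurability of kernel integrals requires. *)
have -> : (fun w => Ex (k w) f) = (fun w => Ex (k w) (fun x => f x + M) - M).
  by apply/funext => w; rewrite ExD// Ex_cst addrK.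
apply: measurable_funB => //; apply: (measurableT_comp (fine_measurable measurableT)).
apply: measurable_fun_integral_kernel.
- move=> U mU; rewrite (_ : (fun w => k w U) = (fun w => K w U)).
    exact: measurable_kernel.
  by apply/funext => w; rewrite Kk.
- by move=> x; rewrite lee_fin; have := fM x; rewrite ler_norml; lra.
- apply/measurable_EFinP; exact: measurable_funD.
Qed.

Lemma Ex_mixture (f : T' -> R) : bmfun f ->
  Ex (mixture Q K) f = Ex Q (fun w => Ex (k w) f).
Proof.
apply: (@bounded_linear_ext _ _ _ _ (fun f => Ex Q (fun w => Ex (k w) f))).
- exact: bounded_linear_Ex.
- split.
  - move=> g h bg bh; rewrite -ExD; [|exact: bmfun_Ex_kernel..].
    by apply: eq_Ex => w; rewrite ExD.
  - move=> a g bg; rewrite -ExZ; last exact: bmfun_Ex_kernel.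
    by apply: eq_Ex => w; rewrite ExZ.
  - exists 1 => g M bg gM; rewrite mul1r.
    by apply: norm_Ex_cst => [|w]; [exact: bmfun_Ex_kernel|exact: norm_Ex_cst].
- move=> A mA; have bA := @bmfun_indic _ T' R A mA.
apply: EFin_inj; rewrite -(Ex_EFin (mixture Q K) bA) -(Ex_EFin Q (bmfun_Ex_kernel bA)).
rewrite integral_indic// setIT.
by apply: eq_integral => w _; rewrite Kk// Ex_indic// fineK// fin_num_measure.
Qed.

End mixture.
End change_of_measure.

Section gaussian_kernel.
Context (R : realType).
Implicit Types v a b : R.

Definition heat_test v1 v2 a b (x : R * R) : R :=
  heat v1 (a - x.1) * heat v2 (b - (x.2 - x.1)).

Lemma bmfun_heat_test v1 v2 a b : 0 < v1 -> 0 < v2 -> bmfun (heat_test v1 v2 a b).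
Proof.
move=> v1_gt0 v2_gt0; apply: bmfunM.
  apply: (bmfun_heat v1_gt0) => //.
  by apply: measurable_funB => //; exact: measurable_fst.
apply: (bmfun_heat v2_gt0) => //.
by apply: measurable_funB => //; apply: measurable_funB; [exact: measurable_snd|exact: measurable_fst].
Qed.

(* The Cholesky factor of V (c^2, c^2; c^2, c^2 + (c - 1)^2) is
   (s, 0; s, t) with s^2 = V c^2 and t^2 = V (c - 1)^2. *)
Lemma normal2_heat (V c v1 v2 a b : R) : 0 <= V -> 0 < v1 -> 0 < v2 ->
  Ex (normal2 (V *: mx2 (c ^+ 2) (c ^+ 2) (c ^+ 2) (c ^+ 2 + (c - 1) ^+ 2)))
    (heat_test v1 v2 a b) =
  heat (v1 + c ^+ 2 * V) a * heat (v2 + (1 - c) ^+ 2 * V) b.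
Proof.
move=> V0 v1_gt0 v2_gt0; set S := V *: _.
pose s := Num.sqrt (V * c ^+ 2); pose t := Num.sqrt (V * (c - 1) ^+ 2).
have s2 : s ^+ 2 = V * c ^+ 2 by rewrite sqr_sqrtr// mulr_ge0// sqr_ge0.
have t2 : t ^+ 2 = V * (c - 1) ^+ 2 by rewrite sqr_sqrtr// mulr_ge0// sqr_ge0.
(* This includes y = 0, because 0^-1 = 0; the Cholesky entries are therefore right for a vanishing
   variance too. *)
have VcK (x y : R) : y ^+ 2 = x -> x / y = y.
  move=> <-; have [->|y0] := eqVneq y 0; first by rewrite invr0 mulr0.
  by rewrite expr2 mulfK.
have S00 : S 0 0 = V * c ^+ 2 by rewrite !mxE.
have S01 : S 0 1 = V * c ^+ 2 by rewrite !mxE.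
have S11 : S 1 1 = V * (c ^+ 2 + (c - 1) ^+ 2) by rewrite !mxE.
have C00 : cholesky2 S 0 0 = s by rewrite mxE /= S00.
have C01 : cholesky2 S 0 1 = 0 by rewrite mxE.
have C10 : cholesky2 S 1 0 = s by rewrite mxE /= S00 S01; exact: VcK.
have C11 : cholesky2 S 1 1 = t.
  rewrite mxE /= S00 S01 S11 [X in _ - X](VcK _ _ erefl).
  by rewrite /t; congr Num.sqrt; ring.
have bt := bmfun_heat_test a b v1_gt0 v2_gt0.
rewrite (Ex_distribution _ _ bt); apply: EFin_inj; rewrite -(Ex_EFin _ (bmfun_comp _ bt)).
(* The normal vector is (s G, s G + t G'), so the difference of its coordinates is t G' and the
   integral splits into a product. *)
transitivity (\int[(normal_prob (0 : R) 1 \x normal_prob (0 : R) 1)%E]_z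
    (heat v1 (a - s * z.1) * heat v2 (b - t * z.2))%:E)%E.
  apply: eq_integral => z _; congr (_%:E).
  rewrite /heat_test /mulmx2 /= C00 C01 C10 C11.
  by congr (heat _ _ * heat _ _); ring.
have mh v x u : 0 < v -> measurable_fun [set: measurableTypeR R] (fun g => heat v (x - u * g)).
  move=> v0; apply: measurable_heat; first exact: measurable_cst.
  by apply: measurable_funB => //; exact: measurable_funM.
rewrite (integral_prod_mul _ _ (mh v1 a s v1_gt0) (mh v2 b t v2_gt0)).
- rewrite (integral_normal_heat s a v1_gt0) (integral_normal_heat t b v2_gt0) -EFinM s2 t2 (mulrC V) (mulrC V).
  by rewrite -[(c - 1) ^+ 2]sqrrN opprB.
- by move=> x; exact: (heat_ge0 v1_gt0).
- by move=> x; exact: (heat_ge0 v2_gt0).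
Qed.

End gaussian_kernel.

Lemma ae_eq_Ex d (T : measurableType d) (R : realType) (P : probability T R) (f g : T -> R) :
  bmfun f -> bmfun g -> {ae P, forall w, f w = g w} -> Ex P f = Ex P g.
Proof.
move=> bf bg fg; apply: EFin_inj; rewrite -(Ex_EFin P bf) -(Ex_EFin P bg).
apply: ae_eq_integral => //.
- by apply/measurable_EFinP; case: bf.
- by apply/measurable_EFinP; case: bg.
- by apply: filterS fg => w fgw _ /=; rewrite fgw.
Qed.

Lemma empirical_meanE d (T : measurableType d) (R : realType)
    (X : nat -> {mfun T >-> R}) n w :
  empirical_mean X n w = emp (fun k => X k : T -> R) n w.
Proof.
rewrite /emp -(big_add1 _ _ 0%N n.+1 xpredT (fun k => X k w)).
change (n%:R^-1 * (\sum_(1 <= k < n.+1) X k : {mfun T >-> R}) w =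
  n%:R^-1 * \sum_(1 <= k < n.+1) X k w).
congr (_ * _); elim/big_rec2: _ => //= k y f _ <-.
by [].
Qed.

Lemma eval_mx_scale d (T : measurableType d) (R : realType) (V : {mfun T >-> R})
    (A : 'M[R]_2) w :
  eval_mx (V *: map_mx (@cst_mfun R d T) A) w = V w *: A.
Proof. by apply/matrixP => i j; rewrite !mxE. Qed.

(** * The natural filtration and the conclusion *)

Section natural_filtration.
Context d (T : measurableType d) (R : realType).
Variables (Z0 : T -> R) (X : nat -> T -> R).

(** The generators alone, so that <<s past_events n>> unfolds to [natural_filtration];
    [sub_measurable] takes generators as its argument. *)
Definition past_events (n : nat) : set_system T :=
  preimage_set_system [set: T] Z0 measurable `|`
  \bigcup_(k in [set k | (1 <= k <= n)%N]) preimage_set_system [set: T] (X k) measurable.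

Lemma past_events_measurable n : measurable_fun [set: T] Z0 ->
  (forall k, measurable_fun [set: T] (X k)) -> <<s past_events n >> `<=` measurable.
Proof.
move=> mZ0 mX; apply: smallest_sub; first exact: sigma_algebra_measurable.
by move=> _ [[B mB <-]|[k _ [B mB <-]]]; [exact: mZ0|exact: mX].
Qed.

Lemma past_events_le m n : (m <= n)%N -> <<s past_events m >> `<=` <<s past_events n >>.
Proof.
move=> mn; apply: sub_sigma_algebra2 => A [?|[k /= /andP[k1 km] Ak]]; first by left.
by right; exists k => //=; rewrite k1 (leq_trans km).
Qed.

Lemma past_events_adapted n : sub_measurable (past_events n.+1) (X n.+1).
Proof.
move=> _ B mB; apply: sub_sigma_algebra; right; exists n.+1 => /=; first by rewrite leqnn.
by exists B.
Qed.

End natural_filtration.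

Theorem theorem3p3 (R : realType) (d : measure_display) (T : measurableType d)
    (P : probability T R) (c : R) (r : nat -> R)
    (Z X : nat -> {RV P >-> R}) (Zoo : {RV P >-> R})
    (c_gt0 : 0 < c)
    (r_itv : forall n, 0 <= r n < 1)
    (r_lim : n%:R * r n @[n --> \oo] --> c)
    (Z0_itv : forall w, 0 <= Z 0%N w <= 1)
    (X01 : forall n w, (1 <= n)%N -> X n w = 0 \/ X n w = 1)
    (Z_rec : forall n w, (1 <= n)%N ->
      Z n w = (1 - r n.-1) * Z n.-1 w + r n.-1 * X n w)
    (X_law : forall n,
      is_cond_prob P (natural_filtration (Z 0%N) (fun k => X k : T -> R) n)
        (X n.+1 @^-1` [set 1]) (Z n))
    (Zoo_lim : {ae P, forall w, Z n w @[n --> \oo] --> Zoo w}) :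
  stable_cvg P
    (fun n => mfun_pair (Num.sqrt n%:R *: (Z n - Zoo))
                        (Num.sqrt n%:R *: (empirical_mean X n - Zoo)))
    (normal2_kernel
      ((Zoo * (1 - Zoo)) *:
       map_mx (@cst_mfun R d T)
         (mx2 (c ^+ 2) (c ^+ 2)
              (c ^+ 2) (c ^+ 2 + (c - 1) ^+ 2)))).
Proof.
pose Zf n : T -> R := Z n; pose Xf n : T -> R := X n.
pose G n := past_events (Zf 0%N) Xf n.
have G_meas n : <<s G n >> `<=` measurable.
  by apply: past_events_measurable => [|k]; exact: measurable_funPT.
(* Adaptedness of Z is contained in [X_law]: a version of a conditional probability is measurable
   for the conditioning sigma-algebra. *)
have Z_adapted n : sub_measurable (G n) (Zf n).
  by have [mZ _ _] := X_law n; move=> _ B mB; rewrite setTI; exact: mZ.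
have Z01 n w : 0 <= Zf n w <= 1.
  elim: n => [|n /andP[Z0 Z1]]; first exact: Z0_itv.
  rewrite /Zf Z_rec//= -/(Zf n w); have /andP[r0 /ltW r1] := r_itv n.
  have r1' : 0 <= 1 - r n by rewrite subr_ge0.
  have X0 : 0 <= X n.+1 w <= 1 by case: (X01 n.+1 w isT) => ->; rewrite lexx ler01.
  have /andP[X0' X1] := X0.
  rewrite addr_ge0 ?(mulr_ge0 r1' Z0) ?(mulr_ge0 r0 X0')//=.
  by have := ler_wpM2l r1' Z1; have := ler_wpM2l r0 X1; lra.
have Zf_rec n w : Zf n.+1 w = Zf n w + r n * innov Zf Xf n w.
  by rewrite /innov /Zf /Xf Z_rec//=; ring.
(* [Zoo_lim] places Zoo in [0, 1] only almost surely, whereas the results on the process ask for it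
   everywhere; the clamped version agrees with Zoo almost surely. *)
pose Zc w := Num.max 0 (Num.min 1 (Zoo w)).
have mZc : measurable_fun [set: T] Zc.
  apply: measurable_maxr; first exact: measurable_cst.
  by apply: measurable_minr; [exact: measurable_cst|exact: measurable_funPT].
have Zc01 w : 0 <= Zc w <= 1.
  by rewrite /Zc le_max lexx/= ge_max ler01/= ge_min lexx.
have ZcE : {ae P, forall w, Zc w = Zoo w}.
  apply: filterS Zoo_lim => w Zw.
  have Zoo0 : 0 <= Zoo w.
    apply: (cvgr_to_ge Zw); apply: nearW => n.
    by case/andP: (Z01 n w).
  have Zoo1 : Zoo w <= 1.
    apply: (cvgr_to_le Zw); apply: nearW => n.
    by case/andP: (Z01 n w).
  by rewrite /Zc min_r// max_r.
have Zc_lim : {ae P, forall w, Zf n w @[n --> \oo] --> Zc w}.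
  by apply: filterS2 Zoo_lim ZcE => w Zw ->.
move=> H mH PH; apply: weak_cvg_heat => v a b v_gt0.
set S := (X in normal2_kernel X).
have bt := bmfun_heat_test a b v_gt0 v_gt0.
pose k w := normal2 (eval_mx S w).
have b1 := @bmfun_indic _ T R H mH.
(* Almost everywhere only: [normal2_heat] needs Zoo (1 - Zoo) >= 0, which may fail where Zc differs
   from Zoo. *)
have kE : {ae P, forall w, Ex (k w) (heat_test v v a b) = limheat c Zc v v a b w}.
  apply: filterS ZcE => w Zw; have /andP[z0 z1] := Zc01 w.
  rewrite /k eval_mx_scale.
  change (Ex (normal2 ((Zoo w * (1 - Zoo w)) *:
    mx2 (c ^+ 2) (c ^+ 2) (c ^+ 2) (c ^+ 2 + (c - 1) ^+ 2))) (heat_test v v a b) =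
    heat (v + c ^+ 2 * (Zc w * (1 - Zc w))) a * heat (v + (1 - c) ^+ 2 * (Zc w * (1 - Zc w))) b).
  rewrite -Zw normal2_heat//.
  by rewrite mulr_ge0// subr_ge0.
have bk : bmfun (fun w => Ex (k w) (heat_test v v a b)).
  exact: (@bmfun_Ex_kernel _ _ _ _ _ (normal2_kernel S) k).
rewrite (Ex_mixture _ (k := k) _ bt)// Ex_cond_proba//.
under eq_fun do rewrite (Ex_distribution _ _ bt) (Ex_cond_proba mH PH (bmfun_comp _ bt)).
apply: cvgMr => //.
pose Y n := mfun_pair (Num.sqrt n%:R *: (Z n - Zoo))
  (Num.sqrt n%:R *: (empirical_mean X n - Zoo)).
have YE n w : Zc w = Zoo w -> heat_test v v a b (Y n w) =
    heat v (a - fluctA Zf Zc n w) * heat v (b - fluctB Zf Xf n w).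
  move=> Zw.
  change (heat v (a - Num.sqrt n%:R * (Z n w - Zoo w)) *
    heat v (b - (Num.sqrt n%:R * (empirical_mean X n w - Zoo w) -
      Num.sqrt n%:R * (Z n w - Zoo w))) =
    heat v (a - fluctA Zf Zc n w) * heat v (b - fluctB Zf Xf n w)).
  rewrite empirical_meanE /fluctA /fluctB Zw.
  by congr (_ * heat v (b - _)); rewrite -mulrBr opprB addrA subrK.
apply/subr_cvg0.
have G_incr m n : (m <= n)%N -> <<s G m >> `<=` <<s G n >> by exact: past_events_le.
have X_adapted n : sub_measurable (G n.+1) (Xf n.+1) by exact: past_events_adapted.
have Xf01 n w : Xf n.+1 w = 0 \/ Xf n.+1 w = 1 by exact: X01.
have bd n : bmfun (heat_defect Zf Xf c Zc v v a b n).
  exact: (bmfun_heat_defect G_meas G_incr Z_adapted X_adapted Z01 Xf01 c Zf_rec mZc Zc01 a b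
    v_gt0 v_gt0).
(* The factor 1 / P(H) is gone, and the difference of the two expectations is the integral of
   [heat_defect] over H, up to the null set where Zc differs from Zoo. *)
rewrite [X in X @ _ --> _](_ : _ =
  fun n => Ex P (fun w => heat_defect Zf Xf c Zc v v a b n w * \1_H w)).
  exact: (Ex_heat_defect_event G_meas G_incr Z_adapted X_adapted Z01 Xf01 X_law
    r_lim Zf_rec mZc Zc01 Zc_lim a b v_gt0 v_gt0 mH).
apply/funext => n; have bYH := bmfunM (bmfun_comp (Y n) bt) b1.
rewrite -(ExB _ bYH (bmfunM bk b1)).
apply: (ae_eq_Ex (bmfunB bYH (bmfunM bk b1)) (bmfunM (bd n) b1)).
apply: filterS2 ZcE kE => w Zw kw.
by rewrite -mulrBl /heat_defect (YE _ _ Zw) kw.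
Qed.
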